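(* Let $\mathcal{C}$ be a semi-abelian category satisfying condition (UA), let $B$ be an object of $\mathcal{C}$, and assume that $\mathbf{PXMod}_B(\mathcal{C})$ has enough (regular) projectives. Any short exact sequence $$0\to (K,\partial_K)\xrightarrow{\,f\,}(X,\partial_X)\xrightarrow{\,g\,}(Y,\partial_Y)\to 0$$ in $\mathbf{PXMod}_B(\mathcal{C})$, with $p\colon(P,\partial_P)\to(X,\partial_X)$ a projective presentation of $(X,\partial_X)$, induces a five-term exact sequence $$\frac{K[p]\wedge\langle P,P\rangle}{\langle P,K[p]\rangle}\to\frac{K[gp]\wedge\langle P,P\rangle}{\langle P,K[gp]\rangle}\to\frac{K}{\langle K,X\rangle}\to\frac{X}{\langle X,X\rangle}\xrightarrow{\ \overline g\ }\frac{Y}{\langle Y,Y\rangle}$$ in $\mathbf{PXMod}_B(\mathcal{C})$, where the morphism $\overline g$ is a regular epimorphism.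
   Context: Internal actions. Let $\mathcal{C}$ be a semi-abelian category. For objects $B,X$, $B\flat X$ denotes the kernel of $[1,0]\colon B+X\to B$; $B\flat(-)$ is the functor part of a monad on $\mathcal{C}$, and an internal $B$-action on $X$ is an algebra $\xi\colon B\flat X\to X$ of this monad. For $u\colon A\to B$, $v\colon X\to Y$, $u\flat v\colon A\flat X\to B\flat Y$ is the restriction of $u+v$. Internal $B$-actions are equivalent to points over $B$ (split epimorphisms onto $B$ with a chosen section): $\xi$ corresponds to $p_B\colon X\rtimes_\xi B\to B$ with section $i_B$ and kernel $j_X\colon X\to X\rtimes_\xi B$, where $j_X\xi=[i_B,j_X]\ker[1,0]$. The pullback action of $\xi$ along $u\colon A\to B$ is $u^*(\xi)=\xi\cdot(u\flat 1_X)$. The conjugation action $\chi\colon B\flat B\to B$ is the restriction of $[1,1]\colon B+B\to B$ to $B\flat B$. Condition (UA): for every cospan $f\colon A\to B$, $g\colon C\to B$ in $\mathcal{C}$ that is jointly extremal epimorphic, and for all internal actions $\xi_1\colon A\flat X\to X$, $\xi_2\colon C\flat X\to X$, $\xi_3,\xi_4\colon B\flat X\to X$ on a same object $X$ with $\xi_3(f\flat 1)=\xi_1=\xi_4(f\flat 1)$ and $\xi_3(g\flat 1)=\xi_2=\xi_4(g\flat 1)$, one has $\xi_3=\xi_4$. Precrossed modules. A precrossed $B$-module in $\mathcal{C}$ is a pair $(\partial\colon X\to B,\xi)$ with $\xi\colon B\flat X\to X$ an internal action and $\partial\xi=\chi(1\flat\partial)$; it is abbreviated $(X,\partial)$. A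 morphism $(\partial,\xi)\to(\partial',\xi')$ is a morphism $f\colon X\to Y$ with $\partial'f=\partial$ and $f\xi=\xi'(1\flat f)$. These form the category $\mathbf{PXMod}_B(\mathcal{C})$, equivalent to the category $\mathbf{RG}_B(\mathcal{C})$ of internal reflexive graphs $(d,c\colon X_1\to B, e\colon B\to X_1)$, $de=1=ce$, over the fixed object $B$: a reflexive graph is sent to $X=K[d]$, $\partial=c\cdot\ker(d)$, with the action corresponding to the point $(d,e)$; so $X_1=X\rtimes_\xi B$. The category $\mathbf{PXMod}_B(\mathcal{C})$ is quasi-pointed with initial object $0\to B$; regular epimorphisms are those morphisms whose underlying morphism in $\mathcal{C}$ is a regular epimorphism; the kernel $K[f]$ of $f\colon X\to Y$ (the pullback of the initial object along $f$) has as underlying object the kernel of $f$ in $\mathcal{C}$, with structure morphism $0\colon K[f]\to B$. Peiffer commutator. Let $(\partial\colon X\to B,\xi)$, $(\partial'\colon Y\to B,\xi')$ be precrossed $B$-modules with corresponding reflexive graphs $X_1,Y_1$. Put $X\rtimes Y=X\rtimes_{\partial'^*\xi}Y$, with $j_X\colon X\to X\rtimes Y$, $i_Y\colon Y\to X\rtimes Y$, and the precrossed $B$-module structure that is the normalization of the reflexive graph $X_1\times_BY_1$ (pullback of $d_X$ and $c_Y$, with domain $d_Yp_2$, codomain $c_Xp_1$ and unit $(e_X,e_Y)$); symmetrically $Y\rtimes X=Y\rtimes_{\partial^*\xi'}X$ with $j_Y$, $i_X$. Then $j_X,i_Y,i_X,j_Y$ are morphisms of precrossed modules. Let $X+_{\mathsf{PX}}Y$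 be the coproduct in $\mathbf{PXMod}_B(\mathcal{C})$. The Peiffer product $X\bowtie Y$ is the pushout in $\mathbf{PXMod}_B(\mathcal{C})$ of $[j_X,i_Y]\colon X+_{\mathsf{PX}}Y\to X\rtimes Y$ and $[i_X,j_Y]\colon X+_{\mathsf{PX}}Y\to Y\rtimes X$, and $\Sigma\colon X+_{\mathsf{PX}}Y\to X\bowtie Y$ is the diagonal of this pushout. If $m\colon X\to A$, $n\colon Y\to A$ are precrossed $B$-submodules (monomorphisms in $\mathbf{PXMod}_B(\mathcal{C})$) of $A$, the Peiffer commutator $\langle X,Y\rangle$ is the subobject of $A$ given by the regular image of the kernel of $\Sigma$ along $[m,n]\colon X+_{\mathsf{PX}}Y\to A$. In the claim, $\langle P,P\rangle$ and $\langle P,K[p]\rangle$, $\langle P,K[gp]\rangle$ are taken in $P$, $\langle K,X\rangle$ and $\langle X,X\rangle$ in $X$ ($K$ being a subobject of $X$ via $f$), and $\langle Y,Y\rangle$ in $Y$. A quotient $M/N$ denotes the codomain of the cokernel in $\mathbf{PXMod}_B(\mathcal{C})$ of the inclusion $N\to M$ (with the induced precrossed module structure); $X/\langle X,X\rangle$ is the reflection of $X$ into crossed modules over $B$, and $\overline g$ is the morphism induced by $g$. Exactness. Two composable morphisms $(K,\partial_K)\xrightarrow{f}(X,\partial_X)\xrightarrow{g}(Y,\partial_Y)$ form a short exact sequence if $f=\ker(g)$ and $g$ is a regular epimorphism (then $\partial_K=0$). A diagram $(X_{i-1},\partial_{i-1})\xrightarrow{f_{i-1}}(X_i,\partial_i)\xrightarrow{f_i}(X_{i+1},\partial_{i+1})$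 is exact if, writing $f_k=m_kp_k$ for the (regular epi, mono)-factorization of $f_k$ through its image $I(f_k)$, the sequence $(I(f_{i-1}),\partial_im_{i-1})\xrightarrow{m_{i-1}}(X_i,\partial_i)\xrightarrow{p_i}(I(f_i),\partial_{i+1}m_i)$ is short exact; a longer sequence is exact if each pair of consecutive morphisms is. A projective presentation of $(X,\partial_X)$ is a regular epimorphism $p\colon(P,\partial_P)\to(X,\partial_X)$ in $\mathbf{PXMod}_B(\mathcal{C})$ whose domain is projective with respect to regular epimorphisms. *)

(* Defs.v *)
(* Plain category theory over Rocq's standard library: hom-types are compared
   with Leibniz equality.  Unique choice turns universal properties into
   functions; proof irrelevance (from classical logic) is used to compare
   morphisms of precrossed modules. *)
From Stdlib Require Import Classical ClassicalEpsilon.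

Set Implicit Arguments.
Unset Strict Implicit.
Unset Printing Implicit Defensive.

Definition the (A : Type) (P : A -> Prop) (h : exists! x, P x) : A :=
  proj1_sig (constructive_definite_description P h).

Lemma theP (A : Type) (P : A -> Prop) (h : exists! x, P x) : P (the h).
Proof. exact (proj2_sig (constructive_definite_description P h)). Qed.

Record Category := {
  Ob :> Type;
  Hom : Ob -> Ob -> Type;
  idm : forall X, Hom X X;
  comp : forall X Y Z, Hom Y Z -> Hom X Y -> Hom X Z;
  comp_assoc : forall W X Y Z (h : Hom Y Z) (g : Hom X Y) (f : Hom W X),
    comp (comp h g) f = comp h (comp g f);
  comp_id_l : forall X Y (f : Hom X Y), comp (idm Y) f = f;
  comp_id_r : forall X Y (f : Hom X Y), comp f (idm X) = f
}.

Arguments Hom {c} X Y.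
Arguments idm {c} X.
Arguments comp {c X Y Z} g f.

Declare Scope cat_scope.
Delimit Scope cat_scope with cat.
Notation "X ~> Y" := (Hom X Y) (at level 90, right associativity) : cat_scope.
Notation "g ∘ f" := (comp g f) (at level 40, left associativity) : cat_scope.
Local Open Scope cat_scope.

Definition is_initial (C : Category) (Z : C) : Prop :=
  forall X, exists f : Z ~> X, forall g, g = f.

Definition is_terminal (C : Category) (T : C) : Prop :=
  forall X, exists f : X ~> T, forall g, g = f.

Definition mono (C : Category) (X Y : C) (m : X ~> Y) : Prop :=
  forall W (a b : W ~> X), m ∘ a = m ∘ b -> a = b.

Definition iso (C : Category) (X Y : C) (f : X ~> Y) : Prop :=
  exists g : Y ~> X, g ∘ f = idm X /\ f ∘ g = idm Y.

Definition is_coproduct (C : Category) (X Y S : C) (i : X ~> S) (j : Y ~> S) :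
    Prop :=
  forall W (a : X ~> W) (b : Y ~> W), exists! h : S ~> W, h ∘ i = a /\ h ∘ j = b.

Definition is_pullback (C : Category) (X Y Z P : C)
    (f : X ~> Z) (g : Y ~> Z) (p : P ~> X) (q : P ~> Y) : Prop :=
  f ∘ p = g ∘ q /\
  forall W (a : W ~> X) (b : W ~> Y), f ∘ a = g ∘ b ->
    exists! h : W ~> P, p ∘ h = a /\ q ∘ h = b.

Definition is_pushout (C : Category) (X Y Z Q : C)
    (f : Z ~> X) (g : Z ~> Y) (a : X ~> Q) (b : Y ~> Q) : Prop :=
  a ∘ f = b ∘ g /\
  forall W (u : X ~> W) (v : Y ~> W), u ∘ f = v ∘ g ->
    exists! h : Q ~> W, h ∘ a = u /\ h ∘ b = v.

Definition is_coequalizer (C : Category) (X Y Q : C) (a b : X ~> Y) (q : Y ~> Q) :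
    Prop :=
  q ∘ a = q ∘ b /\
  forall W (h : Y ~> W), h ∘ a = h ∘ b -> exists! k : Q ~> W, k ∘ q = h.

Definition regular_epi (C : Category) (X Y : C) (q : X ~> Y) : Prop :=
  exists (W : C) (a b : W ~> X), is_coequalizer a b q.

(* The following two notions are used both in pointed and in quasi-pointed
   categories: the initial object plays the role of zero, so that a morphism
   with a cokernel must have a domain that maps to the initial object. *)
Definition is_kernel (C : Category) (K X Y : C) (k : K ~> X) (f : X ~> Y) : Prop :=
  exists (Z : C) (z : Z ~> Y) (t : K ~> Z), is_initial Z /\ is_pullback f z k t.

Definition is_cokernel (C : Category) (N M Q : C) (q : M ~> Q) (n : N ~> M) : Prop :=
  exists (Z : C) (z : Z ~> Q) (t : N ~> Z), is_initial Z /\ is_pushout n t q z.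

Definition short_exact (C : Category) (K X Y : C) (f : K ~> X) (g : X ~> Y) : Prop :=
  is_kernel f g /\ regular_epi g.

Definition is_image (C : Category) (X Y I : C)
    (f : X ~> Y) (p : X ~> I) (m : I ~> Y) : Prop :=
  regular_epi p /\ mono m /\ f = m ∘ p.

Definition exact_at (C : Category) (X Y Z : C) (f : X ~> Y) (g : Y ~> Z) : Prop :=
  exists (I J : C) (p : X ~> I) (m : I ~> Y) (p' : Y ~> J) (m' : J ~> Z),
    is_image f p m /\ is_image g p' m' /\ short_exact m p'.

Definition jointly_extremal_epic (C : Category) (X Y Z : C)
    (f : X ~> Z) (g : Y ~> Z) : Prop :=
  forall (M : C) (m : M ~> Z) (f' : X ~> M) (g' : Y ~> M),
    mono m -> f = m ∘ f' -> g = m ∘ g' -> iso m.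

Definition projective (C : Category) (P : C) : Prop :=
  forall (X Y : C) (e : X ~> Y) (h : P ~> Y), regular_epi e ->
    exists h' : P ~> X, e ∘ h' = h.

Definition enough_projectives (C : Category) : Prop :=
  forall X : C, exists (P : C) (p : P ~> X), projective P /\ regular_epi p.

Definition projective_presentation (C : Category) (P X : C) (p : P ~> X) : Prop :=
  projective P /\ regular_epi p.

Definition finitely_complete (C : Category) : Prop :=
  (exists T : C, is_terminal T) /\
  forall (X Y Z : C) (f : X ~> Z) (g : Y ~> Z),
    exists (P : C) (p : P ~> X) (q : P ~> Y), is_pullback f g p q.

Definition regular_category (C : Category) : Prop :=
  finitely_complete C /\
  (forall (X Y R : C) (f : X ~> Y) (r1 r2 : R ~> X), is_pullback f f r1 r2 ->
     exists (Q : C) (q : X ~> Q), is_coequalizer r1 r2 q) /\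
  (forall (X Y Z P : C) (f : X ~> Z) (g : Y ~> Z) (p : P ~> X) (q : P ~> Y),
     is_pullback f g p q -> regular_epi g -> regular_epi p).

Definition equivalence_relation (C : Category) (R X : C) (r1 r2 : R ~> X) : Prop :=
  (forall W (a b : W ~> R), r1 ∘ a = r1 ∘ b -> r2 ∘ a = r2 ∘ b -> a = b) /\
  (exists r : X ~> R, r1 ∘ r = idm X /\ r2 ∘ r = idm X) /\
  (exists s : R ~> R, r1 ∘ s = r2 /\ r2 ∘ s = r1) /\
  (forall (T : C) (t1 t2 : T ~> R), is_pullback r2 r1 t1 t2 ->
     exists t : T ~> R, r1 ∘ t = r1 ∘ t1 /\ r2 ∘ t = r2 ∘ t2).

Definition barr_exact (C : Category) : Prop :=
  regular_category C /\
  forall (R X : C) (r1 r2 : R ~> X), equivalence_relation r1 r2 ->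
    exists (Q : C) (q : X ~> Q), is_pullback q q r1 r2.

(* Bourn's definition: for every v : E ~> B the change-of-base functor from
   points over B to points over E reflects isomorphisms.  Here h is a morphism
   of points over B and k is its image under change of base along v. *)
Definition protomodular (C : Category) : Prop :=
  forall (E B A A' : C) (v : E ~> B)
    (p : A ~> B) (s : B ~> A) (p' : A' ~> B) (s' : B ~> A') (h : A ~> A')
    (D D' : C) (d1 : D ~> E) (d2 : D ~> A) (d1' : D' ~> E) (d2' : D' ~> A')
    (k : D ~> D'),
  p ∘ s = idm B -> p' ∘ s' = idm B -> p' ∘ h = p -> h ∘ s = s' ->
  is_pullback v p d1 d2 -> is_pullback v p' d1' d2' ->
  d1' ∘ k = d1 -> d2' ∘ k = h ∘ d2 ->
  iso k -> iso h.

(* Pointed, Barr exact, Bourn protomodular, with binary coproducts.  A zero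
   object, binary coproducts and kernels are chosen. *)
Record SemiAbelian := {
  sa_cat :> Category;
  zero_ob : sa_cat;
  zero_initial : is_initial zero_ob;
  zero_terminal : is_terminal zero_ob;
  coprod : sa_cat -> sa_cat -> sa_cat;
  in1 : forall X Y, X ~> coprod X Y;
  in2 : forall X Y, Y ~> coprod X Y;
  coprod_is_coproduct : forall X Y, is_coproduct (in1 X Y) (in2 X Y);
  ker_ob : forall (X Y : sa_cat) (f : X ~> Y), sa_cat;
  ker : forall (X Y : sa_cat) (f : X ~> Y), ker_ob f ~> X;
  ker_kernel : forall (X Y : sa_cat) (f : X ~> Y), is_kernel (ker f) f;
  sa_exact : barr_exact sa_cat;
  sa_protomodular : protomodular sa_cat
}.

Arguments in1 {s} X Y.
Arguments in2 {s} X Y.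

Lemma zero_mor_unique (C : SemiAbelian) (X Y : C) :
  exists! f : X ~> Y, exists (a : X ~> zero_ob C) (b : zero_ob C ~> Y), f = b ∘ a.
Proof.
  destruct (zero_terminal X) as [a ha].
  destruct (zero_initial Y) as [b hb].
  exists (b ∘ a). split; [now exists a, b|].
  intros f [a' [b' ->]]. now rewrite (ha a'), (hb b').
Qed.

Definition zero_mor (C : SemiAbelian) (X Y : C) : X ~> Y := the (zero_mor_unique X Y).
Arguments zero_mor {C} X Y.

Lemma zero_mor_factor (C : SemiAbelian) (X Y : C)
    (a : X ~> zero_ob C) (b : zero_ob C ~> Y) : b ∘ a = zero_mor X Y.
Proof.
  destruct (zero_mor_unique X Y) as [f [_ uf]].
  transitivity f; [symmetry|]; apply uf; [now exists a, b|].
  exact (theP (zero_mor_unique X Y)).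
Qed.

Lemma zero_comp_r (C : SemiAbelian) (X Y Z : C) (f : Y ~> Z) :
  f ∘ zero_mor X Y = zero_mor X Z.
Proof.
  destruct (theP (zero_mor_unique X Y)) as [a [b h]].
  fold (zero_mor X Y) in h.
  rewrite h, <- comp_assoc. apply zero_mor_factor.
Qed.

Lemma zero_comp_l (C : SemiAbelian) (X Y Z : C) (f : X ~> Y) :
  zero_mor Y Z ∘ f = zero_mor X Z.
Proof.
  destruct (theP (zero_mor_unique Y Z)) as [a [b h]].
  fold (zero_mor Y Z) in h.
  rewrite h, comp_assoc. apply zero_mor_factor.
Qed.

Definition copair (C : SemiAbelian) (X Y W : C) (f : X ~> W) (g : Y ~> W) :
  coprod X Y ~> W := the (coprod_is_coproduct f g).

Lemma copair_in1 (C : SemiAbelian) (X Y W : C) (f : X ~> W) (g : Y ~> W) :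
  copair f g ∘ in1 X Y = f.
Proof. exact (proj1 (theP (coprod_is_coproduct f g))). Qed.

Lemma copair_in2 (C : SemiAbelian) (X Y W : C) (f : X ~> W) (g : Y ~> W) :
  copair f g ∘ in2 X Y = g.
Proof. exact (proj2 (theP (coprod_is_coproduct f g))). Qed.

Lemma coprod_hom_ext (C : SemiAbelian) (X Y W : C) (a b : coprod X Y ~> W) :
  a ∘ in1 X Y = b ∘ in1 X Y -> a ∘ in2 X Y = b ∘ in2 X Y -> a = b.
Proof.
  intros h1 h2.
  destruct (coprod_is_coproduct (b ∘ in1 X Y) (b ∘ in2 X Y)) as [h [_ u]].
  transitivity h; [symmetry|]; now apply u.
Qed.

Lemma ker_comp (C : SemiAbelian) (X Y : C) (f : X ~> Y) :
  f ∘ ker f = zero_mor (ker_ob f) Y.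
Proof.
  destruct (ker_kernel f) as [Z [z [t [hZ [-> _]]]]].
  destruct (hZ (zero_ob C)) as [a _], (zero_initial Y) as [b _].
  destruct (hZ Y) as [z' hz].
  rewrite (hz z), <- (hz (b ∘ a)), comp_assoc. apply zero_mor_factor.
Qed.

Lemma ker_universal (C : SemiAbelian) (W X Y : C) (f : X ~> Y) (h : W ~> X) :
  f ∘ h = zero_mor W Y -> exists! l : W ~> ker_ob f, ker f ∘ l = h.
Proof.
  intros e. destruct (ker_kernel f) as [Z [z [t [hZ [_ u]]]]].
  destruct (zero_terminal W) as [a ha].
  destruct (zero_initial Z) as [b _].
  destruct (hZ (zero_ob C)) as [c _].
  assert (tz : forall x y : W ~> Z, x = y).
  { assert (bc : b ∘ c = idm Z).
    { destruct (hZ Z) as [i hi]. now rewrite (hi (b ∘ c)), (hi (idm Z)). }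
    intros x y. rewrite <- (comp_id_l x), <- (comp_id_l y), <- bc, !comp_assoc.
    now rewrite (ha (c ∘ x)), (ha (c ∘ y)). }
  destruct (u W h (b ∘ a)) as [l [[hl _] ul]].
  - rewrite e, <- comp_assoc. symmetry. apply zero_mor_factor.
  - exists l. split; [exact hl|].
    intros l' hl'. apply ul. split; [exact hl' | apply tz].
Qed.

Definition ker_lift (C : SemiAbelian) (W X Y : C) (f : X ~> Y) (h : W ~> X)
    (e : f ∘ h = zero_mor W Y) : W ~> ker_ob f :=
  the (ker_universal e).

Lemma ker_lift_comp (C : SemiAbelian) (W X Y : C) (f : X ~> Y) (h : W ~> X)
    (e : f ∘ h = zero_mor W Y) : ker f ∘ ker_lift e = h.
Proof. exact (theP (ker_universal e)). Qed.

Lemma ker_hom_ext (C : SemiAbelian) (W X Y : C) (f : X ~> Y)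
    (a b : W ~> ker_ob f) : ker f ∘ a = ker f ∘ b -> a = b.
Proof.
  intros h.
  assert (e : f ∘ (ker f ∘ b) = zero_mor W Y).
  { rewrite <- comp_assoc, ker_comp. apply zero_comp_l. }
  destruct (ker_universal e) as [l [_ u]].
  transitivity l; [symmetry|]; now apply u.
Qed.

Section Actions.
Context {C : SemiAbelian}.
Implicit Types A B X Y : C.

Definition coprod_map A B X Y (u : A ~> B) (v : X ~> Y) : coprod A X ~> coprod B Y :=
  copair (in1 B Y ∘ u) (in2 B Y ∘ v).

Definition flat B X : C := ker_ob (copair (idm B) (zero_mor X B)).

Definition flat_ker B X : flat B X ~> coprod B X := ker (copair (idm B) (zero_mor X B)).

Lemma flat_ker_comp B X :
  copair (idm B) (zero_mor X B) ∘ flat_ker B X = zero_mor (flat B X) B.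
Proof. apply ker_comp. Qed.

Lemma flat_map_proof A B X Y (u : A ~> B) (v : X ~> Y) :
  copair (idm B) (zero_mor Y B) ∘ (coprod_map u v ∘ flat_ker A X)
  = zero_mor (flat A X) B.
Proof.
  rewrite <- comp_assoc.
  replace (copair (idm B) (zero_mor Y B) ∘ coprod_map u v)
    with (u ∘ copair (idm A) (zero_mor X A)).
  - rewrite comp_assoc, flat_ker_comp. apply zero_comp_r.
  - unfold coprod_map. apply coprod_hom_ext; rewrite !comp_assoc.
    + now rewrite !copair_in1, <- comp_assoc, copair_in1, comp_id_l, comp_id_r.
    + now rewrite !copair_in2, <- comp_assoc, copair_in2, zero_comp_r, zero_comp_l.
Qed.

Definition flat_map A B X Y (u : A ~> B) (v : X ~> Y) : flat A X ~> flat B Y :=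
  ker_lift (flat_map_proof u v).

Definition flat_unit B X : X ~> flat B X := ker_lift (copair_in2 (idm B) (zero_mor X B)).

Lemma flat_mult_proof B X :
  copair (idm B) (zero_mor X B)
    ∘ (copair (in1 B X) (flat_ker B X) ∘ flat_ker B (flat B X))
  = zero_mor (flat B (flat B X)) B.
Proof.
  rewrite <- comp_assoc.
  replace (copair (idm B) (zero_mor X B) ∘ copair (in1 B X) (flat_ker B X))
    with (copair (idm B) (zero_mor (flat B X) B)).
  - apply flat_ker_comp.
  - apply coprod_hom_ext; rewrite !comp_assoc.
    + now rewrite !copair_in1.
    + rewrite !copair_in2. symmetry. apply flat_ker_comp.
Qed.

Definition flat_mult B X : flat B (flat B X) ~> flat B X :=
  ker_lift (flat_mult_proof B X).

(* Algebras of the monad (flat B, flat_unit B, flat_mult B). *)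
Definition is_action B X (xi : flat B X ~> X) : Prop :=
  xi ∘ flat_unit B X = idm X /\
  xi ∘ flat_mult B X = xi ∘ flat_map (idm B) xi.

Definition pullback_action A B X (u : A ~> B) (xi : flat B X ~> X) : flat A X ~> X :=
  xi ∘ flat_map u (idm X).

Definition conjugation B : flat B B ~> B := copair (idm B) (idm B) ∘ flat_ker B B.

(* (p, i) is the point over B corresponding to the action xi, and j is the
   kernel of p; S is then the semidirect product of X and B along xi. *)
Definition is_semidirect B X S (xi : flat B X ~> X)
    (p : S ~> B) (i : B ~> S) (j : X ~> S) : Prop :=
  p ∘ i = idm B /\ is_kernel j p /\ j ∘ xi = copair i j ∘ flat_ker B X.

End Actions.

Definition condition_UA (C : SemiAbelian) : Prop :=
  forall (A B D X : C) (f : A ~> B) (g : D ~> B)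
    (xi1 : flat A X ~> X) (xi2 : flat D X ~> X) (xi3 xi4 : flat B X ~> X),
  jointly_extremal_epic f g ->
  is_action xi1 -> is_action xi2 -> is_action xi3 -> is_action xi4 ->
  pullback_action f xi3 = xi1 -> pullback_action f xi4 = xi1 ->
  pullback_action g xi3 = xi2 -> pullback_action g xi4 = xi2 ->
  xi3 = xi4.

Record PrecrossedModule (C : SemiAbelian) (B : C) := {
  px_ob : C;
  px_bd : px_ob ~> B;
  px_act : flat B px_ob ~> px_ob;
  px_actP : is_action px_act;
  px_precrossed : px_bd ∘ px_act = conjugation B ∘ flat_map (idm B) px_bd
}.

Definition is_px_morphism (C : SemiAbelian) (B : C) (M N : PrecrossedModule B)
    (f : px_ob M ~> px_ob N) : Prop :=
  px_bd N ∘ f = px_bd M /\ f ∘ px_act M = px_act N ∘ flat_map (idm B) f.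

Definition PXHom (C : SemiAbelian) (B : C) (M N : PrecrossedModule B) : Type :=
  { f : px_ob M ~> px_ob N | is_px_morphism f }.

Lemma PXHom_ext (C : SemiAbelian) (B : C) (M N : PrecrossedModule B)
    (f g : PXHom M N) : proj1_sig f = proj1_sig g -> f = g.
Proof.
  destruct f as [f hf], g as [g hg]. simpl. intros <-.
  f_equal. apply proof_irrelevance.
Qed.

Lemma flat_map_ker (C : SemiAbelian) (A B X Y : C) (u : A ~> B) (v : X ~> Y) :
  flat_ker B Y ∘ flat_map u v = coprod_map u v ∘ flat_ker A X.
Proof. apply ker_lift_comp. Qed.

Lemma flat_hom_ext (C : SemiAbelian) (W B X : C) (a b : W ~> flat B X) :
  flat_ker B X ∘ a = flat_ker B X ∘ b -> a = b.
Proof. apply ker_hom_ext. Qed.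

Lemma flat_map_id (C : SemiAbelian) (B X : C) :
  flat_map (idm B) (idm X) = idm (flat B X).
Proof.
  apply flat_hom_ext. rewrite flat_map_ker, comp_id_r.
  replace (coprod_map (idm B) (idm X)) with (idm (coprod B X)); [apply comp_id_l|].
  unfold coprod_map.
  apply coprod_hom_ext; rewrite ?copair_in1, ?copair_in2, comp_id_l, comp_id_r; auto.
Qed.

Lemma flat_map_comp (C : SemiAbelian) (B X Y Z : C) (g : Y ~> Z) (f : X ~> Y) :
  flat_map (idm B) (g ∘ f) = flat_map (idm B) g ∘ flat_map (idm B) f.
Proof.
  apply flat_hom_ext.
  rewrite <- comp_assoc, !flat_map_ker, comp_assoc, flat_map_ker, <- comp_assoc.
  f_equal. unfold coprod_map.
  apply coprod_hom_ext; rewrite !comp_assoc, ?copair_in1, ?copair_in2.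
  - now rewrite <- !comp_assoc, copair_in1, !comp_id_r.
  - now rewrite <- !comp_assoc, copair_in2.
Qed.

Lemma px_id_proof (C : SemiAbelian) (B : C) (M : PrecrossedModule B) :
  is_px_morphism (M := M) (N := M) (idm (px_ob M)).
Proof.
  split; [apply comp_id_r|]. now rewrite flat_map_id, comp_id_l, comp_id_r.
Qed.

Lemma px_comp_proof (C : SemiAbelian) (B : C) (M N L : PrecrossedModule B)
    (g : PXHom N L) (f : PXHom M N) :
  is_px_morphism (M := M) (N := L) (proj1_sig g ∘ proj1_sig f).
Proof.
  destruct f as [f [f1 f2]], g as [g [g1 g2]]. simpl. split.
  - now rewrite <- comp_assoc, g1.
  - rewrite flat_map_comp, comp_assoc, f2, <- comp_assoc, g2.
    apply comp_assoc.
Qed.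

Definition PXMod (C : SemiAbelian) (B : C) : Category.
Proof.
  refine {| Ob := PrecrossedModule B;
            Hom := @PXHom C B;
            idm := fun M => exist _ _ (px_id_proof M);
            comp := fun M N L g f => exist _ _ (px_comp_proof g f) |}.
  - intros. apply PXHom_ext, comp_assoc.
  - intros. apply PXHom_ext, comp_id_l.
  - intros. apply PXHom_ext, comp_id_r.
Defined.

Record ReflexiveGraph (C : SemiAbelian) (B : C) := {
  rg_ob : C;
  rg_dom : rg_ob ~> B;
  rg_cod : rg_ob ~> B;
  rg_unit : B ~> rg_ob;
  rg_dom_unit : rg_dom ∘ rg_unit = idm B;
  rg_cod_unit : rg_cod ∘ rg_unit = idm B
}.

Section Peiffer.
Context {C : SemiAbelian} {B : C}.

Definition underlying (M N : PXMod B) (f : M ~> N) : px_ob M ~> px_ob N := proj1_sig f.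

(* M is the precrossed module corresponding to the reflexive graph G, where
   k : M ~> G is the kernel of the domain morphism of G. *)
Definition is_normalization (G : ReflexiveGraph B) (M : PXMod B)
    (k : px_ob M ~> rg_ob G) : Prop :=
  is_semidirect (px_act M) (rg_dom G) (rg_unit G) k /\ rg_cod G ∘ k = px_bd M.

Definition is_composite_graph (G H L : ReflexiveGraph B)
    (p1 : rg_ob L ~> rg_ob G) (p2 : rg_ob L ~> rg_ob H) : Prop :=
  is_pullback (rg_dom G) (rg_cod H) p1 p2 /\
  rg_dom L = rg_dom H ∘ p2 /\
  rg_cod L = rg_cod G ∘ p1 /\
  p1 ∘ rg_unit L = rg_unit G /\
  p2 ∘ rg_unit L = rg_unit H.

(* S, with j : X ~> S and i : Y ~> S, is the semidirect product of X and Y in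
   precrossed modules.  The underlying object is the semidirect product along
   the pullback of the action of X along the boundary of Y; the precrossed
   structure is the normalization of the composite graph.  The last three
   equations say that the kernel w : S ~> L is the canonical one, induced by
   (1, boundary of Y) : S ~> G and by S ~> Y ~> H. *)
Definition is_px_semidirect (X Y S : PXMod B) (j : X ~> S) (i : Y ~> S) : Prop :=
  exists (p : px_ob S ~> px_ob Y)
    (G H L : ReflexiveGraph B)
    (kX : px_ob X ~> rg_ob G) (kY : px_ob Y ~> rg_ob H) (w : px_ob S ~> rg_ob L)
    (p1 : rg_ob L ~> rg_ob G) (p2 : rg_ob L ~> rg_ob H),
    is_semidirect (pullback_action (px_bd Y) (px_act X))
      p (underlying i) (underlying j) /\
    is_normalization kX /\
    is_normalization kY /\
    is_composite_graph p1 p2 /\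
    is_normalization w /\
    p1 ∘ w ∘ underlying j = kX /\
    p1 ∘ w ∘ underlying i = rg_unit G ∘ px_bd Y /\
    p2 ∘ w = kY ∘ p.

(* T is the coproduct of X and Y, and sigma : T ~> Q is the diagonal of the
   pushout defining the Peiffer product Q of X and Y. *)
Definition is_peiffer_product (X Y T Q : PXMod B)
    (inX : X ~> T) (inY : Y ~> T) (sigma : T ~> Q) : Prop :=
  is_coproduct inX inY /\
  exists (S S' : PXMod B) (jX : X ~> S) (iY : Y ~> S) (jY : Y ~> S') (iX : X ~> S')
    (l : T ~> S) (r : T ~> S') (a : S ~> Q) (b : S' ~> Q),
    is_px_semidirect jX iY /\
    is_px_semidirect jY iX /\
    l ∘ inX = jX /\ l ∘ inY = iY /\
    r ∘ inX = iX /\ r ∘ inY = jY /\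
    is_pushout l r a b /\
    sigma = a ∘ l.

(* c : D ~> A is the Peiffer commutator of the subobjects m and n of A. *)
Definition is_peiffer_commutator (X Y A D : PXMod B)
    (m : X ~> A) (n : Y ~> A) (c : D ~> A) : Prop :=
  mono m /\ mono n /\
  exists (T Q N : PXMod B) (inX : X ~> T) (inY : Y ~> T) (sigma : T ~> Q)
    (mn : T ~> A) (k : N ~> T) (e : N ~> D),
    is_peiffer_product inX inY sigma /\
    mn ∘ inX = m /\ mn ∘ inY = n /\
    is_kernel k sigma /\
    is_image (mn ∘ k) e c.

(* The objects of the five-term sequence, each given by its universal property:
   quot1, ..., quot5 are the projections onto its five terms. *)
Record FiveTermObjects (K X Y P : PXMod B)
    (f : K ~> X) (g : X ~> Y) (p : P ~> X) := {
  ft_Kp : PXMod B;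
  ft_kp : ft_Kp ~> P;
  ft_kpP : is_kernel ft_kp p;
  ft_Kgp : PXMod B;
  ft_kgp : ft_Kgp ~> P;
  ft_kgpP : is_kernel ft_kgp (g ∘ p);

  ft_PP : PXMod B;
  ft_cPP : ft_PP ~> P;
  ft_cPPP : is_peiffer_commutator (idm P) (idm P) ft_cPP;
  ft_PKp : PXMod B;
  ft_cPKp : ft_PKp ~> P;
  ft_cPKpP : is_peiffer_commutator (idm P) ft_kp ft_cPKp;
  ft_PKgp : PXMod B;
  ft_cPKgp : ft_PKgp ~> P;
  ft_cPKgpP : is_peiffer_commutator (idm P) ft_kgp ft_cPKgp;
  ft_KX : PXMod B;
  ft_cKX : ft_KX ~> X;
  ft_cKXP : is_peiffer_commutator f (idm X) ft_cKX;
  ft_XX : PXMod B;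
  ft_cXX : ft_XX ~> X;
  ft_cXXP : is_peiffer_commutator (idm X) (idm X) ft_cXX;
  ft_YY : PXMod B;
  ft_cYY : ft_YY ~> Y;
  ft_cYYP : is_peiffer_commutator (idm Y) (idm Y) ft_cYY;

  ft_M1 : PXMod B;
  ft_m1 : ft_M1 ~> ft_Kp;
  ft_m1' : ft_M1 ~> ft_PP;
  ft_m1P : is_pullback ft_kp ft_cPP ft_m1 ft_m1';
  ft_M2 : PXMod B;
  ft_m2 : ft_M2 ~> ft_Kgp;
  ft_m2' : ft_M2 ~> ft_PP;
  ft_m2P : is_pullback ft_kgp ft_cPP ft_m2 ft_m2';

  ft_n1 : ft_PKp ~> ft_M1;
  ft_n1P : ft_kp ∘ ft_m1 ∘ ft_n1 = ft_cPKp;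
  ft_n2 : ft_PKgp ~> ft_M2;
  ft_n2P : ft_kgp ∘ ft_m2 ∘ ft_n2 = ft_cPKgp;
  ft_n3 : ft_KX ~> K;
  ft_n3P : f ∘ ft_n3 = ft_cKX;

  ft_Q1 : PXMod B;
  quot1 : ft_M1 ~> ft_Q1;
  quot1P : is_cokernel quot1 ft_n1;
  ft_Q2 : PXMod B;
  quot2 : ft_M2 ~> ft_Q2;
  quot2P : is_cokernel quot2 ft_n2;
  ft_Q3 : PXMod B;
  quot3 : K ~> ft_Q3;
  quot3P : is_cokernel quot3 ft_n3;
  ft_Q4 : PXMod B;
  quot4 : X ~> ft_Q4;
  quot4P : is_cokernel quot4 ft_cXX;
  ft_Q5 : PXMod B;
  quot5 : Y ~> ft_Q5;
  quot5P : is_cokernel quot5 ft_cYY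
}.

End Peiffer.

(* Main.v *)
Require Import Defs.
From Stdlib Require Import Classical ClassicalEpsilon.
From Corelib Require Import ssreflect.

(** The sequence is the one that a commutator theory with good formal properties
    always produces. Write <M, N> for the Peiffer commutator in an object A, and
    L for the kernel of a morphism out of A. Three facts are used.

    (1) <M, N> is symmetric, monotone and compatible with regular images: a
    regular epimorphism A -> A' that maps M onto M' and N onto N' maps <M, N>
    onto <M', N'> ([peiffer_commutator_map]).

    (2) <A, L> is contained in L ([peiffer_commutator_null]).

    (3) <A, N> is a kernel in A ([peiffer_commutator_kernel]), so that the
    quotients in the sequence are quotients by kernels.

    Granted these, exactness is a chase with generalized elements, in which
    regular epimorphisms allow one to choose preimages on a cover. Thus <P, P>
    maps onto <X, X>, <X, X> onto <Y, Y> and <P, K[gp]> onto <K, X>; where group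
    theory would multiply an element by an inverse, one uses that the kernel
    pairs of any two morphisms commute ([kernel_pairs_commute]), which holds
    because relations in a protomodular category are difunctional
    ([difunctional]).

    The proof of (1) rests on a description of the morphisms X + Y -> W that
    factor through the semidirect product of X and Y, hence of those that factor
    through the Peiffer product ([peiffer_product_factor]). In reflexive graphs
    the semidirect product is the composite graph of X_1 and Y_1, which as an
    object of C is the semidirect product of X with Y_1, acting through its
    codomain. So the factorization amounts to an equation between two morphisms
    on Y_1 ♭ X ([extends_to_semidirectP]), natural in X and Y; as u ♭ v is
    regular epic when u and v are ([flat_map_regular_epi]), the equation descends
    along regular epimorphisms. Consequently, when X and Y are replaced by
    regular quotients, the Peiffer product is replaced by a pushout, and in an
    exact protomodular category a pushout of regular epimorphisms induces a
    regular epimorphism between kernels ([regular_epi_pushout]). Fact (3) follows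
    from the same property of pushouts, and (2) holds because the equation is
    trivially satisfied when one of the two components is null.

    These arguments take place in the category of precrossed modules, which must
    therefore be known to be Barr exact, protomodular, quasi-pointed and to have
    binary coproducts. Reflexive graphs over B are the objects between B and
    B x B that factor the diagonal, so their category inherits these properties
    from C ([rg_barr_exact], [rg_protomodular]); they are transferred along the
    equivalence between precrossed modules and reflexive graphs
    ([px_graph_equivalence]). Its essential point is that every action has a
    semidirect product ([semidirect_ex]). *)

Set Implicit Arguments.
Unset Strict Implicit.
Unset Printing Implicit Defensive.
Set Bullet Behavior "None".
Local Open Scope cat_scope.

(** * Morphisms and universal properties *)

Lemma comp_eq_r (C : Category) (X Y Z : C) (g : Y ~> Z) (f : X ~> Y) (h : X ~> Z) :
  g ∘ f = h -> forall W (x : W ~> X), g ∘ (f ∘ x) = h ∘ x.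
Proof. by move=> <- W x; rewrite comp_assoc. Qed.

Lemma comp_eq_r3 (C : Category) (X X' Y Z : C) (g : Y ~> Z) (f : X' ~> Y)
    (k : X ~> X') (h : X ~> Z) :
  g ∘ (f ∘ k) = h -> forall W (x : W ~> X), g ∘ (f ∘ (k ∘ x)) = h ∘ x.
Proof. by move=> <- W x; rewrite !comp_assoc. Qed.

(* Composites are kept associated to the right; [crw e] rewrites with an
   equation between composites inside a longer composite. *)
Ltac crw_dir e :=
  rewrite ?comp_assoc;
  first [ rewrite !(comp_eq_r3 e) | rewrite !(comp_eq_r e) | idtac ]; rewrite ?e;
  rewrite ?comp_assoc.
Tactic Notation "crw" constr(e) :=
  let e' := fresh in
  have e' := e; rewrite ?comp_assoc in e'; crw_dir e'; clear e'.
Tactic Notation "crwl" constr(e) :=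
  let e' := fresh in
  have e' := e; symmetry in e'; rewrite ?comp_assoc in e'; crw_dir e'; clear e'.

Section Morphisms.
Context {C : Category}.
Implicit Types A D I J K M N P Q R S T W X Y Z : C.

Lemma pullback_comm X Y Z P (f : X ~> Z) (g : Y ~> Z) (p : P ~> X) (q : P ~> Y) :
  is_pullback f g p q -> f ∘ p = g ∘ q.
Proof. by case. Qed.

Lemma pullback_lift X Y Z P (f : X ~> Z) (g : Y ~> Z) (p : P ~> X) (q : P ~> Y) :
  is_pullback f g p q -> forall W (a : W ~> X) (b : W ~> Y), f ∘ a = g ∘ b ->
  exists h : W ~> P, p ∘ h = a /\ q ∘ h = b.
Proof. by move=> [_ u] W a b e; case: (u W a b e) => h [eh _]; exists h. Qed.

Lemma pullback_ext X Y Z P (f : X ~> Z) (g : Y ~> Z) (p : P ~> X) (q : P ~> Y) :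
  is_pullback f g p q -> forall W (a b : W ~> P),
  p ∘ a = p ∘ b -> q ∘ a = q ∘ b -> a = b.
Proof.
move=> [e u] W a b ep eq.
case: (u W (p ∘ b) (q ∘ b)); first by rewrite -!comp_assoc e.
by move=> h [_ uh]; rewrite -(uh a) ?(uh b).
Qed.

Lemma pullback_intro X Y Z P (f : X ~> Z) (g : Y ~> Z) (p : P ~> X) (q : P ~> Y) :
  f ∘ p = g ∘ q ->
  (forall W (a b : W ~> P), p ∘ a = p ∘ b -> q ∘ a = q ∘ b -> a = b) ->
  (forall W (a : W ~> X) (b : W ~> Y), f ∘ a = g ∘ b ->
     exists h : W ~> P, p ∘ h = a /\ q ∘ h = b) ->
  is_pullback f g p q.
Proof.
move=> e ext lift; split=> // W a b ab; case: (lift W a b ab) => h [ha hb].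
by exists h; split=> // h' [ha' hb']; apply: ext; rewrite ?ha ?hb.
Qed.

Lemma coequalizer_epi X Y Q (a b : X ~> Y) (q : Y ~> Q) :
  is_coequalizer a b q -> forall W (u v : Q ~> W), u ∘ q = v ∘ q -> u = v.
Proof.
move=> [e u] W x y exy.
case: (u W (y ∘ q)); first by rewrite !comp_assoc e.
by move=> k [_ uk]; rewrite -(uk x) // -(uk y).
Qed.

Lemma coequalizer_lift X Y Q (a b : X ~> Y) (q : Y ~> Q) :
  is_coequalizer a b q -> forall W (h : Y ~> W), h ∘ a = h ∘ b ->
  exists k : Q ~> W, k ∘ q = h.
Proof. by move=> [_ u] W h e; case: (u W h e) => k [ek _]; exists k. Qed.

Lemma regular_epi_epi X Y (q : X ~> Y) :
  regular_epi q -> forall W (u v : Y ~> W), u ∘ q = v ∘ q -> u = v.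
Proof. by move=> [V [a [b /coequalizer_epi]]]. Qed.

Lemma regular_epi_mono_diagonal X Y Z W (e : X ~> Y) (m : Z ~> W)
    (u : X ~> Z) (v : Y ~> W) :
  regular_epi e -> mono m -> m ∘ u = v ∘ e ->
  exists d : Y ~> Z, d ∘ e = u /\ m ∘ d = v.
Proof.
move=> re mm E; case: (re) => [V [a [b co]]].
case: (@coequalizer_lift _ _ _ _ _ _ co _ u).
  by apply: mm; crw E; case: co => -> _; crwl E.
move=> d ed; exists d; split=> //.
by apply: (coequalizer_epi co); crw ed.
Qed.

Lemma split_mono_iso X Y (m : X ~> Y) (s : Y ~> X) :
  mono m -> m ∘ s = idm Y -> iso m.
Proof.
move=> mm e; exists s; split=> //; apply: mm.
by crw e; rewrite comp_id_l comp_id_r.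
Qed.

Lemma split_epi_regular X Y (e : X ~> Y) (s : Y ~> X) :
  e ∘ s = idm Y -> regular_epi e.
Proof.
move=> es; exists X, (s ∘ e), (idm X); split.
  by crw es; rewrite comp_id_l comp_id_r.
move=> W h E; exists (h ∘ s); split.
  by rewrite comp_assoc E comp_id_r.
by move=> k <-; crw es; rewrite comp_id_r.
Qed.

Lemma iso_regular_epi X Y (f : X ~> Y) : iso f -> regular_epi f.
Proof. by move=> [g [_ /split_epi_regular]]. Qed.

Lemma retract_mono X Y (m : X ~> Y) (r : Y ~> X) : r ∘ m = idm X -> mono m.
Proof.
by move=> e W a b h; rewrite -(comp_id_l a) -(comp_id_l b) -e !comp_assoc h.
Qed.

Lemma iso_mono X Y (f : X ~> Y) : iso f -> mono f.
Proof.
by move=> [g [/retract_mono h _]].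
Qed.

Lemma mono_comp X Y Z (m : Y ~> Z) (n : X ~> Y) : mono m -> mono n -> mono (m ∘ n).
Proof. by move=> hm hn W a b e; apply/hn/hm; rewrite -!comp_assoc. Qed.

Lemma pushout_sym X Y Z Q (f : Z ~> X) (g : Z ~> Y) (a : X ~> Q) (b : Y ~> Q) :
  is_pushout f g a b -> is_pushout g f b a.
Proof.
move=> [e u]; split=> // W x y E; case: (u W y x) => // h [[h1 h2] uh].
by exists h; split=> // h' [h1' h2']; apply: uh.
Qed.

Lemma pushout_regular_epi X Y Z Q (f : Z ~> X) (g : Z ~> Y) (a : X ~> Q) (b : Y ~> Q) :
  is_pushout f g a b -> regular_epi g -> regular_epi a.
Proof.
move=> [e u] [V [s [t co]]]; exists V, (f ∘ s), (f ∘ t); split.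
  by rewrite -!comp_assoc e !comp_assoc; case: co => ->.
move=> W h eh; case: (coequalizer_lift co (h := h ∘ f)) => [|v ev].
  by rewrite !comp_assoc.
case: (u W h v) => // k [[k1 k2] uk]; exists k; split=> // k' ek'.
apply: uk; split=> //; apply: (coequalizer_epi co).
by rewrite comp_assoc -e -comp_assoc ek' ev.
Qed.

Lemma coproduct_ext X Y S (i : X ~> S) (j : Y ~> S) :
  is_coproduct i j -> forall W (a b : S ~> W), a ∘ i = b ∘ i -> a ∘ j = b ∘ j -> a = b.
Proof.
move=> u W a b ei ej; case: (u W (b ∘ i) (b ∘ j)) => h [_ uh].
by rewrite -(uh a) // -(uh b).
Qed.

Lemma coproduct_lift X Y S (i : X ~> S) (j : Y ~> S) :
  is_coproduct i j -> forall W (a : X ~> W) (b : Y ~> W),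
  exists h : S ~> W, h ∘ i = a /\ h ∘ j = b.
Proof. by move=> u W a b; case: (u W a b) => h [eh _]; exists h. Qed.

Lemma coproduct_sym X Y S (i : X ~> S) (j : Y ~> S) :
  is_coproduct i j -> is_coproduct j i.
Proof.
move=> u W a b; case: (u W b a) => h [[h1 h2] uh].
by exists h; split=> // h' [h1' h2']; apply: uh.
Qed.

Lemma initial_ext (Z : C) : is_initial Z -> forall X (a b : Z ~> X), a = b.
Proof. by move=> hZ X a b; case: (hZ X) => f uf; rewrite (uf a) (uf b). Qed.

End Morphisms.

(** * Regular categories and generalized elements *)

Section Regular.
Context {C : Category} (hC : regular_category C).
Implicit Types A D I J K M N P Q R S T W X Y Z : C.

Lemma pullback_ex X Y Z (f : X ~> Z) (g : Y ~> Z) :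
  exists (P : C) (p : P ~> X) (q : P ~> Y), is_pullback f g p q.
Proof. by case: hC => [[_ h] _]. Qed.

Lemma regular_epi_pullback X Y Z P (f : X ~> Z) (g : Y ~> Z) (p : P ~> X) (q : P ~> Y) :
  is_pullback f g p q -> regular_epi g -> regular_epi p.
Proof. by case: hC => [_ [_ h]]; apply: h. Qed.

(** In arguments with generalized elements this takes the place of choosing a
    preimage: the domain of the element is replaced by a cover of it. *)
Lemma lift_along X Y W (f : X ~> Y) (y : W ~> Y) : regular_epi f ->
  exists (W' : C) (e : W' ~> W) (x : W' ~> X), regular_epi e /\ f ∘ x = y ∘ e.
Proof.
move=> rf; case: (pullback_ex y f) => P [p [q h]].
exists P, p, q; split; first exact: regular_epi_pullback h rf.
by rewrite (pullback_comm h).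
Qed.

Lemma kernel_pair_coequalizer X Y R (q : X ~> Y) (r1 r2 : R ~> X) :
  regular_epi q -> is_pullback q q r1 r2 -> is_coequalizer r1 r2 q.
Proof.
move=> [V [a [b co]]] pb; split; first exact: pullback_comm pb.
move=> W h eh; case: (@pullback_lift _ _ _ _ _ _ _ _ _ pb V a b) => [|l [la lb]].
  by case: co.
case: (@coequalizer_lift _ _ _ _ _ _ _ co W h) => [|k ek].
  by rewrite -la -lb; crw eh.
exists k; split=> // k' ek'.
by apply: (coequalizer_epi co); rewrite ek ek'.
Qed.

Lemma image_ex X Y (f : X ~> Y) :
  exists (I : C) (p : X ~> I) (m : I ~> Y), is_image f p m.
Proof.
case: (pullback_ex f f) => R [r1 [r2 pb]].
case: (hC) => [_ [/(_ _ _ _ _ _ _ pb) [I [q co]] _]].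
case: (coequalizer_lift co (pullback_comm pb)) => m em.
have rq : regular_epi q by exists R, r1, r2.
exists I, q, m; split=> //; split=> // W a b E.
case: (lift_along a rq) => W1 [e1 [a1 [re1 ea]]].
case: (lift_along (b ∘ e1) rq) => W2 [e2 [b2 [re2 eb]]].
apply: (regular_epi_epi re1); apply: (regular_epi_epi re2).
case: (@pullback_lift _ _ _ _ _ _ _ _ _ pb W2 (a1 ∘ e2) b2) => [|h [h1 h2]].
  by rewrite -em; crw ea; crw eb; crw E.
have qr : q ∘ r1 = q ∘ r2 by case: co.
by rewrite comp_assoc; crwl ea; rewrite -h1; crw qr; crw h2; crw eb.
Qed.

Lemma regular_epi_comp X Y Z (g : Y ~> Z) (f : X ~> Y) :
  regular_epi g -> regular_epi f -> regular_epi (g ∘ f).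
Proof.
move=> rg rf; case: (image_ex (g ∘ f)) => I [q [m [rq [mm em]]]].
case: (regular_epi_mono_diagonal rf mm (eq_sym em)) => d [d1 d2].
case: (@regular_epi_mono_diagonal _ _ _ _ _ g m d (idm Z) rg mm).
  by rewrite comp_id_l.
move=> s [s1 s2]; case: (rq) => V [a [b co]]; exists V, a, b.
rewrite em; split; first by rewrite !comp_assoc; case: co => -> _.
move=> W h eh; case: (coequalizer_lift co eh) => k ek.
case: (split_mono_iso mm s2) => t [tm mt].
exists (k ∘ t); split; first by crw tm; rewrite comp_id_l.
move=> k' ek'; apply: (regular_epi_epi (iso_regular_epi (ex_intro _ t (conj tm mt)))).
apply: (coequalizer_epi co); crw ek'; rewrite -ek.
by crw tm; rewrite comp_id_l.
Qed.

Lemma regular_epi_cancel X Y Z (g : Y ~> Z) (f : X ~> Y) :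
  regular_epi (g ∘ f) -> regular_epi g.
Proof.
move=> rgf; case: (image_ex g) => I [q [m [rq [mm em]]]].
case: (@regular_epi_mono_diagonal _ _ _ _ _ (g ∘ f) m (q ∘ f) (idm Z) rgf mm).
  by rewrite comp_id_l em comp_assoc.
move=> s [s1 s2]; rewrite em; apply: regular_epi_comp => //.
exact: iso_regular_epi (split_mono_iso mm s2).
Qed.

Lemma product_ex X Y : exists (P : C) (p : P ~> X) (q : P ~> Y),
  (forall W (a : W ~> X) (b : W ~> Y), exists h : W ~> P, p ∘ h = a /\ q ∘ h = b) /\
  (forall W (a b : W ~> P), p ∘ a = p ∘ b -> q ∘ a = q ∘ b -> a = b).
Proof.
case: (hC) => [[[T hT] _] _]; case: (hT X) => x ux; case: (hT Y) => y uy.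
case: (pullback_ex x y) => P [p [q pb]]; exists P, p, q; split.
  move=> W a b; apply: (pullback_lift pb).
  by case: (hT W) => w uw; rewrite (uw (x ∘ a)) (uw (y ∘ b)).
exact: (pullback_ext pb).
Qed.

Definition jointly_monic X Y R (r1 : R ~> X) (r2 : R ~> Y) : Prop :=
  forall W (a b : W ~> R), r1 ∘ a = r1 ∘ b -> r2 ∘ a = r2 ∘ b -> a = b.

Lemma span_image_ex X Y R (r1 : R ~> X) (r2 : R ~> Y) :
  exists (I : C) (e : R ~> I) (i1 : I ~> X) (i2 : I ~> Y),
    regular_epi e /\ jointly_monic i1 i2 /\ i1 ∘ e = r1 /\ i2 ∘ e = r2.
Proof.
case: (product_ex X Y) => P [p [q [lift ext]]].
case: (lift R r1 r2) => r [er1 er2].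
case: (image_ex r) => I [e [m [re [mm em]]]].
exists I, e, (p ∘ m), (q ∘ m); do 2!split=> //; last first.
  by rewrite !comp_assoc -em.
move=> W a b; rewrite !comp_assoc => h1 h2.
by apply: mm; apply: ext.
Qed.

(** Membership in a relation is a local property, because the relation is
    monic and [e] is a coequalizer. *)
Lemma jointly_monic_local X Y R W W' (r1 : R ~> X) (r2 : R ~> Y) (e : W' ~> W)
    (x : W ~> X) (y : W ~> Y) (d : W' ~> R) :
  jointly_monic r1 r2 -> regular_epi e -> r1 ∘ d = x ∘ e -> r2 ∘ d = y ∘ e ->
  exists d' : W ~> R, r1 ∘ d' = x /\ r2 ∘ d' = y.
Proof.
move=> jm re e1 e2; case: (re) => V [a [b co]].
case: (@coequalizer_lift _ _ _ _ _ _ _ co _ d).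
  by apply: jm; rewrite -!comp_assoc ?e1 ?e2 !comp_assoc; case: co => ->.
move=> d' ed'; exists d'.
by split; apply: (coequalizer_epi co); rewrite comp_assoc ed'.
Qed.

Lemma mono_local X Y W W' (m : X ~> Y) (e : W' ~> W) (y : W ~> Y) (d : W' ~> X) :
  mono m -> regular_epi e -> m ∘ d = y ∘ e -> exists d' : W ~> X, m ∘ d' = y.
Proof.
move=> mm re h; case: (regular_epi_mono_diagonal re mm h) => d' [_ h'].
by exists d'.
Qed.

Lemma coproduct_regular_epi X Y T X' Y' T' (i : X ~> T) (j : Y ~> T)
    (i' : X' ~> T') (j' : Y' ~> T') (x : X ~> X') (y : Y ~> Y') (t : T ~> T') :
  is_coproduct i' j' -> t ∘ i = i' ∘ x -> t ∘ j = j' ∘ y ->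
  regular_epi x -> regular_epi y -> regular_epi t.
Proof.
move=> co ei ej rx ry; case: (image_ex t) => I [q [m [rq [mm em]]]].
have em' : m ∘ q = t by [].
case: (@regular_epi_mono_diagonal _ _ _ _ _ x m (q ∘ i) i' rx mm) => [|a [_ ea]].
  by crw em'.
case: (@regular_epi_mono_diagonal _ _ _ _ _ y m (q ∘ j) j' ry mm) => [|b [_ eb]].
  by crw em'.
case: (coproduct_lift co a b) => s [sa sb].
rewrite -em'; apply: regular_epi_comp rq; apply: iso_regular_epi.
apply: (@split_mono_iso _ _ _ m s) => //.
by apply: (coproduct_ext co); rewrite comp_assoc ?sa ?sb comp_id_l.
Qed.

End Regular.

(** The effectiveness axiom does not ask the quotient map to be regular epic; its
    image part has the same kernel pair. *)
Lemma equivalence_relation_quotient (C : Category) (hE : barr_exact C) (R X : C)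
    (r1 r2 : R ~> X) : equivalence_relation r1 r2 ->
  exists (Q : C) (q : X ~> Q), regular_epi q /\ is_pullback q q r1 r2.
Proof.
case: hE => hC eff /eff [Q0 [q0 pq0]].
case: (image_ex hC q0) => Q [q [m [rq [mm em]]]]; exists Q, q; split=> //.
apply: pullback_intro.
- by apply: mm; crwl em; rewrite (pullback_comm pq0).
- by move=> W a b e1 e2; apply: (pullback_ext pq0).
- by move=> W a b e; apply: (pullback_lift pq0); rewrite em !comp_assoc e.
Qed.

(** * The Mal'cev property and quotients *)

Section Malcev.
Context {C : Category} (hC : regular_category C) (hP : protomodular C).
Implicit Types A D I J K M N P Q R S T W X Y Z : C.

(** Let [A] and [B] be the kernel pairs of the two legs. Then [D] consists of the
    zigzags x I y, x' I y, x' I y', and its subobject [M] of those with x I y'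
    contains the zigzags with x = x' and those with y = y'. The former are the
    fibre of [D] over the diagonal of [A], and the latter the image of a section
    of [D] over [A]; by protomodularity [M] is all of [D]. *)
Lemma difunctional X Y I (i1 : I ~> X) (i2 : I ~> Y) : jointly_monic i1 i2 ->
  forall W (a b c : W ~> I), i2 ∘ a = i2 ∘ b -> i1 ∘ b = i1 ∘ c ->
  exists d : W ~> I, i1 ∘ d = i1 ∘ a /\ i2 ∘ d = i2 ∘ c.
Proof.
move=> jm.
case: (pullback_ex hC i2 i2) => A [a1 [a2 pA]].
case: (pullback_ex hC i1 i1) => B [b1 [b2 pB]].
case: (pullback_ex hC a2 b1) => D [d1 [d2 pD]].
case: (pullback_lift pA (a := idm I) (b := idm I) (eq_refl _)) => sA [sA1 sA2].
case: (pullback_lift pB (a := idm I) (b := idm I) (eq_refl _)) => sB [sB1 sB2].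
case: (pullback_lift pD (a := idm A) (b := sB ∘ a2)) => [|iA [iA1 iA2]].
  by crw sB1; rewrite comp_id_l comp_id_r.
case: (pullback_lift pD (a := sA ∘ b1) (b := idm B)) => [|iB [iB1 iB2]].
  by crw sA2; rewrite comp_id_l comp_id_r.
case: (product_ex hC X Y) => P [p [q [lift ext]]].
case: (lift I i1 i2) => r [r1 r2].
case: (lift D (i1 ∘ a1 ∘ d1) (i2 ∘ b2 ∘ d2)) => s [s1 s2].
case: (pullback_ex hC r s) => M [mr [m pM]].
have mr1 : i1 ∘ mr = i1 ∘ (a1 ∘ (d1 ∘ m)).
  by rewrite -{1}r1; crw (pullback_comm pM); crw s1.
have mr2 : i2 ∘ mr = i2 ∘ (b2 ∘ (d2 ∘ m)).
  by rewrite -{1}r2; crw (pullback_comm pM); crw s2.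
have mm : mono m.
  move=> W a b e; apply: (pullback_ext pM) => //.
  by apply: jm; rewrite -!comp_assoc ?mr1 ?mr2 !comp_assoc e.
case: (pullback_lift pM (a := a1) (b := iA)) => [|uA [_ uA2]].
  apply: ext; rewrite -!comp_assoc ?r1 ?r2 ?s1 ?s2 !comp_assoc.
    by rewrite iA1 comp_id_r.
  by rewrite iA2; crw sB2; rewrite comp_id_l (pullback_comm pA).
case: (pullback_lift pM (a := b2) (b := iB)) => [|uB [_ uB2]].
  apply: ext; rewrite -!comp_assoc ?r1 ?r2 ?s1 ?s2 !comp_assoc.
    by rewrite iB1; crw sA1; rewrite comp_id_l (pullback_comm pB).
  by rewrite iB2 comp_id_r.
have fib : forall W (x : W ~> I) (y : W ~> D), sA ∘ x = d1 ∘ y ->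
    b1 ∘ (d2 ∘ y) = x /\ iB ∘ (d2 ∘ y) = y.
  move=> W x y e.
  have e1 : b1 ∘ (d2 ∘ y) = x.
    by crwl (pullback_comm pD); rewrite -e; crw sA2; rewrite comp_id_l.
  split=> //; apply: (pullback_ext pD).
    by crw iB1; rewrite e1 e.
  by crw iB2; rewrite comp_id_l.
have pM' : is_pullback sA (d1 ∘ m) b1 uB.
{ apply: pullback_intro.
  - by crw uB2; rewrite iB1.
  - move=> W a b _ e; apply: (retract_mono iB2).
    by rewrite -uB2 !comp_assoc e.
  - move=> W x y; rewrite comp_assoc => /fib [e1 e2].
    exists (d2 ∘ (m ∘ y)); split=> //.
    by apply: mm; crw uB2. }
have pD' : is_pullback sA d1 b1 iB.
{ apply: pullback_intro; first by rewrite iB1.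
  - by move=> W a b _; apply: (retract_mono iB2).
  - by move=> W x y /fib [e1 e2]; exists (d2 ∘ y). }
have im : iso m.
{ apply: (hP (v := sA) (p := d1 ∘ m) (s := uA) (p' := d1) (s' := iA) (h := m)
    (k := idm B) _ _ _ _ pM' pD') => //.
  - by crw uA2.
  - by rewrite comp_id_r.
  - by rewrite uB2 comp_id_r.
  - by exists (idm B); rewrite comp_id_l. }
case: im => n [_ mn] W a b c e1 e2.
case: (pullback_lift pA e1) => α [α1 α2].
case: (pullback_lift pB e2) => β [β1 β2].
case: (pullback_lift pD (a := α) (b := β)) => [|δ [δ1 δ2]]; first by rewrite α2 β1.
exists (mr ∘ (n ∘ δ)); split.
- by crw mr1; crw mn; rewrite comp_id_l δ1 α1.
- by crw mr2; crw mn; rewrite comp_id_l δ2 β2.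
Qed.

(** The image of [g] and [q] in the product of their codomains is difunctional.
    Hence a zigzag through [x'] can be replaced, locally, by one that uses the
    two kernel pairs in the other order. *)
Lemma kernel_pairs_commute X Y Z (g : X ~> Y) (q : X ~> Z)
    W (x x' x'' : W ~> X) : g ∘ x = g ∘ x' -> q ∘ x' = q ∘ x'' ->
  exists (W' : C) (e : W' ~> W) (y : W' ~> X),
    regular_epi e /\ q ∘ y = q ∘ x ∘ e /\ g ∘ y = g ∘ x'' ∘ e.
Proof.
move=> eg eq; case: (span_image_ex hC g q) => I [p [i1 [i2 [rp [jm [p1 p2]]]]]].
case: (difunctional jm (a := p ∘ x'') (b := p ∘ x') (c := p ∘ x)).
  by crw p2.
  by crw p1.
move=> d; rewrite -!comp_assoc p1 p2 => -[d1 d2].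
case: (lift_along hC d rp) => W' [e [y [re ey]]]; exists W', e, y; split=> //.
by rewrite -d2 -d1 -p1 -p2 !comp_assoc ey.
Qed.

End Malcev.

Section Quotients.
Context {C : Category} (hE : barr_exact C) (hP : protomodular C).
Implicit Types A D I J K M N P Q R S T W X Y Z : C.
Let hC : regular_category C := proj1 hE.

(** The image of a reflexive pair is an equivalence relation because it is
    difunctional, and equivalence relations are effective. Reflexivity is
    required only after the cover [s]. *)
Lemma reflexive_pair_quotient R X X' (r1 r2 : R ~> X) (s : X' ~> X) (d : X' ~> R) :
  regular_epi s -> r1 ∘ d = s -> r2 ∘ d = s ->
  exists (Q : C) (q : X ~> Q), regular_epi q /\ is_coequalizer r1 r2 q /\
    forall W (x y : W ~> X), q ∘ x = q ∘ y ->
    exists (W' : C) (e : W' ~> W) (r : W' ~> R),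
      regular_epi e /\ r1 ∘ r = x ∘ e /\ r2 ∘ r = y ∘ e.
Proof.
move=> rs d1 d2.
case: (span_image_ex hC r1 r2) => I [p [i1 [i2 [rp [jm [p1 p2]]]]]].
have [δ [δ1 δ2]] : exists δ : X ~> I, i1 ∘ δ = idm X /\ i2 ∘ δ = idm X.
  apply: (jointly_monic_local jm rs (d := p ∘ d)).
    by rewrite -comp_assoc p1 comp_id_l.
  by rewrite -comp_assoc p2 comp_id_l.
have er : equivalence_relation i1 i2.
  split=> //; split; [by exists δ | split].
    case: (difunctional hC hP jm (a := δ ∘ i2) (b := idm I) (c := δ ∘ i1)).
      by crw δ2; rewrite comp_id_l comp_id_r.
      by crw δ1; rewrite comp_id_l comp_id_r.
    move=> t [t1 t2]; exists t; split.
      by rewrite t1; crw δ1; rewrite comp_id_l.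
    by rewrite t2; crw δ2; rewrite comp_id_l.
  move=> T t1 t2 pT.
  case: (difunctional hC hP jm (a := t1) (b := δ ∘ (i2 ∘ t1)) (c := t2)).
    by crw δ2; rewrite comp_id_l.
    by crw δ1; rewrite comp_id_l (pullback_comm pT).
  by move=> t [? ?]; exists t.
case: (equivalence_relation_quotient hE er) => Q [q [rq pq]].
exists Q, q; split=> //; split.
  have [e1 u1] := kernel_pair_coequalizer rq pq.
  split; first by rewrite -p1 -p2; crw e1.
  move=> W h eh; apply: u1; apply: (regular_epi_epi rp).
  by rewrite !comp_assoc p1 p2.
move=> W x y /(pullback_lift pq) [z [z1 z2]].
case: (lift_along hC z rp) => W' [e [r [re er']]]; exists W', e, r.
by rewrite -p1 -p2 !comp_assoc er' -!comp_assoc z1 z2.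
Qed.

(** The pushout is the quotient of [Q] by the image under [s] of the kernel pair
    of [h]. The lifting property, which makes the square a regular pushout,
    combines the description of that quotient with the commutation of the
    kernel pairs of [s] and [h]. *)
Lemma regular_epi_pushout T A Q (h : T ~> A) (s : T ~> Q) :
  regular_epi h -> regular_epi s ->
  exists (P : C) (u : A ~> P) (v : Q ~> P), is_pushout h s u v /\
    regular_epi u /\
    forall W (a : W ~> A) (b : W ~> Q), u ∘ a = v ∘ b ->
    exists (W' : C) (e : W' ~> W) (t : W' ~> T),
      regular_epi e /\ h ∘ t = a ∘ e /\ s ∘ t = b ∘ e.
Proof.
move=> rh rs; case: (pullback_ex hC h h) => R [r1 [r2 pR]].
case: (pullback_lift pR (a := idm T) (b := idm T) (eq_refl _)) => d [d1 d2].
case: (@reflexive_pair_quotient R Q T (s ∘ r1) (s ∘ r2) s d rs).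
  by crw d1; rewrite comp_id_r.
  by crw d2; rewrite comp_id_r.
move=> P [v [rv [cv lv]]].
have [eh uh] := kernel_pair_coequalizer rh pR.
case: (coequalizer_lift (kernel_pair_coequalizer rh pR) (h := v ∘ s)) => [|u eu].
  by rewrite !comp_assoc; case: cv.
exists P, u, v; split; last split.
- split=> // W x y exy.
  case: (coequalizer_lift cv (h := y)) => [|k ek].
    by rewrite -!comp_assoc -exy !comp_assoc eh.
  exists k; split.
    by split=> //; apply: (regular_epi_epi rh); rewrite comp_assoc eu exy -comp_assoc ek.
  by move=> k' [_ ek']; apply: (regular_epi_epi rv); rewrite ek ek'.
- by apply: (regular_epi_cancel hC (f := h)); rewrite eu; apply: regular_epi_comp.
- move=> W a b eab.
  case: (lift_along hC a rh) => W1 [e1 [t0 [re1 et0]]].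
  case: (lv W1 (s ∘ t0) (b ∘ e1)) => [|W2 [e2 [r [re2 [er1 er2]]]]].
    by crwl eu; rewrite et0; crw eab.
  case: (kernel_pairs_commute hC hP (g := s) (q := h)
    (x := t0 ∘ e2) (x' := r1 ∘ r) (x'' := r2 ∘ r)) => [||W3 [e3 [t [re3 [et es]]]]].
    by crw er1.
    by crw eh.
  exists W3, (e1 ∘ (e2 ∘ e3)), t; split; last split.
  + by do 2?apply: regular_epi_comp.
  + by rewrite et; crw et0.
  + by rewrite es; crw er2.
Qed.

End Quotients.

(** * Kernels and cokernels in quasi-pointed categories *)

Definition quasi_pointed (C : Category) : Prop :=
  exists Z : C, is_initial Z /\ forall W (a b : W ~> Z), a = b.

(** In a quasi-pointed category a null morphism exists only out of an object
    that maps to the initial one, so null morphisms cannot be a chosen family. *)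
Definition null (C : Category) (X Y : C) (f : X ~> Y) : Prop :=
  exists (Z : C) (a : X ~> Z) (b : Z ~> Y), is_initial Z /\ f = b ∘ a.

Section Null.
Context {C : Category} (hq : quasi_pointed C).
Implicit Types A D I J K M N P Q R S T W X Y Z : C.

Lemma initial_subterminal Z : is_initial Z -> forall W (a b : W ~> Z), a = b.
Proof.
case: hq => Z0 [h0 sub] hZ W a b.
case: (hZ Z0) => f _; case: (h0 Z) => g _.
have e : g ∘ f = idm Z by apply: initial_ext.
by rewrite -(comp_id_l a) -(comp_id_l b) -e !comp_assoc (sub _ (f ∘ a) (f ∘ b)).
Qed.

Lemma null_comp_l X Y Z (g : Y ~> Z) (f : X ~> Y) : null f -> null (g ∘ f).
Proof. by move=> [V [a [b [hV ->]]]]; exists V, a, (g ∘ b); rewrite comp_assoc. Qed.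

Lemma null_comp_r X Y Z (g : Y ~> Z) (f : X ~> Y) : null g -> null (g ∘ f).
Proof. by move=> [V [a [b [hV ->]]]]; exists V, (a ∘ f), b; rewrite comp_assoc. Qed.

Lemma null_unique X Y (f g : X ~> Y) : null f -> null g -> f = g.
Proof.
move=> [V [a [b [hV ->]]]] [V' [a' [b' [hV' ->]]]].
case: (hV V') => c _.
have -> : a' = c ∘ a by apply: (initial_subterminal hV').
by crwl (initial_ext hV b (b' ∘ c)).
Qed.

Lemma null_target X Y Y' (f : X ~> Y) : null f -> exists g : X ~> Y', null g.
Proof.
by move=> [V [a [_ [hV _]]]]; case: (hV Y') => b _; exists (b ∘ a), V, a, b.
Qed.

Lemma null_regular_epi X Y Z (e : X ~> Y) (f : Y ~> Z) :
  regular_epi e -> null (f ∘ e) -> null f.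
Proof.
move=> re [V [a [b [hV h]]]]; case: (re) => T [t1 [t2 co]].
case: (coequalizer_lift co (h := a)) => [|c ec].
  exact: initial_subterminal.
exists V, c, b; split=> //; apply: (regular_epi_epi re).
by rewrite h comp_assoc ec.
Qed.

Lemma null_mono X Y Z (m : Y ~> Z) (f : X ~> Y) : mono m -> null (m ∘ f) -> null f.
Proof.
move=> mm h; case: (null_target Y h) => g hg.
suff -> : f = g by [].
by apply: mm; apply: null_unique h (null_comp_l _ hg).
Qed.

Lemma kernel_null K X Y (k : K ~> X) (f : X ~> Y) : is_kernel k f -> null (f ∘ k).
Proof. by move=> [Z [z [t [hZ [e _]]]]]; exists Z, t, z. Qed.

Lemma kernel_mono K X Y (k : K ~> X) (f : X ~> Y) : is_kernel k f -> mono k.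
Proof.
move=> [Z [z [t [hZ pb]]]] W a b e.
by apply: (pullback_ext pb) => //; apply: initial_subterminal.
Qed.

Lemma kernel_lift K X Y (k : K ~> X) (f : X ~> Y) : is_kernel k f ->
  forall W (x : W ~> X), null (f ∘ x) -> exists l : W ~> K, k ∘ l = x.
Proof.
move=> [Z [z [t [hZ pb]]]] W x [V [a [b [hV e]]]].
case: (hV Z) => c _; case: (pullback_lift pb (a := x) (b := c ∘ a)) => [|l [el _]].
  by rewrite e; crwl (initial_ext hV b (z ∘ c)).
by exists l.
Qed.

Lemma kernel_intro K X Y (k : K ~> X) (f : X ~> Y) : mono k -> null (f ∘ k) ->
  (forall W (x : W ~> X), null (f ∘ x) -> exists l : W ~> K, k ∘ l = x) ->
  is_kernel k f.
Proof.
move=> mk [Z [t [z [hZ e]]]] lift; exists Z, z, t; split=> //.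
apply: pullback_intro => //; first by move=> W a b /mk.
move=> W x c ec; case: (lift W x) => [|l el]; first by exists Z, c, z.
by exists l; split=> //; apply: initial_subterminal.
Qed.

(** Elements of the kernel may be lifted locally, since [k] is monic. *)
Lemma kernel_intro_local K X Y (k : K ~> X) (f : X ~> Y) : mono k -> null (f ∘ k) ->
  (forall W (x : W ~> X), null (f ∘ x) ->
     exists (W' : C) (e : W' ~> W) (l : W' ~> K), regular_epi e /\ k ∘ l = x ∘ e) ->
  is_kernel k f.
Proof.
move=> mk nk lift; apply: kernel_intro => // W x /lift [W' [e [l [re el]]]].
exact: (mono_local mk re el).
Qed.

Lemma cokernel_null N M Q (q : M ~> Q) (n : N ~> M) : is_cokernel q n -> null (q ∘ n).
Proof. by move=> [Z [z [t [hZ [e _]]]]]; exists Z, t, z. Qed.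

Lemma cokernel_lift N M Q (q : M ~> Q) (n : N ~> M) : is_cokernel q n ->
  forall W (h : M ~> W), null (h ∘ n) -> exists k : Q ~> W, k ∘ q = h.
Proof.
move=> [Z [z [t [hZ [_ u]]]]] W h [V [a [b [hV e]]]].
case: (hZ V) => c _; case: (u W h (b ∘ c)).
  by rewrite e comp_assoc (initial_subterminal hV a (c ∘ t)).
by move=> k [[ek _] _]; exists k.
Qed.

Lemma cokernel_intro N M Q (q : M ~> Q) (n : N ~> M) :
  (forall W (a b : Q ~> W), a ∘ q = b ∘ q -> a = b) -> null (q ∘ n) ->
  (forall W (h : M ~> W), null (h ∘ n) -> exists k : Q ~> W, k ∘ q = h) ->
  is_cokernel q n.
Proof.
move=> eq [Z [t [z [hZ e]]]] lift; exists Z, z, t; split=> //; split=> // W h c ec.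
case: (lift W h) => [|k ek]; first by exists Z, t, c.
exists k; split; first by split=> //; apply: initial_ext.
by move=> k' [ek' _]; apply: eq; rewrite ek ek'.
Qed.

(** The map from [N] to the initial object is a split epimorphism, and the
    cokernel is its pushout along [n]. *)
Lemma cokernel_regular_epi N M Q (q : M ~> Q) (n : N ~> M) :
  is_cokernel q n -> regular_epi q.
Proof.
move=> [Z [z [t [hZ po]]]]; case: (hZ N) => s _.
apply: (pushout_regular_epi po); apply: (split_epi_regular (s := s)).
exact: initial_ext.
Qed.

End Null.

Section ExactProtomodular.
Context {C : Category} (hE : barr_exact C) (hP : protomodular C).
Context (hq : quasi_pointed C).
Implicit Types A D I J K M N P Q R S T W X Y Z : C.
Let hC : regular_category C := proj1 hE.

Lemma kernel_ex X Y (f : X ~> Y) : exists (K : C) (k : K ~> X), is_kernel k f.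
Proof.
case: (hq) => Z [hZ _]; case: (hZ Y) => z _.
by case: (pullback_ex hC f z) => K [k [t pb]]; exists K, k, Z, z, t.
Qed.

(** Let [h] vanish on the kernel of [q]. On the kernel pair [R] of [q], a point
    over the domain of [q], the subobject where [h] takes equal values has the
    same kernel part, hence is everything. *)
Lemma kernel_cokernel N M I (n : N ~> M) (q : M ~> I) :
  is_kernel n q -> regular_epi q -> is_cokernel q n.
Proof.
move=> kn rq; apply: (cokernel_intro _ (kernel_null kn)).
  exact: regular_epi_epi.
move=> W h hn; case: (pullback_ex hC q q) => R [r1 [r2 pR]].
apply: (coequalizer_lift (kernel_pair_coequalizer rq pR)).
case: (pullback_lift pR (a := idm M) (b := idm M) (eq_refl _)) => d [d1 d2].
case: (pullback_ex hC h h) => H [h1 [h2 pH]].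
case: (pullback_lift pH (a := idm M) (b := idm M) (eq_refl _)) => d' [d1' d2'].
case: (product_ex hC M M) => MM [pr1 [pr2 [lift ext]]].
case: (lift R r1 r2) => r [er1 er2]; case: (lift H h1 h2) => η [eη1 eη2].
case: (pullback_ex hC r η) => E [ε [ε' pE]].
have mε : mono ε.
  move=> V a b e; apply: (pullback_ext pE) => //.
  apply: (pullback_ext pH); rewrite -?eη1 -?eη2 !comp_assoc.
    by crwl (pullback_comm pE); rewrite e; crw (pullback_comm pE).
  by crwl (pullback_comm pE); rewrite e; crw (pullback_comm pE).
have inE : forall V (x : V ~> R), h ∘ (r1 ∘ x) = h ∘ (r2 ∘ x) ->
    exists y : V ~> E, ε ∘ y = x.
  move=> V x ex; case: (pullback_lift pH ex) => y [y1 y2].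
  case: (pullback_lift pE (a := x) (b := y)) => [|z [z1 _]]; last by exists z.
  by apply: ext; rewrite -!comp_assoc ?er1 ?er2 ?eη1 ?eη2.
case: (inE M d) => [|s es]; first by rewrite d1 d2.
case: (hq) => Z [hZ subZ]; case: (hZ M) => z _.
case: (pullback_ex hC z r1) => D [δ1 [δ2 pD]].
have nullD : null (h ∘ (r1 ∘ δ2)).
  by rewrite -(pullback_comm pD) -comp_assoc; exists Z, δ1, (h ∘ z).
case: (kernel_lift kn (x := r2 ∘ δ2)) => [|l el].
  crwl (pullback_comm pR); rewrite -(pullback_comm pD) -comp_assoc.
  by exists Z, δ1, (q ∘ z).
case: (inE D δ2) => [|β eβ].
  apply: (null_unique hq nullD); rewrite -el -comp_assoc.
  exact: null_comp_r.
have pD' : is_pullback z (r1 ∘ ε) δ1 β.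
{ apply: pullback_intro.
  - by rewrite (pullback_comm pD); crw eβ.
  - move=> V a b e1 e2; apply: (pullback_ext pD) => //.
    by rewrite -eβ !comp_assoc e2.
  - move=> V a b; rewrite comp_assoc => e.
    case: (pullback_lift pD e) => c [c1 c2]; exists c; split=> //.
    by apply: mε; crw eβ. }
have [ε'' [_ eε]] : iso ε.
{ apply: (hP (v := z) (p := r1 ∘ ε) (s := s) (p' := r1) (s' := d) (h := ε)
    (k := idm D) _ _ _ _ pD' pD) => //.
  - by crw es.
  - by rewrite eβ comp_id_r.
  - by exists (idm D); rewrite comp_id_l. }
have eqH : h ∘ (r1 ∘ ε) = h ∘ (r2 ∘ ε).
  rewrite -er1 -er2 !comp_assoc (pullback_comm pE).
  by crw eη1; crw eη2; crw (pullback_comm pH).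
by rewrite -(comp_id_r r1) -(comp_id_r r2) -eε; crw eqH.
Qed.

Lemma cokernel_of_kernel_ex N M Y (n : N ~> M) (f : M ~> Y) : is_kernel n f ->
  exists (Q : C) (q : M ~> Q), is_cokernel q n.
Proof.
move=> kn; case: (image_ex hC f) => Q [q [m [rq [mm em]]]]; exists Q, q.
apply: kernel_cokernel => //; apply: (kernel_intro hq).
- exact: (kernel_mono hq kn).
- by apply: (null_mono hq mm); rewrite -comp_assoc -em; apply: kernel_null.
- move=> W x nx; apply: (kernel_lift kn).
  by rewrite em comp_assoc; apply: null_comp_l.
Qed.

Lemma cokernel_kernel N M Y Q (n : N ~> M) (f : M ~> Y) (q : M ~> Q) :
  is_kernel n f -> is_cokernel q n -> is_kernel n q.
Proof.
move=> kn cq; apply: (kernel_intro hq); first exact: (kernel_mono hq kn).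
  exact: cokernel_null.
move=> W x nx; apply: (kernel_lift kn).
case: (cokernel_lift hq cq (kernel_null kn)) => k <-.
by rewrite comp_assoc; apply: null_comp_l.
Qed.

(** The witness is the pushout of [s] along [h]: by its lifting property, an
    element of its kernel comes, locally, from an element of the kernel of [s]. *)
Lemma regular_image_kernel N T Q A D (k : N ~> T) (s : T ~> Q) (h : T ~> A)
    (e : N ~> D) (c : D ~> A) :
  is_kernel k s -> regular_epi s -> regular_epi h -> is_image (h ∘ k) e c ->
  exists (P : C) (u : A ~> P), is_kernel c u.
Proof.
move=> ks rs rh [re [mc ec]].
case: (regular_epi_pushout hE hP rh rs) => P [u [v [[euv _] [_ lift]]]].
exists P, u; apply: (kernel_intro_local hq) => //.
  apply: (null_regular_epi hq re); rewrite comp_assoc -ec; crw euv.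
  by apply: null_comp_l; apply: kernel_null.
move=> W a na; case: (null_target Q na) => b nb.
case: (lift W a b) => [|W' [p [t [rp [ta tb]]]]].
  by apply: (null_unique hq na); apply: null_comp_l.
case: (kernel_lift ks (x := t)) => [|n en].
  by rewrite tb; apply: null_comp_r.
exists W', p, (e ∘ n); split=> //.
by rewrite -ta; crwl ec; rewrite en.
Qed.

Lemma exact_intro X Y Z N (f : X ~> Y) (g : Y ~> Z) (k : N ~> Y) (e : X ~> N) :
  is_kernel k g -> regular_epi e -> k ∘ e = f -> exact_at f g.
Proof.
move=> kk re ef; case: (image_ex hC g) => J [p' [m' [rp' [mm' em']]]].
exists N, J, e, k, p', m'; split; [|split=> //].
  by split=> //; split; first exact: (kernel_mono hq kk).
split=> //; apply: (kernel_intro hq); first exact: (kernel_mono hq kk).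
  by apply: (null_mono hq mm'); rewrite -comp_assoc -em'; apply: kernel_null.
move=> W x nx; apply: (kernel_lift kk).
by rewrite em' comp_assoc; apply: null_comp_l.
Qed.

(** The terms of the five-term sequence are quotients; testing exactness on
    elements of the object [M] above the middle term makes computations take
    place in that object. *)
Lemma exact_of_lift M X Y Z (q : M ~> Y) (f : X ~> Y) (g : Y ~> Z) :
  regular_epi q -> null (g ∘ f) ->
  (forall W (m : W ~> M), null (g ∘ (q ∘ m)) ->
     exists (W' : C) (e : W' ~> W) (x : W' ~> X), regular_epi e /\ f ∘ x = q ∘ m ∘ e) ->
  exact_at f g.
Proof.
move=> rq nf lift; case: (kernel_ex g) => N [k kk].
case: (kernel_lift kk nf) => u eu.
apply: (exact_intro kk _ eu).
case: (lift_along hC k rq) => W1 [e1 [m [re1 em]]].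
case: (lift W1 m) => [|W2 [e2 [x [re2 ex]]]].
  by rewrite em -comp_assoc; apply: null_comp_r; apply: kernel_null.
apply: (regular_epi_cancel hC (f := x)).
suff -> : u ∘ x = e1 ∘ e2 by apply: regular_epi_comp.
by apply: (kernel_mono hq kk); crw eu; rewrite ex -comp_assoc -em !comp_assoc.
Qed.

End ExactProtomodular.

(** * Actions and points in a semi-abelian category *)

Section SemiAbelianActions.
Context {C : SemiAbelian}.
Implicit Types A B S W X Y : C.

Definition sa_regular : regular_category C := proj1 (sa_exact C).

Lemma sa_quasi_pointed : quasi_pointed C.
Proof.
exists (zero_ob C); split; first exact: zero_initial.
by move=> W a b; case: (zero_terminal W) => f uf; rewrite (uf a) (uf b).
Qed.

Lemma zero_mor_null X Y : null (zero_mor X Y).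
Proof.
case: (zero_terminal X) => a _; case: (zero_initial Y) => b _.
exists (zero_ob C), a, b; split; first exact: zero_initial.
by rewrite zero_mor_factor.
Qed.

Lemma null_zero X Y (f : X ~> Y) : null f -> f = zero_mor X Y.
Proof. by move=> nf; apply: (null_unique sa_quasi_pointed nf); apply: zero_mor_null. Qed.

Lemma copair_comp X Y V W (h : V ~> W) (a : X ~> V) (b : Y ~> V) :
  h ∘ copair a b = copair (h ∘ a) (h ∘ b).
Proof. by apply: coprod_hom_ext; rewrite comp_assoc ?copair_in1 ?copair_in2. Qed.

Lemma copair_map A X B Y W (u : A ~> B) (v : X ~> Y) (a : B ~> W) (b : Y ~> W) :
  copair a b ∘ coprod_map u v = copair (a ∘ u) (b ∘ v).
Proof.
by rewrite /coprod_map copair_comp -!comp_assoc copair_in1 copair_in2.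
Qed.

Lemma copair_eta X Y W (f : coprod X Y ~> W) : f = copair (f ∘ in1 X Y) (f ∘ in2 X Y).
Proof. by apply: coprod_hom_ext; rewrite ?copair_in1 ?copair_in2. Qed.

Lemma copair_flat_map A X B Y W (u : A ~> B) (v : X ~> Y) (a : B ~> W) (b : Y ~> W) :
  copair a b ∘ flat_ker B Y ∘ flat_map u v
  = copair (a ∘ u) (b ∘ v) ∘ flat_ker A X.
Proof. by rewrite comp_assoc flat_map_ker -comp_assoc copair_map. Qed.

Lemma flat_lift B X W (h : W ~> coprod B X) :
  null (copair (idm B) (zero_mor X B) ∘ h) ->
  exists l : W ~> flat B X, flat_ker B X ∘ l = h.
Proof. by move/null_zero => e; exists (ker_lift e); apply: ker_lift_comp. Qed.

Lemma flat_ker_unit B X : flat_ker B X ∘ flat_unit B X = in2 B X.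
Proof. exact: ker_lift_comp. Qed.

Lemma flat_ker_mult B X :
  flat_ker B X ∘ flat_mult B X = copair (in1 B X) (flat_ker B X) ∘ flat_ker B (flat B X).
Proof. exact: ker_lift_comp. Qed.

Lemma coprod_map_regular_epi A B X Y (u : A ~> B) (v : X ~> Y) :
  regular_epi u -> regular_epi v -> regular_epi (coprod_map u v).
Proof.
apply: (coproduct_regular_epi sa_regular
  (i := in1 A X) (j := in2 A X) (@coprod_is_coproduct _ _ _)).
- by rewrite /coprod_map copair_in1.
- by rewrite /coprod_map copair_in2.
Qed.

(** An element of the kernel lifts along [u + v]; the commutation of kernel
    pairs corrects the lift so that its component in [A] vanishes. *)
Lemma flat_map_regular_epi A B X Y (u : A ~> B) (v : X ~> Y) :
  regular_epi u -> regular_epi v -> regular_epi (flat_map u v).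
Proof.
move=> ru rv; have ruv := coprod_map_regular_epi ru rv.
case: (lift_along sa_regular (flat_ker B Y) ruv) => W [e [w [re ew]]].
set p := copair (idm A) (zero_mor X A).
have qi : coprod_map u v ∘ in1 A X = in1 B Y ∘ u by rewrite /coprod_map copair_in1.
have pi : p ∘ in1 A X = idm A by rewrite /p copair_in1.
have up : u ∘ (p ∘ w) = zero_mor W B.
  have -> : u ∘ (p ∘ w) = copair (idm B) (zero_mor Y B) ∘ (coprod_map u v ∘ w).
    by rewrite -!comp_assoc copair_map /p copair_comp comp_id_l comp_id_r
      zero_comp_r zero_comp_l.
  by rewrite ew -comp_assoc flat_ker_comp zero_comp_l.
case: (kernel_pairs_commute sa_regular (@sa_protomodular C) (g := p) (q := coprod_map u v)
  (x := w) (x' := in1 A X ∘ (p ∘ w)) (x'' := zero_mor W _)) => [||W' [e' [y [re' [ey py]]]]].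
  by crw pi; rewrite comp_id_l.
  by crw qi; rewrite up !zero_comp_r.
case: (@flat_lift A X W' y) => [|l el].
  by rewrite -/p py zero_comp_r zero_comp_l; apply: zero_mor_null.
apply: (regular_epi_cancel sa_regular (f := l)).
suff -> : flat_map u v ∘ l = e ∘ e' by apply: (regular_epi_comp sa_regular).
by apply: flat_hom_ext; crw (flat_map_ker u v); rewrite el ey; crw ew.
Qed.

Lemma kernel_pullback_zero X S B (j : X ~> S) (p : S ~> B) (z : zero_ob C ~> B)
    (t : X ~> zero_ob C) : is_kernel j p -> is_pullback z p t j.
Proof.
move=> kj; have sub := initial_subterminal sa_quasi_pointed (zero_initial (s := C)).
apply: pullback_intro.
- rewrite zero_mor_factor; symmetry; apply: null_zero; exact: kernel_null.
- by move=> W a b _; apply: (kernel_mono sa_quasi_pointed kj).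
- move=> W a b e; case: (kernel_lift kj (x := b)) => [|l el].
    by rewrite -e zero_mor_factor; apply: zero_mor_null.
  by exists l; split.
Qed.

(** The image of [i, j] is a point over [B] with the same kernel, so it is all of
    [S] by protomodularity. *)
Lemma point_copair_regular_epi B X S (p : S ~> B) (i : B ~> S) (j : X ~> S) :
  p ∘ i = idm B -> is_kernel j p -> regular_epi (copair i j).
Proof.
move=> pi kj; case: (image_ex sa_regular (copair i j)) => I [q [m [rq [mm em]]]].
case: (zero_initial B) => z _; case: (zero_terminal X) => t _.
have m1 : m ∘ (q ∘ in1 B X) = i by crwl em; rewrite copair_in1.
have m2 : m ∘ (q ∘ in2 B X) = j by crwl em; rewrite copair_in2.
have pD := kernel_pullback_zero z t kj.
have pI : is_pullback z (p ∘ m) t (q ∘ in2 B X).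
{ apply: pullback_intro.
  - by rewrite comp_assoc m2 (pullback_comm pD).
  - move=> W a b e1 e2; apply: (pullback_ext pD) => //.
    by rewrite -m2 !comp_assoc -!(comp_assoc q) e2.
  - move=> W a b; rewrite comp_assoc => e; case: (pullback_lift pD e) => c [c1 c2].
    by exists c; split=> //; apply: mm; crw m2. }
rewrite em; apply: (regular_epi_comp sa_regular) rq; apply: iso_regular_epi.
apply: (@sa_protomodular C _ _ _ _ z (p ∘ m) (q ∘ in1 B X) p i m _ _ _ _ _ _ (idm X)
  _ _ _ _ pI pD) => //.
- by rewrite comp_assoc m1.
- by rewrite comp_id_r.
- by rewrite m2 comp_id_r.
- by exists (idm X); rewrite comp_id_l.
Qed.

Lemma point_hom_ext B X S W (p : S ~> B) (i : B ~> S) (j : X ~> S) (a b : S ~> W) :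
  p ∘ i = idm B -> is_kernel j p -> a ∘ i = b ∘ i -> a ∘ j = b ∘ j -> a = b.
Proof.
move=> pi kj ei ej; apply: (regular_epi_epi (point_copair_regular_epi pi kj)).
by rewrite !copair_comp ei ej.
Qed.

(** Since [i, j] is the cokernel of its kernel, and that kernel lies in
    [flat B X] and is killed by [xi], a morphism out of [coprod B X] descends
    as soon as it satisfies the equation on [flat B X]. *)
Lemma semidirect_lift B X S W (xi : flat B X ~> X) (p : S ~> B) (i : B ~> S)
    (j : X ~> S) (a : X ~> W) (b : B ~> W) :
  is_semidirect xi p i j -> a ∘ xi = copair b a ∘ flat_ker B X ->
  exists h : S ~> W, h ∘ i = b /\ h ∘ j = a.
Proof.
move=> [pi [kj ej]] ea; have rS := point_copair_regular_epi pi kj.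
case: (kernel_ex (sa_exact C) sa_quasi_pointed (copair i j)) => N [n kn].
have nn := kernel_null kn.
have cn := kernel_cokernel (sa_exact C) (@sa_protomodular C) sa_quasi_pointed kn rS.
have pS : p ∘ copair i j = copair (idm B) (zero_mor X B).
  by rewrite copair_comp pi; congr copair; apply/null_zero/kernel_null.
case: (@flat_lift B X N n) => [|n' en].
  by rewrite -pS comp_assoc; apply: null_comp_l.
case: (cokernel_lift sa_quasi_pointed cn (h := copair b a)) => [|h eh].
  rewrite -en; crwl ea; apply: null_comp_l.
  apply: (null_mono sa_quasi_pointed (kernel_mono sa_quasi_pointed kj)).
  by crw ej; rewrite en.
exists h; split.
- by rewrite -(copair_in1 b a) -eh comp_assoc copair_in1.
- by rewrite -(copair_in2 b a) -eh comp_assoc copair_in2.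
Qed.

Lemma point_action B X S (p : S ~> B) (i : B ~> S) (j : X ~> S) :
  p ∘ i = idm B -> is_kernel j p ->
  exists xi : flat B X ~> X, is_action xi /\ is_semidirect xi p i j.
Proof.
move=> pi kj; have mj := kernel_mono sa_quasi_pointed kj.
have pS : p ∘ copair i j = copair (idm B) (zero_mor X B).
  by rewrite copair_comp pi; congr copair; apply/null_zero/kernel_null.
case: (kernel_lift kj (x := copair i j ∘ flat_ker B X)) => [|xi exi].
  by crw pS; rewrite flat_ker_comp; apply: zero_mor_null.
exists xi; split; last by split.
split; apply: mj.
- by crw exi; rewrite flat_ker_unit copair_in2 comp_id_r.
- crw exi; rewrite flat_ker_mult flat_map_ker -!comp_assoc copair_comp copair_map.
  by rewrite copair_in1 comp_id_r exi.
Qed.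

(** The semidirect product is the coequalizer of the free presentation of the
    algebra [xi]; its kernel part is the coequalizer of [flat_mult B X] and
    [flat_map (idm B) xi], which [xi] splits, so that the kernel is [X]. *)
Lemma semidirect_ex B X (xi : flat B X ~> X) : is_action xi ->
  exists (S : C) (p : S ~> B) (i : B ~> S) (j : X ~> S), is_semidirect xi p i j.
Proof.
move=> [unit assoc].
set r1 := copair (in1 B X) (flat_ker B X).
set r2 := coprod_map (idm B) xi.
set π := copair (idm B) (zero_mor X B).
case: (@reflexive_pair_quotient C (sa_exact C) (@sa_protomodular C) _ _ _ r1 r2
  (idm _) (coprod_map (idm B) (flat_unit B X))) => [|||S [q [rq [cq lq]]]].
  by apply: iso_regular_epi; exists (idm _); rewrite comp_id_l.
  rewrite /r1 copair_map flat_ker_unit comp_id_r; symmetry.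
  by rewrite {1}(copair_eta (idm _)) !comp_id_l.
  rewrite /r2 copair_map !comp_assoc unit !comp_id_r; symmetry.
  by rewrite {1}(copair_eta (idm _)) !comp_id_l.
have π1 : π ∘ r1 = copair (idm B) (zero_mor _ B).
  by rewrite copair_comp copair_in1 flat_ker_comp.
have π2 : π ∘ r2 = copair (idm B) (zero_mor _ B).
  by rewrite copair_map comp_id_l zero_comp_l.
case: (coequalizer_lift cq (h := π)) => [|p ep]; first by rewrite π1 π2.
have eq12 : q ∘ r1 = q ∘ r2 by case: cq.
have act : q ∘ (in2 B X ∘ xi) = q ∘ flat_ker B X.
  have -> : in2 B X ∘ xi = r2 ∘ in2 B (flat B X) by rewrite /r2 /coprod_map copair_in2.
  by crwl eq12; rewrite /r1 copair_in2.
exists S, p, (q ∘ in1 B X), (q ∘ in2 B X).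
split; first by crw ep; rewrite copair_in1.
split; last by rewrite comp_assoc act -copair_eta.
case: (kernel_ex (sa_exact C) sa_quasi_pointed p) => K [k kk].
have mk := kernel_mono sa_quasi_pointed kk.
case: (kernel_lift kk (x := q ∘ flat_ker B X)) => [|φ eφ].
  by crw ep; rewrite flat_ker_comp; apply: zero_mor_null.
case: (kernel_lift kk (x := q ∘ in2 B X)) => [|ψ eψ].
  by crw ep; rewrite copair_in2; apply: zero_mor_null.
have eφψ : ψ ∘ xi = φ by apply: mk; crw eψ; rewrite act eφ.
have rφ : regular_epi φ.
{ case: (lift_along sa_regular k rq) => W [e [w [re ew]]].
  case: (@flat_lift B X W w) => [|l el].
    by rewrite -/π -ep comp_assoc ew -comp_assoc; apply: null_comp_r; apply: kernel_null.
  apply: (regular_epi_cancel sa_regular (f := l)).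
  by suff -> : φ ∘ l = e by []; apply: mk; crw eφ; rewrite el. }
have rψ : regular_epi ψ by apply: (regular_epi_cancel sa_regular (f := xi)); rewrite eφψ.
have mψ : mono ψ.
{ move=> W a b e; case: (lq W (in2 B X ∘ a) (in2 B X ∘ b)) => [|W' [ε [ρ [rε [ρ1 ρ2]]]]].
    by crwl eψ; rewrite e.
  case: (@flat_lift B _ W' ρ) => [|ρ' eρ].
    rewrite -π1 comp_assoc ρ1; crw (copair_in2 (idm B) (zero_mor X B)).
    by rewrite zero_comp_l; apply: zero_mor_null.
  apply: (regular_epi_epi rε).
  have h1 : flat_mult B X ∘ ρ' = flat_unit B X ∘ (a ∘ ε).
    apply: flat_hom_ext; crw (flat_ker_mult B X); rewrite eρ ρ1.
    by crw (flat_ker_unit B X).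
  have h2 : flat_map (idm B) xi ∘ ρ' = flat_unit B X ∘ (b ∘ ε).
    apply: flat_hom_ext; crw (flat_map_ker (idm B) xi); rewrite eρ ρ2.
    by crw (flat_ker_unit B X).
  rewrite -(comp_id_l (a ∘ ε)) -(comp_id_l (b ∘ ε)) -unit !comp_assoc -h1 -h2.
  by crw assoc. }
have [ψ' [_ ψψ']] : iso ψ.
  case: (regular_epi_mono_diagonal rψ mψ (u := idm X) (v := idm K)).
    by rewrite comp_id_l comp_id_r.
  by move=> d [? ?]; exists d.
apply: (kernel_intro sa_quasi_pointed).
- by rewrite -eψ; apply: mono_comp.
- by crw ep; rewrite copair_in2; apply: zero_mor_null.
- move=> W x /(kernel_lift kk) [l el]; exists (ψ' ∘ l).
  by rewrite -eψ; crw ψψ'; rewrite comp_id_l.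
Qed.

End SemiAbelianActions.

(** * Reflexive graphs over a fixed object *)

Definition is_rg_morphism (C : SemiAbelian) (B : C) (G H : ReflexiveGraph B)
    (f : rg_ob G ~> rg_ob H) : Prop :=
  rg_dom H ∘ f = rg_dom G /\ rg_cod H ∘ f = rg_cod G /\ f ∘ rg_unit G = rg_unit H.

Definition RGHom (C : SemiAbelian) (B : C) (G H : ReflexiveGraph B) : Type :=
  { f : rg_ob G ~> rg_ob H | is_rg_morphism f }.

Lemma RGHom_ext (C : SemiAbelian) (B : C) (G H : ReflexiveGraph B)
    (f g : RGHom G H) : proj1_sig f = proj1_sig g -> f = g.
Proof.
case: f g => [f hf] [g hg] /= e; case: _ / e hg => hg.
by rewrite (proof_irrelevance _ hf hg).
Qed.

Lemma rg_id_proof (C : SemiAbelian) (B : C) (G : ReflexiveGraph B) :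
  is_rg_morphism (G := G) (H := G) (idm (rg_ob G)).
Proof. by split; last split; rewrite ?comp_id_l ?comp_id_r. Qed.

Lemma rg_comp_proof (C : SemiAbelian) (B : C) (G H L : ReflexiveGraph B)
    (g : RGHom H L) (f : RGHom G H) :
  is_rg_morphism (G := G) (H := L) (proj1_sig g ∘ proj1_sig f).
Proof.
case: f g => [f [f1 [f2 f3]]] [g [g1 [g2 g3]]] /=.
by split; last split; rewrite -?comp_assoc ?g1 ?g2 // comp_assoc f3.
Qed.

Definition RG (C : SemiAbelian) (B : C) : Category.
Proof.
refine {| Ob := ReflexiveGraph B;
          Hom := @RGHom C B;
          idm := fun G => exist _ _ (rg_id_proof G);
          comp := fun G H L g f => exist _ _ (rg_comp_proof g f) |}.
- by move=> *; apply: RGHom_ext; apply: comp_assoc.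
- by move=> *; apply: RGHom_ext; apply: comp_id_l.
- by move=> *; apply: RGHom_ext; apply: comp_id_r.
Defined.

Section ReflexiveGraphs.
Context {C : SemiAbelian} {B : C}.
Implicit Types G H L : RG B.

Definition rgu G H (f : G ~> H) : rg_ob G ~> rg_ob H := proj1_sig f.

Definition rg_mor G H (f : rg_ob G ~> rg_ob H) (h : is_rg_morphism f) : G ~> H :=
  exist _ f h.

Lemma rgu_comp G H L (g : H ~> L) (f : G ~> H) : rgu (g ∘ f) = rgu g ∘ rgu f.
Proof. by []. Qed.

Lemma rgu_inj G H (f g : G ~> H) : rgu f = rgu g -> f = g.
Proof. exact: RGHom_ext. Qed.

Lemma rgu_dom G H (f : G ~> H) : rg_dom H ∘ rgu f = rg_dom G.
Proof. by case: f => f [? []]. Qed.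

Lemma rgu_cod G H (f : G ~> H) : rg_cod H ∘ rgu f = rg_cod G.
Proof. by case: f => f [? []]. Qed.

Lemma rgu_unit G H (f : G ~> H) : rgu f ∘ rg_unit G = rg_unit H.
Proof. by case: f => f [? []]. Qed.

Definition rg_discrete : RG B.
Proof.
by refine {| rg_ob := B; rg_dom := idm B; rg_cod := idm B; rg_unit := idm B |};
  rewrite comp_id_l.
Defined.

Lemma rg_discrete_initial : is_initial rg_discrete.
Proof.
move=> G; have h : is_rg_morphism (G := rg_discrete) (H := G) (rg_unit G).
  by split; last split; rewrite /= ?rg_dom_unit ?rg_cod_unit ?comp_id_r.
exists (rg_mor h) => g; apply: rgu_inj.
by rewrite -[RHS](rgu_unit g) /= comp_id_r.
Qed.

Lemma rg_quasi_pointed : quasi_pointed (RG B).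
Proof.
exists rg_discrete; split; first exact: rg_discrete_initial.
move=> G f g; apply: rgu_inj.
by rewrite -(comp_id_l (rgu f)) -(comp_id_l (rgu g)) (rgu_dom f) (rgu_dom g).
Qed.

Lemma rg_terminal_ex : exists T : RG B, is_terminal T.
Proof.
case: (product_ex (@sa_regular C) B B) => P [p [q [lift ext]]].
case: (lift B (idm B) (idm B)) => u [pu qu].
exists {| rg_ob := P; rg_dom := p; rg_cod := q; rg_unit := u;
          rg_dom_unit := pu; rg_cod_unit := qu |} => G.
case: (lift _ (rg_dom G) (rg_cod G)) => f [pf qf].
have h : is_rg_morphism (G := G) (H := {| rg_ob := P; rg_dom := p; rg_cod := q;
    rg_unit := u; rg_dom_unit := pu; rg_cod_unit := qu |}) f.
  split=> //; split=> //=.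
  by apply: ext; rewrite -!comp_assoc ?pf ?qf ?rg_dom_unit ?rg_cod_unit ?pu ?qu.
exists (exist _ f h) => g; apply: rgu_inj; apply: ext.
  by rewrite [LHS](rgu_dom g) pf.
by rewrite [LHS](rgu_cod g) qf.
Qed.

Lemma rg_pullback_of_underlying G H L P (f : G ~> L) (g : H ~> L)
    (p : P ~> G) (q : P ~> H) :
  is_pullback (rgu f) (rgu g) (rgu p) (rgu q) -> is_pullback f g p q.
Proof.
move=> pb; apply: pullback_intro.
- by apply: rgu_inj; apply: (pullback_comm pb).
- move=> W a b e1 e2; apply: rgu_inj; apply: (pullback_ext pb).
    by rewrite -!rgu_comp e1.
  by rewrite -!rgu_comp e2.
move=> W a b e; case: (pullback_lift pb (a := rgu a) (b := rgu b)) => [|h [h1 h2]].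
  by rewrite -!rgu_comp e.
have hh : is_rg_morphism h.
  split; last split.
  + by rewrite -(rgu_dom p) comp_assoc h1 rgu_dom.
  + by rewrite -(rgu_cod p) comp_assoc h1 rgu_cod.
  + by apply: (pullback_ext pb); rewrite -comp_assoc ?h1 ?h2 !rgu_unit.
by exists (rg_mor hh); split; apply: rgu_inj.
Qed.

Lemma rg_pullback_ex G H L (f : G ~> L) (g : H ~> L) :
  exists (P : RG B) (p : P ~> G) (q : P ~> H),
    is_pullback (rgu f) (rgu g) (rgu p) (rgu q).
Proof.
case: (pullback_ex (@sa_regular C) (rgu f) (rgu g)) => P [p [q pb]].
case: (pullback_lift pb (a := rg_unit G) (b := rg_unit H)) => [|u [pu qu]].
  by rewrite !rgu_unit.
have du : (rg_dom G ∘ p) ∘ u = idm B by rewrite comp_assoc pu rg_dom_unit.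
have cu : (rg_cod G ∘ p) ∘ u = idm B by rewrite comp_assoc pu rg_cod_unit.
pose PG := {| rg_dom_unit := du; rg_cod_unit := cu |} : RG B.
have hp : is_rg_morphism (G := PG) (H := G) p by [].
have hq : is_rg_morphism (G := PG) (H := H) q.
  split; last split=> //=.
    by rewrite -(rgu_dom g) comp_assoc -(pullback_comm pb) -comp_assoc rgu_dom.
  by rewrite -(rgu_cod g) comp_assoc -(pullback_comm pb) -comp_assoc rgu_cod.
by exists PG, (rg_mor hp), (rg_mor hq).
Qed.

Lemma rg_underlying_pullback G H L P (f : G ~> L) (g : H ~> L)
    (p : P ~> G) (q : P ~> H) :
  is_pullback f g p q -> is_pullback (rgu f) (rgu g) (rgu p) (rgu q).
Proof.
move=> pb; case: (rg_pullback_ex f g) => P' [p' [q' pb']].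
have pb'' := rg_pullback_of_underlying pb'.
case: (pullback_lift pb (pullback_comm pb'')) => h [h1 h2].
case: (pullback_lift pb'' (pullback_comm pb)) => k [k1 k2].
have hk : h ∘ k = idm P.
  by apply: (pullback_ext pb); rewrite -comp_assoc ?h1 ?h2 ?k1 ?k2 comp_id_r.
have hk' : rgu h ∘ rgu k = idm _ by rewrite -rgu_comp hk.
apply: pullback_intro.
- by rewrite -!rgu_comp (pullback_comm pb).
- move=> W a b; rewrite -k1 -k2 !rgu_comp !comp_assoc => e1 e2.
  by apply: (retract_mono hk'); apply: (pullback_ext pb').
- move=> W a b /(pullback_lift pb') [l [l1 l2]]; exists (rgu h ∘ l).
  by rewrite -!comp_assoc -!rgu_comp h1 h2.
Qed.

Definition rg_quotient G (Q : C) (q : rg_ob G ~> Q) (d c : Q ~> B)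
    (hd : d ∘ q = rg_dom G) (hc : c ∘ q = rg_cod G) : RG B.
Proof.
refine {| rg_ob := Q; rg_dom := d; rg_cod := c; rg_unit := q ∘ rg_unit G |}.
- by rewrite -comp_assoc hd rg_dom_unit.
- by rewrite -comp_assoc hc rg_cod_unit.
Defined.

Lemma rg_quotient_map G (Q : C) (q : rg_ob G ~> Q) (d c : Q ~> B)
    (hd : d ∘ q = rg_dom G) (hc : c ∘ q = rg_cod G) :
  is_rg_morphism (G := G) (H := rg_quotient hd hc) q.
Proof. by []. Qed.

Lemma rg_descend G H L (q : G ~> H) (h : G ~> L) (k : rg_ob H ~> rg_ob L) :
  (forall W (a b : rg_ob H ~> W), a ∘ rgu q = b ∘ rgu q -> a = b) ->
  k ∘ rgu q = rgu h -> is_rg_morphism k.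
Proof.
move=> eq e; split; last split.
- by apply: eq; rewrite comp_assoc e !rgu_dom.
- by apply: eq; rewrite comp_assoc e !rgu_cod.
- by rewrite -(rgu_unit q) -comp_assoc e rgu_unit.
Qed.

Lemma rg_coequalizer_of_underlying R G H (a b : R ~> G) (q : G ~> H) :
  is_coequalizer (rgu a) (rgu b) (rgu q) -> is_coequalizer a b q.
Proof.
move=> co; have [e _] := co; split; first exact: rgu_inj.
move=> L h eh; case: (coequalizer_lift co (h := rgu h)) => [|k ek].
  by rewrite -!rgu_comp eh.
exists (rg_mor (rg_descend (coequalizer_epi co) ek)); split; first exact: rgu_inj.
by move=> k' ek'; apply: rgu_inj; apply: (coequalizer_epi co); rewrite /= ek -ek'.
Qed.

Lemma rg_regular_epi_of_underlying G H (q : G ~> H) :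
  regular_epi (rgu q) -> regular_epi q.
Proof.
move=> rq; case: (rg_pullback_ex q q) => R [r1 [r2 pb]]; exists R, r1, r2.
apply: rg_coequalizer_of_underlying.
exact: (kernel_pair_coequalizer rq pb).
Qed.

(** The image in [C] of a morphism of graphs carries a graph structure, through
    which a regular epimorphism of graphs factors. *)
Lemma rg_underlying_regular_epi G H (q : G ~> H) :
  regular_epi q -> regular_epi (rgu q).
Proof.
move=> rq; case: (image_ex (@sa_regular C) (rgu q)) => I [p [m [rp [mm em]]]].
have hd : (rg_dom H ∘ m) ∘ p = rg_dom G by rewrite comp_assoc -em rgu_dom.
have hc : (rg_cod H ∘ m) ∘ p = rg_cod G by rewrite comp_assoc -em rgu_cod.
pose IG := rg_quotient hd hc; pose pG : G ~> IG := rg_mor (rg_quotient_map hd hc).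
have hm : is_rg_morphism (G := IG) (H := H) m.
  by split=> //; split=> //=; rewrite -comp_assoc -em rgu_unit.
case: (@regular_epi_mono_diagonal _ _ _ _ _ q (rg_mor hm) pG (idm H) rq).
  by move=> W a b e; apply: rgu_inj; apply: mm; rewrite -!(rgu_comp (rg_mor hm)) e.
  by apply: rgu_inj; rewrite /= comp_id_l -em.
move=> d [_ ed]; rewrite em; apply: (regular_epi_comp (@sa_regular C)) rp.
apply: iso_regular_epi; apply: (split_mono_iso mm (s := rgu d)).
by rewrite -(rgu_comp (rg_mor hm)) ed.
Qed.

(** A morphism from an object of [C] into a graph extends to a morphism of
    graphs from a coproduct with [B], so joint monicity in graphs implies joint
    monicity in [C]. *)
Lemma rg_jointly_monic R G (r1 r2 : R ~> G) : jointly_monic r1 r2 ->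
  jointly_monic (rgu r1) (rgu r2).
Proof.
move=> jm W a b e1 e2.
have ed : rg_dom R ∘ a = rg_dom R ∘ b.
  by rewrite -(rgu_dom r1) !comp_assoc e1.
have ec : rg_cod R ∘ a = rg_cod R ∘ b.
  by rewrite -(rgu_cod r1) !comp_assoc e1.
have du : copair (rg_dom R ∘ a) (idm B) ∘ in2 W B = idm B by rewrite copair_in2.
have cu : copair (rg_cod R ∘ a) (idm B) ∘ in2 W B = idm B by rewrite copair_in2.
pose F := {| rg_dom_unit := du; rg_cod_unit := cu |} : RG B.
have ha : is_rg_morphism (G := F) (H := R) (copair a (rg_unit R)).
  by split; last split; rewrite /= ?copair_comp ?rg_dom_unit ?rg_cod_unit ?copair_in2.
have hb : is_rg_morphism (G := F) (H := R) (copair b (rg_unit R)).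
  by split; last split;
    rewrite /= ?copair_comp ?rg_dom_unit ?rg_cod_unit ?copair_in2 -?ed -?ec.
have e : rg_mor ha = rg_mor hb.
  apply: jm; apply: rgu_inj; rewrite /= !copair_comp; congr copair => //.
rewrite -(copair_in1 a (rg_unit R)) -(copair_in1 b (rg_unit R)).
by have := f_equal (@rgu F R) e => /= ->.
Qed.

Lemma rg_barr_exact : barr_exact (RG B).
Proof.
split; [split; [split; first exact: rg_terminal_ex | split] |].
- move=> X Y Z f g; case: (rg_pullback_ex f g) => P [p [q pb]].
  by exists P, p, q; apply: rg_pullback_of_underlying.
- move=> X Y R f r1 r2 /rg_underlying_pullback pb.
  case: (@sa_regular C) => _ [/(_ _ _ _ _ _ _ pb) [Q [q co]] _].
  case: (coequalizer_lift co (h := rg_dom X)) => [|d hd]; first by rewrite !rgu_dom.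
  case: (coequalizer_lift co (h := rg_cod X)) => [|c hc]; first by rewrite !rgu_cod.
  exists (rg_quotient hd hc), (rg_mor (rg_quotient_map hd hc)).
  exact: rg_coequalizer_of_underlying.
- move=> X Y Z P f g p q /rg_underlying_pullback pb /rg_underlying_regular_epi rg.
  by apply: rg_regular_epi_of_underlying; apply: (regular_epi_pullback _ pb) => //;
    apply: sa_regular.
move=> R X r1 r2 [jm [[r [er1 er2]] [[s [es1 es2]] tr]]].
have eqr : equivalence_relation (rgu r1) (rgu r2).
{ split; first exact: rg_jointly_monic.
  split; first by exists (rgu r); rewrite -!rgu_comp er1 er2.
  split; first by exists (rgu s); rewrite -!rgu_comp es1 es2.
  move=> T t1 t2 pT; case: (rg_pullback_ex r2 r1) => T' [t1' [t2' pT']].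
  case: (tr T' t1' t2') => [|t [et1 et2]]; first exact: rg_pullback_of_underlying.
  case: (pullback_lift pT' (pullback_comm pT)) => h [<- <-].
  exists (rgu t ∘ h); rewrite -!comp_assoc -!rgu_comp et1 et2 //. }
case: (equivalence_relation_quotient (sa_exact C) eqr) => Q [q [rq pq]].
have co := kernel_pair_coequalizer rq pq.
case: (coequalizer_lift co (h := rg_dom X)) => [|d hd]; first by rewrite !rgu_dom.
case: (coequalizer_lift co (h := rg_cod X)) => [|c hc]; first by rewrite !rgu_cod.
exists (rg_quotient hd hc), (rg_mor (rg_quotient_map hd hc)).
exact: rg_pullback_of_underlying.
Qed.

Lemma rg_iso_of_underlying G H (f : G ~> H) : iso (rgu f) -> iso f.
Proof.
move=> [g [gf fg]].
have hg : is_rg_morphism g.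
  split; last split.
  - by rewrite -(rgu_dom f) comp_assoc fg comp_id_r.
  - by rewrite -(rgu_cod f) comp_assoc fg comp_id_r.
  - by rewrite -(rgu_unit f) -comp_assoc gf comp_id_l.
by exists (rg_mor hg); split; apply: rgu_inj.
Qed.

Lemma rg_underlying_iso G H (f : G ~> H) : iso f -> iso (rgu f).
Proof. by move=> [g [gf fg]]; exists (rgu g); rewrite -!rgu_comp gf fg. Qed.

Lemma rg_protomodular : protomodular (RG B).
Proof.
move=> E F A A' v p s p' s' h D D' d1 d2 d1' d2' k ps ps' ph hs
  /rg_underlying_pullback pb /rg_underlying_pullback pb' e1 e2 /rg_underlying_iso ik.
apply: rg_iso_of_underlying.
apply: (@sa_protomodular C _ _ _ _ _ _ (rgu s) _ (rgu s') _ _ _ _ _ _ _ (rgu k)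
  _ _ _ _ pb pb') => //; rewrite -!rgu_comp ?ps ?ps' ?ph ?hs ?e1 ?e2 //.
Qed.

(** The coproduct of graphs is the pushout of their units, a quotient of the
    coproduct in [C]. *)
Lemma rg_coproduct_ex G H : exists (T : RG B) (i : G ~> T) (j : H ~> T),
  is_coproduct i j.
Proof.
set U := coprod (rg_ob G) (rg_ob H).
set u1 := in1 (rg_ob G) (rg_ob H) ∘ rg_unit G.
set u2 := in2 (rg_ob G) (rg_ob H) ∘ rg_unit H.
case: (@reflexive_pair_quotient C (sa_exact C) (@sa_protomodular C) _ _ _
  (copair (idm U) u1) (copair (idm U) u2) (idm U) (in1 U B)) => [|||Q [q [rq [co _]]]].
  by apply: iso_regular_epi; exists (idm _); rewrite comp_id_l.
  by rewrite copair_in1.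
  by rewrite copair_in1.
have eqU : q ∘ u1 = q ∘ u2.
  by rewrite -(copair_in2 (idm U) u1) -(copair_in2 (idm U) u2) -!comp_assoc;
    case: co => ->.
have descend : forall W (a : rg_ob G ~> W) (b : rg_ob H ~> W),
    a ∘ rg_unit G = b ∘ rg_unit H -> exists k : Q ~> W, k ∘ q = copair a b.
  move=> W a b e; apply: (coequalizer_lift co).
  by rewrite !copair_comp !comp_id_r /u1 /u2 -!comp_assoc copair_in1 copair_in2 e.
case: (descend B (rg_dom G) (rg_dom H)) => [|d ed]; first by rewrite !rg_dom_unit.
case: (descend B (rg_cod G) (rg_cod H)) => [|c ec]; first by rewrite !rg_cod_unit.
have du : d ∘ (q ∘ u1) = idm B.
  by rewrite -comp_assoc ed -comp_assoc copair_in1 rg_dom_unit.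
have cu : c ∘ (q ∘ u1) = idm B.
  by rewrite -comp_assoc ec -comp_assoc copair_in1 rg_cod_unit.
pose T := {| rg_dom_unit := du; rg_cod_unit := cu |} : RG B.
have hi : is_rg_morphism (G := G) (H := T) (q ∘ in1 _ _).
  split; last split=> //=.
  - by rewrite -comp_assoc ed copair_in1.
  - by rewrite -comp_assoc ec copair_in1.
  - by rewrite comp_assoc.
have hj : is_rg_morphism (G := H) (H := T) (q ∘ in2 _ _).
  split; last split=> //=.
  - by rewrite -comp_assoc ed copair_in2.
  - by rewrite -comp_assoc ec copair_in2.
  - by rewrite comp_assoc -/u2 eqU.
exists T, (rg_mor hi), (rg_mor hj) => W a b.
case: (descend _ (rgu a) (rgu b)) => [|k ek]; first by rewrite !rgu_unit.
have k1 : k ∘ (q ∘ in1 _ _) = rgu a by rewrite -comp_assoc ek copair_in1.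
have k2 : k ∘ (q ∘ in2 _ _) = rgu b by rewrite -comp_assoc ek copair_in2.
have hk : is_rg_morphism (G := T) (H := W) k.
  split; last split.
  - by apply: (regular_epi_epi rq); rewrite comp_assoc ek copair_comp !rgu_dom.
  - by apply: (regular_epi_epi rq); rewrite comp_assoc ek copair_comp !rgu_cod.
  - by rewrite /= /u1 -(comp_assoc q) -comp_assoc k1 rgu_unit.
exists (rg_mor hk); split.
  by split; apply: rgu_inj.
move=> h [h1 h2]; apply: rgu_inj; apply: (regular_epi_epi rq).
rewrite /= ek; apply: coprod_hom_ext; rewrite comp_assoc ?copair_in1 ?copair_in2.
  by rewrite -h1.
by rewrite -h2.
Qed.

End ReflexiveGraphs.

(** * Transfer along an equivalence of categories *)

Record Equivalence (D E : Category) := {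
  eqv_ob : D -> E;
  eqv_mor : forall X Y : D, X ~> Y -> eqv_ob X ~> eqv_ob Y;
  eqv_id : forall X : D, eqv_mor (idm X) = idm (eqv_ob X);
  eqv_comp : forall (X Y Z : D) (g : Y ~> Z) (f : X ~> Y),
    eqv_mor (g ∘ f) = eqv_mor g ∘ eqv_mor f;
  eqv_faithful : forall (X Y : D) (f g : X ~> Y), eqv_mor f = eqv_mor g -> f = g;
  eqv_full : forall (X Y : D) (h : eqv_ob X ~> eqv_ob Y), exists f, eqv_mor f = h;
  eqv_surj : forall Y : E, exists (X : D) (φ : eqv_ob X ~> Y), iso φ
}.

Section Transfer.
Context {D E : Category} (F : Equivalence D E).
Let Fo := eqv_ob F.
Notation Fm := (eqv_mor F).

Lemma eqv_pullback_reflect (X Y Z P : D) (f : X ~> Z) (g : Y ~> Z)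
    (p : P ~> X) (q : P ~> Y) :
  is_pullback (Fm f) (Fm g) (Fm p) (Fm q) -> is_pullback f g p q.
Proof.
move=> pb; apply: pullback_intro.
- by apply: (eqv_faithful (e := F)); rewrite !eqv_comp (pullback_comm pb).
- move=> W a b e1 e2; apply: (eqv_faithful (e := F)); apply: (pullback_ext pb).
    by rewrite -!eqv_comp e1.
  by rewrite -!eqv_comp e2.
- move=> W a b e; case: (pullback_lift pb (a := Fm a) (b := Fm b)).
    by rewrite -!eqv_comp e.
  move=> h; case: (eqv_full (e := F) h) => h' <-; rewrite -!eqv_comp => -[h1 h2].
  by exists h'; split; apply: (eqv_faithful (e := F)).
Qed.

Lemma eqv_pullback_preserve (X Y Z P : D) (f : X ~> Z) (g : Y ~> Z)
    (p : P ~> X) (q : P ~> Y) :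
  is_pullback f g p q -> is_pullback (Fm f) (Fm g) (Fm p) (Fm q).
Proof.
move=> pb; apply: pullback_intro.
- by rewrite -!eqv_comp (pullback_comm pb).
- move=> W a b e1 e2; case: (eqv_surj F W) => W' [φ iφ].
  apply: (regular_epi_epi (iso_regular_epi iφ)).
  case: (eqv_full (e := F) (a ∘ φ)) => a' ea; case: (eqv_full (e := F) (b ∘ φ)) => b' eb.
  rewrite -ea -eb; congr (Fm _); apply: (pullback_ext pb); apply: (eqv_faithful (e := F)).
    by rewrite !eqv_comp ea eb -!comp_assoc e1.
  by rewrite !eqv_comp ea eb -!comp_assoc e2.
- move=> W a b e; case: (eqv_surj F W) => W' [φ [ψ [ψφ φψ]]].
  case: (eqv_full (e := F) (a ∘ φ)) => a' ea; case: (eqv_full (e := F) (b ∘ φ)) => b' eb.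
  case: (pullback_lift pb (a := a') (b := b')) => [|h [h1 h2]].
    by apply: (eqv_faithful (e := F)); rewrite !eqv_comp ea eb -!comp_assoc e.
  exists (Fm h ∘ ψ); rewrite -!comp_assoc -!eqv_comp h1 h2 ea eb !comp_assoc φψ.
  by rewrite !comp_id_r.
Qed.

Lemma eqv_coequalizer_reflect (X Y Q : D) (a b : X ~> Y) (q : Y ~> Q) :
  is_coequalizer (Fm a) (Fm b) (Fm q) -> is_coequalizer a b q.
Proof.
move=> co; split; first by apply: (eqv_faithful (e := F)); rewrite !eqv_comp; case: co.
move=> W h eh; case: (coequalizer_lift co (h := Fm h)) => [|k].
  by rewrite -!eqv_comp eh.
case: (eqv_full (e := F) k) => k' <-; rewrite -eqv_comp => /eqv_faithful ek.
exists k'; split=> // k'' ek''; apply: (eqv_faithful (e := F)).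
by apply: (coequalizer_epi co); rewrite -!eqv_comp ek ek''.
Qed.

Lemma eqv_coequalizer_preserve (X Y Q : D) (a b : X ~> Y) (q : Y ~> Q) :
  is_coequalizer a b q -> is_coequalizer (Fm a) (Fm b) (Fm q).
Proof.
move=> co; split; first by rewrite -!eqv_comp; case: co => ->.
move=> W h eh; case: (eqv_surj F W) => W' [φ [ψ [ψφ φψ]]].
case: (eqv_full (e := F) (ψ ∘ h)) => h' eh'.
case: (coequalizer_lift co (h := h')) => [|k ek].
  by apply: (eqv_faithful (e := F)); rewrite !eqv_comp eh' !comp_assoc eh.
exists (φ ∘ Fm k); split.
  by rewrite comp_assoc -eqv_comp ek eh' -comp_assoc φψ comp_id_l.
move=> l el; case: (eqv_full (e := F) (ψ ∘ l)) => l' el'.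
suff -> : k = l' by rewrite el' -comp_assoc φψ comp_id_l.
apply: (coequalizer_epi co); apply: (eqv_faithful (e := F)).
by rewrite !eqv_comp el' comp_assoc el -eqv_comp ek.
Qed.

Lemma eqv_regular_epi_preserve (X Y : D) (q : X ~> Y) :
  regular_epi q -> regular_epi (Fm q).
Proof.
move=> [W [a [b co]]]; exists (Fo W), (Fm a), (Fm b).
exact: eqv_coequalizer_preserve.
Qed.

Lemma eqv_regular_epi_reflect (X Y : D) (q : X ~> Y) :
  regular_epi (Fm q) -> regular_epi q.
Proof.
move=> [W [a [b [e u]]]]; case: (eqv_surj F W) => W' [φ iφ].
case: (eqv_full (e := F) (a ∘ φ)) => a' ea; case: (eqv_full (e := F) (b ∘ φ)) => b' eb.
exists W', a', b'; apply: eqv_coequalizer_reflect; split.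
  by rewrite ea eb -!comp_assoc e.
move=> V h; rewrite ea eb -!comp_assoc => /(regular_epi_epi (iso_regular_epi iφ)).
exact: u.
Qed.

Lemma eqv_iso_reflect (X Y : D) (f : X ~> Y) : iso (Fm f) -> iso f.
Proof.
move=> [g]; case: (eqv_full (e := F) g) => g' <-; rewrite -!eqv_comp -!eqv_id.
by move=> [e1 e2]; exists g'; split; apply: (eqv_faithful (e := F)).
Qed.

Lemma eqv_iso_preserve (X Y : D) (f : X ~> Y) : iso f -> iso (Fm f).
Proof. by move=> [g [e1 e2]]; exists (Fm g); rewrite -!eqv_comp -!eqv_id e1 e2. Qed.

Lemma eqv_pullback_ex (X Y Z : D) (f : X ~> Z) (g : Y ~> Z) : regular_category E ->
  exists (P : D) (p : P ~> X) (q : P ~> Y), is_pullback f g p q.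
Proof.
move=> hE; case: (pullback_ex hE (Fm f) (Fm g)) => P [p [q pb]].
case: (eqv_surj F P) => P' [φ iφ]; have [ψ [ψφ φψ]] := iφ.
case: (eqv_full (e := F) (p ∘ φ)) => p' ep; case: (eqv_full (e := F) (q ∘ φ)) => q' eq.
exists P', p', q'; apply: eqv_pullback_reflect; rewrite ep eq; apply: pullback_intro.
- by rewrite -!comp_assoc (pullback_comm pb).
- move=> W a b; rewrite !comp_assoc => e1 e2; apply: (iso_mono iφ).
  exact: (pullback_ext pb).
- move=> W a b /(pullback_lift pb) [h [h1 h2]]; exists (ψ ∘ h).
  by crw φψ; rewrite !comp_id_l.
Qed.

Lemma eqv_equivalence_relation (R X : D) (r1 r2 : R ~> X) : regular_category E ->
  equivalence_relation r1 r2 -> equivalence_relation (Fm r1) (Fm r2).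
Proof.
move=> hE [jm [[r [er1 er2]] [[s [es1 es2]] tr]]]; split; last split; last split.
- move=> W a b e1 e2; case: (eqv_surj F W) => W' [φ iφ].
  apply: (regular_epi_epi (iso_regular_epi iφ)).
  case: (eqv_full (e := F) (a ∘ φ)) => a' ea; case: (eqv_full (e := F) (b ∘ φ)) => b' eb.
  rewrite -ea -eb; congr (Fm _); apply: jm; apply: (eqv_faithful (e := F)).
    by rewrite !eqv_comp ea eb -!comp_assoc e1.
  by rewrite !eqv_comp ea eb -!comp_assoc e2.
- by exists (Fm r); rewrite -!eqv_comp er1 er2 eqv_id.
- by exists (Fm s); rewrite -!eqv_comp es1 es2.
- move=> T t1 t2 pT; case: (eqv_pullback_ex r2 r1 hE) => T' [t1' [t2' pT']].
  case: (tr _ _ _ pT') => t [et1 et2].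
  case: (pullback_lift (eqv_pullback_preserve pT') (pullback_comm pT)) => h [<- <-].
  by exists (Fm t ∘ h); rewrite -!comp_assoc -!eqv_comp et1 et2.
Qed.

Lemma eqv_barr_exact : barr_exact E -> barr_exact D.
Proof.
move=> hE; have [hR eff] := hE; have [[[T hT] _] [coeq stab]] := hR.
split; [split; [split | split] |].
- case: (eqv_surj F T) => T' [φ iφ]; exists T' => X.
  case: (hT (Fo X)) => t ut; have [ψ [_ φψ]] := iφ.
  case: (eqv_full (e := F) (ψ ∘ t)) => f _; exists f => g.
  by apply: (eqv_faithful (e := F)); apply: (iso_mono iφ); rewrite (ut (φ ∘ _)) (ut (φ ∘ Fm f)).
- by move=> X Y Z f g; apply: eqv_pullback_ex.
- move=> X Y R f r1 r2 /eqv_pullback_preserve /coeq [Q [q co]].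
  case: (eqv_surj F Q) => Q' [φ iφ]; have [ψ [ψφ φψ]] := iφ.
  case: (eqv_full (e := F) (ψ ∘ q)) => q' eq; exists Q', q'.
  apply: eqv_coequalizer_reflect; rewrite eq; have [e _] := co; split.
    by rewrite !comp_assoc e.
  move=> W h /(coequalizer_lift co) [k ek]; exists (k ∘ φ); split.
    by rewrite comp_assoc; crw φψ; rewrite comp_id_l.
  move=> k' ek'; apply: (regular_epi_epi (q := ψ)).
    by apply: iso_regular_epi; exists φ.
  by apply: (coequalizer_epi co); rewrite !comp_assoc ek'; crw φψ; rewrite comp_id_l.
- move=> X Y Z P f g p q /eqv_pullback_preserve pb /eqv_regular_epi_preserve rg.
  by apply: eqv_regular_epi_reflect; apply: (stab _ _ _ _ _ _ _ _ pb).
- move=> R X r1 r2 /(eqv_equivalence_relation hR) /eff [Q [q pq]].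
  case: (eqv_surj F Q) => Q' [φ iφ]; have [ψ [ψφ φψ]] := iφ.
  case: (eqv_full (e := F) (ψ ∘ q)) => q' eq; exists Q', q'.
  apply: eqv_pullback_reflect; rewrite eq; apply: pullback_intro.
  + by rewrite !comp_assoc (pullback_comm pq).
  + by move=> W a b; apply: (pullback_ext pq).
  + move=> W a b e; apply: (pullback_lift pq).
    by rewrite -(comp_id_l q) -φψ !comp_assoc; move: e; rewrite !comp_assoc => ->.
Qed.

Lemma eqv_protomodular : protomodular E -> protomodular D.
Proof.
move=> hP V B A A' v p s p' s' h K K' d1 d2 d1' d2' k ps ps' ph hs
  /eqv_pullback_preserve pb /eqv_pullback_preserve pb' e1 e2 /eqv_iso_preserve ik.
apply: eqv_iso_reflect.
apply: (hP _ _ _ _ _ _ (Fm s) _ (Fm s') _ _ _ _ _ _ _ (Fm k) _ _ _ _ pb pb') => //;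
  by rewrite -?eqv_comp -?eqv_id ?ps ?ps' ?ph ?hs ?e1 ?e2.
Qed.

Lemma eqv_quasi_pointed : quasi_pointed E -> quasi_pointed D.
Proof.
move=> [Z [hZ sub]]; case: (eqv_surj F Z) => Z' [φ iφ]; have [ψ [ψφ φψ]] := iφ.
exists Z'; split.
  move=> X; case: (hZ (Fo X)) => z _; case: (eqv_full (e := F) (z ∘ φ)) => f ef.
  exists f => g; apply: (eqv_faithful (e := F)).
  apply: (regular_epi_epi (q := ψ)); first by apply: iso_regular_epi; exists φ.
  exact: initial_ext.
move=> W a b; apply: (eqv_faithful (e := F)); apply: (iso_mono iφ); exact: sub.
Qed.

Lemma eqv_coproduct_ex (X Y : D) :
  (exists (T : E) (i : Fo X ~> T) (j : Fo Y ~> T), is_coproduct i j) ->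
  exists (T : D) (i : X ~> T) (j : Y ~> T), is_coproduct i j.
Proof.
move=> [T [i [j co]]]; case: (eqv_surj F T) => T' [φ [ψ [ψφ φψ]]].
case: (eqv_full (e := F) (ψ ∘ i)) => i' ei; case: (eqv_full (e := F) (ψ ∘ j)) => j' ej.
exists T', i', j' => W a b; case: (coproduct_lift co (Fm a) (Fm b)) => h [h1 h2].
case: (eqv_full (e := F) (h ∘ φ)) => h' eh; exists h'; split.
  by split; apply: (eqv_faithful (e := F)); rewrite eqv_comp ?ei ?ej eh comp_assoc;
    crw φψ; rewrite comp_id_l.
move=> k [k1 k2]; apply: (eqv_faithful (e := F)); rewrite eh.
apply: (regular_epi_epi (q := ψ)); first by apply: iso_regular_epi; exists φ.
rewrite comp_assoc φψ comp_id_r; apply: (coproduct_ext co).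
  by rewrite comp_assoc -ei -eqv_comp k1.
by rewrite comp_assoc -ej -eqv_comp k2.
Qed.

End Transfer.

(** * Precrossed modules and reflexive graphs *)

Section Normalization.
Context {C : SemiAbelian} {B : C}.
Implicit Types M N X Y : PXMod B.
Implicit Types G H L : RG B.

Lemma underlying_comp M N X (g : N ~> X) (f : M ~> N) :
  underlying (g ∘ f) = underlying g ∘ underlying f.
Proof. by []. Qed.

Lemma underlying_inj M N (f g : M ~> N) : underlying f = underlying g -> f = g.
Proof. exact: PXHom_ext. Qed.

Lemma underlying_bd M N (f : M ~> N) : px_bd N ∘ underlying f = px_bd M.
Proof. by case: f => f []. Qed.

Lemma underlying_act M N (f : M ~> N) :
  underlying f ∘ px_act M = px_act N ∘ flat_map (idm B) (underlying f).
Proof. by case: f => f []. Qed.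

Lemma normalization_act G M (k : px_ob M ~> rg_ob G) : is_normalization k ->
  k ∘ px_act M = copair (rg_unit G) k ∘ flat_ker B (px_ob M).
Proof. by case=> [[_ []]]. Qed.

Lemma normalization_kernel G M (k : px_ob M ~> rg_ob G) : is_normalization k ->
  is_kernel k (rg_dom G).
Proof. by case=> [[_ []]]. Qed.

Lemma normalization_mono G M (k : px_ob M ~> rg_ob G) : is_normalization k -> mono k.
Proof. by move/normalization_kernel/(kernel_mono (@sa_quasi_pointed C)). Qed.

Lemma normalization_cod G M (k : px_ob M ~> rg_ob G) : is_normalization k ->
  rg_cod G ∘ k = px_bd M.
Proof. by case. Qed.

Lemma normalization_dom G M (k : px_ob M ~> rg_ob G) : is_normalization k ->
  rg_dom G ∘ k = zero_mor _ B.
Proof. by move/normalization_kernel/kernel_null/null_zero. Qed.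

Lemma normalization_hom_ext G M (k : px_ob M ~> rg_ob G) W (a b : rg_ob G ~> W) :
  is_normalization k -> a ∘ rg_unit G = b ∘ rg_unit G -> a ∘ k = b ∘ k -> a = b.
Proof.
move=> nk; apply: point_hom_ext (rg_dom_unit G) (normalization_kernel nk).
Qed.

Lemma graph_of_precrossed_ex M :
  exists (G : RG B) (k : px_ob M ~> rg_ob G), is_normalization k.
Proof.
case: (semidirect_ex (px_actP M)) => S [p [i [j sd]]].
case: (semidirect_lift sd (a := px_bd M) (b := idm B)) => [|c [ci cj]].
  by rewrite px_precrossed /conjugation copair_flat_map !comp_id_l.
have pi : p ∘ i = idm B by case: sd.
by exists {| rg_dom_unit := pi; rg_cod_unit := ci |}, j.
Qed.

Lemma precrossed_of_graph_ex G :
  exists (M : PXMod B) (k : px_ob M ~> rg_ob G), is_normalization k.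
Proof.
have kk := ker_kernel (rg_dom G).
case: (point_action (rg_dom_unit G) kk) => xi [axi sd].
have pre : (rg_cod G ∘ ker (rg_dom G)) ∘ xi
    = conjugation B ∘ flat_map (idm B) (rg_cod G ∘ ker (rg_dom G)).
  rewrite /conjugation copair_flat_map !comp_id_l.
  case: sd => [_ [_ e]]; rewrite comp_assoc e -comp_assoc copair_comp.
  by rewrite rg_cod_unit.
by exists {| px_actP := axi; px_precrossed := pre |}, (ker (rg_dom G)).
Qed.

Lemma normalization_extend G H M N (k : px_ob M ~> rg_ob G) (k' : px_ob N ~> rg_ob H)
    (u : M ~> N) : is_normalization k -> is_normalization k' ->
  exists g : G ~> H, rgu g ∘ k = k' ∘ underlying u.
Proof.
move=> nk nk'.
case: (semidirect_lift (proj1 nk) (a := k' ∘ underlying u) (b := rg_unit H)) => [|g [g1 g2]].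
  crw (underlying_act u); crw (normalization_act nk').
  by rewrite -comp_assoc copair_flat_map comp_id_r.
have hg : is_rg_morphism (G := G) (H := H) g.
  split; last split=> //; apply: (normalization_hom_ext nk).
  - by rewrite comp_assoc g1 !rg_dom_unit.
  - by rewrite comp_assoc g2 -comp_assoc !normalization_dom // zero_comp_l.
  - by rewrite comp_assoc g1 !rg_cod_unit.
  - by rewrite comp_assoc g2 -comp_assoc !normalization_cod // underlying_bd.
by exists (rg_mor hg).
Qed.

Lemma normalization_restrict G H M N (k : px_ob M ~> rg_ob G) (k' : px_ob N ~> rg_ob H)
    (g : G ~> H) : is_normalization k -> is_normalization k' ->
  exists u : M ~> N, rgu g ∘ k = k' ∘ underlying u.
Proof.
move=> nk nk'; case: (kernel_lift (normalization_kernel nk') (x := rgu g ∘ k)) => [|u eu].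
  by rewrite -comp_assoc rgu_dom; apply: (kernel_null (normalization_kernel nk)).
have hu : is_px_morphism (M := M) (N := N) u.
  split; first by rewrite -(normalization_cod nk') comp_assoc eu -comp_assoc rgu_cod
    normalization_cod.
  apply: (normalization_mono nk'); rewrite -!comp_assoc eu (normalization_act nk').
  rewrite copair_flat_map comp_id_r eu; crw (normalization_act nk).
  by rewrite -comp_assoc copair_comp rgu_unit.
by exists (exist _ u hu).
Qed.

(** [u] is the pullback of [g] along the kernel [k'], and [g] is a quotient of
    [idm B + u] because [e, k'] is regular epic, [e] being the unit of [H]. *)
Lemma normalization_regular_epi G H M N (k : px_ob M ~> rg_ob G)
    (k' : px_ob N ~> rg_ob H) (g : G ~> H) (u : px_ob M ~> px_ob N) :
  is_normalization k -> is_normalization k' -> rgu g ∘ k = k' ∘ u ->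
  regular_epi (rgu g) <-> regular_epi u.
Proof.
move=> nk nk' e; split=> r.
- case: (lift_along (@sa_regular C) k' r) => W [ε [x [rε ex]]].
  case: (kernel_lift (normalization_kernel nk) (x := x)) => [|y ey].
    rewrite -(rgu_dom g) comp_assoc ex -comp_assoc; apply: null_comp_r.
    exact: (kernel_null (normalization_kernel nk')).
  apply: (regular_epi_cancel (@sa_regular C) (f := y)).
  suff -> : u ∘ y = ε by [].
  by apply: (normalization_mono nk'); rewrite -comp_assoc -e comp_assoc ey.
- apply: (regular_epi_cancel (@sa_regular C) (f := copair (rg_unit G) k)).
  have -> : rgu g ∘ copair (rg_unit G) k = copair (rg_unit H) k' ∘ coprod_map (idm B) u.
    by rewrite copair_comp copair_map rgu_unit e comp_id_r.
  apply: (regular_epi_comp (@sa_regular C)).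
    exact: point_copair_regular_epi (rg_dom_unit H) (normalization_kernel nk').
  apply: coprod_map_regular_epi r; apply: iso_regular_epi.
  by exists (idm B); rewrite comp_id_l.
Qed.

(** Chosen once for all, so that passing from precrossed modules to graphs is a
    functor. *)
Definition px_graph M : RG B :=
  proj1_sig (constructive_indefinite_description _ (graph_of_precrossed_ex M)).

Definition px_graph_ker M : px_ob M ~> rg_ob (px_graph M) :=
  proj1_sig (constructive_indefinite_description _
    (proj2_sig (constructive_indefinite_description _ (graph_of_precrossed_ex M)))).

Lemma px_graph_normalization M : is_normalization (px_graph_ker M).
Proof.
exact: (proj2_sig (constructive_indefinite_description _
    (proj2_sig (constructive_indefinite_description _ (graph_of_precrossed_ex M))))).
Qed.

Definition px_graph_mor M N (u : M ~> N) : px_graph M ~> px_graph N :=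
  proj1_sig (constructive_indefinite_description _
    (normalization_extend u (px_graph_normalization M) (px_graph_normalization N))).

Lemma px_graph_mor_ker M N (u : M ~> N) :
  rgu (px_graph_mor u) ∘ px_graph_ker M = px_graph_ker N ∘ underlying u.
Proof.
exact: (proj2_sig (constructive_indefinite_description _
    (normalization_extend u (px_graph_normalization M) (px_graph_normalization N)))).
Qed.

Lemma px_graph_hom_ext M H (f g : px_graph M ~> H) :
  rgu f ∘ px_graph_ker M = rgu g ∘ px_graph_ker M -> f = g.
Proof.
move=> e; apply: rgu_inj; apply: (normalization_hom_ext (px_graph_normalization M)) => //.
by rewrite !rgu_unit.
Qed.

Definition px_graph_equivalence : Equivalence (PXMod B) (RG B).
Proof.
exists px_graph px_graph_mor.
- move=> M; apply: px_graph_hom_ext; rewrite px_graph_mor_ker.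
  by rewrite /= comp_id_l comp_id_r.
- move=> M N X g f; apply: px_graph_hom_ext.
  by rewrite px_graph_mor_ker rgu_comp comp_assoc px_graph_mor_ker -comp_assoc
    px_graph_mor_ker comp_assoc.
- move=> M N f g e; apply: underlying_inj.
  apply: (normalization_mono (px_graph_normalization N)).
  by rewrite -!px_graph_mor_ker e.
- move=> M N h.
  case: (normalization_restrict h (px_graph_normalization M) (px_graph_normalization N)).
  by move=> u eu; exists u; apply: px_graph_hom_ext; rewrite px_graph_mor_ker.
- move=> G; case: (precrossed_of_graph_ex G) => M [k nk]; exists M.
  have nM := px_graph_normalization M.
  case: (normalization_extend (idm M) nM nk) => f ef.
  case: (normalization_extend (idm M) nk nM) => g eg.
  exists f; apply: rg_iso_of_underlying; exists (rgu g); split.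
  + apply: (normalization_hom_ext nM); first by rewrite comp_assoc !rgu_unit comp_id_l.
    by rewrite comp_assoc ef /= comp_id_r eg /= comp_id_r comp_id_l.
  + apply: (normalization_hom_ext nk); first by rewrite comp_assoc !rgu_unit comp_id_l.
    by rewrite comp_assoc eg /= comp_id_r ef /= comp_id_r comp_id_l.
Defined.

Definition px_barr_exact : barr_exact (PXMod B) :=
  eqv_barr_exact px_graph_equivalence rg_barr_exact.

Definition px_regular : regular_category (PXMod B) := proj1 px_barr_exact.

Definition px_protomodular : protomodular (PXMod B) :=
  eqv_protomodular px_graph_equivalence rg_protomodular.

Definition px_quasi_pointed : quasi_pointed (PXMod B) :=
  eqv_quasi_pointed px_graph_equivalence rg_quasi_pointed.

Lemma px_coproduct_ex M N : exists (T : PXMod B) (i : M ~> T) (j : N ~> T),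
  is_coproduct i j.
Proof. by apply: (eqv_coproduct_ex (F := px_graph_equivalence)); apply: rg_coproduct_ex. Qed.

Lemma px_regular_epi M N (u : M ~> N) : regular_epi u <-> regular_epi (underlying u).
Proof.
have h := normalization_regular_epi (px_graph_normalization M)
  (px_graph_normalization N) (px_graph_mor_ker u).
split.
- move/(eqv_regular_epi_preserve px_graph_equivalence)/rg_underlying_regular_epi.
  by case: h => h _; apply: h.
- case: h => _ h /h r; apply: (eqv_regular_epi_reflect (F := px_graph_equivalence)).
  exact: rg_regular_epi_of_underlying.
Qed.

End Normalization.

(** * Morphisms out of a semidirect product of precrossed modules *)

Section PeifferCommutators.
Context {C : SemiAbelian} {B : C}.
Implicit Types A D M N Q S T W X Y : PXMod B.
Implicit Types G H L : RG B.
Let sq := @sa_quasi_pointed C.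

Lemma flat_map_comp2 (A1 A2 A3 X1 X2 X3 : C) (u' : A2 ~> A3) (u : A1 ~> A2)
    (v' : X2 ~> X3) (v : X1 ~> X2) :
  flat_map u' v' ∘ flat_map u v = flat_map (u' ∘ u) (v' ∘ v).
Proof.
apply: flat_hom_ext; crw (flat_map_ker u' v'); rewrite !flat_map_ker -comp_assoc.
by rewrite /coprod_map copair_map !comp_assoc.
Qed.

Lemma copair_zero_flat_ker (A X W : C) (b : A ~> W) :
  copair b (zero_mor X W) ∘ flat_ker A X = zero_mor _ W.
Proof.
have -> : copair b (zero_mor X W) = b ∘ copair (idm A) (zero_mor X A).
  by rewrite copair_comp comp_id_r zero_comp_r.
by rewrite comp_assoc flat_ker_comp zero_comp_r.
Qed.

(** The initial precrossed module has zero underlying object: it is a retract of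
    the normalization of the discrete graph, whose domain map is an identity. *)
Lemma px_initial_zero (Z : PXMod B) : is_initial Z -> idm (px_ob Z) = zero_mor _ _.
Proof.
move=> hZ; case: (precrossed_of_graph_ex (@rg_discrete C B)) => M [k nk].
have idM : idm (px_ob M) = zero_mor _ _.
  apply: (normalization_mono nk); rewrite comp_id_r zero_comp_r.
  by rewrite -[k]comp_id_l; exact: (normalization_dom nk).
case: (hZ M) => f _.
case: (rg_discrete_initial (px_graph Z)) => z _.
case: (normalization_restrict z nk (px_graph_normalization Z)) => g _.
have e : g ∘ f = idm Z by apply: initial_ext.
have e' : underlying g ∘ underlying f = idm (px_ob Z) by rewrite -underlying_comp e.
by rewrite -e' -(comp_id_l (underlying f)) idM zero_comp_l zero_comp_r.
Qed.

Lemma px_null_zero M N (f : M ~> N) : null f -> underlying f = zero_mor _ _.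
Proof.
move=> [Z [a [b [hZ ->]]]].
by rewrite underlying_comp -(comp_id_l (underlying a)) (px_initial_zero hZ)
  zero_comp_l zero_comp_r.
Qed.

(** The condition under which [a] and [b] extend to the semidirect product of
    [X] and [Y] in precrossed modules. The graph of that product is the
    semidirect product of [X] with the whole graph of [Y], acting through the
    codomain; the condition therefore has to be imposed over the graph of [Y]
    rather than over [Y] alone. *)
Definition extends_to_semidirect X Y W (a : X ~> W) (b : Y ~> W) : Prop :=
  px_graph_ker W ∘ underlying a ∘ pullback_action (rg_cod (px_graph Y)) (px_act X)
  = copair (rgu (px_graph_mor b)) (px_graph_ker W ∘ underlying a)
      ∘ flat_ker (rg_ob (px_graph Y)) (px_ob X).

(** The composite graph [L] is the pullback of a split epimorphism along the
    codomain of the graph of [Y], hence again a semidirect product with kernel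
    [X], in which the graph of [Y] acts through its codomain. *)
Lemma px_semidirect_graph X Y S (j : X ~> S) (i : Y ~> S) : is_px_semidirect j i ->
  exists (L : RG B) (w : px_ob S ~> rg_ob L) (p : rg_ob L ~> rg_ob (px_graph Y))
    (s : px_graph Y ~> L),
  is_normalization w /\
  is_semidirect (pullback_action (rg_cod (px_graph Y)) (px_act X))
    p (rgu s) (w ∘ underlying j) /\
  rgu s ∘ px_graph_ker Y = w ∘ underlying i.
Proof.
move=> [p [G [H [L [kX [kY [w [p1 [p2 [sd [nX [nY [cg [nw [e1 [e2 e3]]]]]]]]]]]]]]]].
have [pb [dL [cL [p1u p2u]]]] := cg.
have nY0 := px_graph_normalization Y.
case: (normalization_extend (idm Y) nY0 nY) => θ eθ.
case: (normalization_extend (idm Y) nY nY0) => θ' eθ'.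
rewrite /= comp_id_r in eθ; rewrite /= comp_id_r in eθ'.
have θθ' : rgu θ ∘ rgu θ' = idm _.
  apply: (normalization_hom_ext nY); first by rewrite comp_assoc !rgu_unit comp_id_l.
  by rewrite comp_assoc eθ' eθ comp_id_l.
have θ'θ : rgu θ' ∘ rgu θ = idm _.
  apply: (normalization_hom_ext nY0); first by rewrite comp_assoc !rgu_unit comp_id_l.
  by rewrite comp_assoc eθ eθ' comp_id_l.
case: (pullback_lift pb (a := rg_unit G ∘ rg_cod H) (b := idm _)) => [|s0 [s1 s2]].
  by rewrite -comp_assoc rg_dom_unit comp_id_l comp_id_r.
have hs : is_rg_morphism (G := H) (H := L) s0.
  split; last split.
  - by rewrite dL comp_assoc s2 comp_id_r.
  - by rewrite cL comp_assoc s1 -comp_assoc rg_cod_unit comp_id_l.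
  - apply: (pullback_ext pb); rewrite -comp_assoc ?s1 ?s2 ?p1u ?p2u ?comp_id_l //.
    by rewrite comp_assoc rg_cod_unit comp_id_r.
have [_ [kj _]] := sd.
have p2wj : p2 ∘ (w ∘ underlying j) = zero_mor _ _.
  apply: null_zero; rewrite -comp_assoc e3 comp_assoc.
  by apply: null_comp_l; apply: kernel_null.
exists L, w, (rgu θ' ∘ p2), (rg_mor hs ∘ θ); split=> //.
have -> : rgu (rg_mor hs ∘ θ) = s0 ∘ rgu θ by [].
split.
  split; first by crw s2; rewrite comp_id_l.
  split.
    apply: (kernel_intro sq).
    - by apply: mono_comp; [exact: normalization_mono nw | exact: (kernel_mono sq kj)].
    - by rewrite comp_assoc p2wj zero_comp_r; apply: zero_mor_null.
    - move=> V x nx.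
      have n2 : null (p2 ∘ x).
        by rewrite -(comp_id_l p2) -θθ' !comp_assoc -!(comp_assoc (rgu θ')); apply: null_comp_l.
      case: (kernel_lift (normalization_kernel nw) (x := x)) => [|y ey].
        by rewrite dL comp_assoc; apply: null_comp_l.
      case: (kernel_lift kj (x := y)) => [|z ez].
        apply: (null_mono sq (normalization_mono nY)).
        by rewrite -comp_assoc -e3 comp_assoc ey.
      by exists z; rewrite comp_assoc ez.
  apply: (pullback_ext pb).
    rewrite -!comp_assoc e1 (normalization_act nX) copair_flat_map comp_id_r.
    by rewrite copair_comp -!comp_assoc e1 s1 comp_assoc rgu_cod.
  rewrite -comp_assoc p2wj zero_comp_l -comp_assoc copair_comp p2wj.
  by rewrite copair_zero_flat_ker.
rewrite comp_assoc eθ; apply: (pullback_ext pb).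
  by crw s1; rewrite (normalization_cod nY); rewrite -comp_assoc e2.
by crw s2; crw e3; case: sd => -> _; rewrite comp_id_l comp_id_r.
Qed.

(** Morphisms out of [S] are morphisms of graphs out of its graph, to which the
    universal property of the semidirect product in [C] applies. *)
Lemma extends_to_semidirectP X Y S W (j : X ~> S) (i : Y ~> S) (a : X ~> W) (b : Y ~> W) :
  is_px_semidirect j i ->
  (exists v : S ~> W, v ∘ j = a /\ v ∘ i = b) <-> extends_to_semidirect a b.
Proof.
move=> /px_semidirect_graph [L [w [p [s [nw [sd si]]]]]].
have nW := px_graph_normalization W; have nY := px_graph_normalization Y.
have [ps [kp act]] := sd.
split.
- move=> [v [<- <-]]; case: (normalization_extend v nw nW) => g eg.
  have eb : px_graph_mor (v ∘ i) = g ∘ s.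
    apply: px_graph_hom_ext; rewrite px_graph_mor_ker rgu_comp comp_assoc si.
    by rewrite -comp_assoc eg comp_assoc.
  rewrite /extends_to_semidirect eb underlying_comp -comp_assoc -eg rgu_comp.
  rewrite !comp_assoc -(comp_assoc w) act -comp_assoc.
  by rewrite copair_comp.
- move=> h; case: (semidirect_lift sd h) => g [gs gj].
  have hg : is_rg_morphism (G := L) (H := px_graph W) g.
    split; last split.
    + apply: (point_hom_ext ps kp); first by rewrite comp_assoc gs !rgu_dom.
      rewrite comp_assoc gj -!comp_assoc (normalization_dom nw).
      by rewrite (normalization_dom nW) !zero_comp_l.
    + apply: (point_hom_ext ps kp); first by rewrite comp_assoc gs !rgu_cod.
      rewrite comp_assoc gj -!comp_assoc (normalization_cod nw).
      by rewrite (normalization_cod nW) !underlying_bd.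
    + by rewrite -(rgu_unit s) -comp_assoc gs rgu_unit.
  case: (normalization_restrict (rg_mor hg) nw nW) => v ev.
  exists v; split; apply: underlying_inj; apply: (normalization_mono nW);
    rewrite underlying_comp -comp_assoc -ev /= comp_assoc //.
  by rewrite -si -comp_assoc gs px_graph_mor_ker.
Qed.

Lemma px_graph_mor_comp M N W (v : N ~> W) (u : M ~> N) :
  rgu (px_graph_mor (v ∘ u)) = rgu (px_graph_mor v) ∘ rgu (px_graph_mor u).
Proof. by have /= -> := eqv_comp px_graph_equivalence v u. Qed.

(** Both sides of the condition are natural in [X] and [Y]: restricting along
    [x] and [y] amounts to composing with [flat_map] of the two, which is
    regular epic when [x] and [y] are. *)
Lemma extends_to_semidirect_comp X X' Y Y' W (x : X ~> X') (y : Y ~> Y')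
    (a : X' ~> W) (b : Y' ~> W) :
  let F := flat_map (rgu (px_graph_mor y)) (underlying x) in
  extends_to_semidirect (a ∘ x) (b ∘ y) <->
  px_graph_ker W ∘ underlying a ∘ pullback_action (rg_cod (px_graph Y')) (px_act X') ∘ F
  = copair (rgu (px_graph_mor b)) (px_graph_ker W ∘ underlying a)
      ∘ flat_ker (rg_ob (px_graph Y')) (px_ob X') ∘ F.
Proof.
move=> F; rewrite /extends_to_semidirect.
have -> : px_graph_ker W ∘ underlying (a ∘ x)
      ∘ pullback_action (rg_cod (px_graph Y)) (px_act X)
    = px_graph_ker W ∘ underlying a
      ∘ pullback_action (rg_cod (px_graph Y')) (px_act X') ∘ F.
  rewrite /pullback_action underlying_comp !comp_assoc; do 2!congr (_ ∘ _).
  rewrite -comp_assoc underlying_act !comp_assoc !flat_map_comp2 rgu_cod.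
  by rewrite !comp_id_l comp_id_r.
by rewrite copair_flat_map px_graph_mor_comp underlying_comp -(comp_assoc (px_graph_ker W)).
Qed.

Lemma extends_to_semidirect_restrict X X' Y Y' W (x : X ~> X') (y : Y ~> Y')
    (a : X' ~> W) (b : Y' ~> W) :
  extends_to_semidirect a b -> extends_to_semidirect (a ∘ x) (b ∘ y).
Proof. by rewrite extends_to_semidirect_comp => ->. Qed.

Lemma extends_to_semidirect_descend X X' Y Y' W (x : X ~> X') (y : Y ~> Y')
    (a : X' ~> W) (b : Y' ~> W) : regular_epi x -> regular_epi y ->
  extends_to_semidirect (a ∘ x) (b ∘ y) -> extends_to_semidirect a b.
Proof.
move=> /px_regular_epi rx /px_regular_epi ry /extends_to_semidirect_comp.
apply: regular_epi_epi; apply: flat_map_regular_epi => //.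
exact: (proj2 (normalization_regular_epi (px_graph_normalization Y)
  (px_graph_normalization Y') (px_graph_mor_ker y)) ry).
Qed.

Lemma extends_to_semidirect_null_r X Y W (a : X ~> W) (b : Y ~> W) :
  null b -> extends_to_semidirect a b.
Proof.
move/px_null_zero => b0; have nY := px_graph_normalization Y.
have nW := px_graph_normalization W.
have eb : rgu (px_graph_mor b) = rg_unit (px_graph W) ∘ rg_cod (px_graph Y).
  apply: (normalization_hom_ext nY).
    by rewrite rgu_unit comp_assoc rg_cod_unit comp_id_r.
  rewrite px_graph_mor_ker comp_assoc (normalization_cod nY) -(underlying_bd b).
  by rewrite b0 !zero_comp_r.
rewrite /extends_to_semidirect eb /pullback_action -!comp_assoc.
rewrite (comp_assoc (px_graph_ker W)) underlying_act -!comp_assoc (normalization_act nW).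
by rewrite !copair_flat_map !comp_id_r.
Qed.

Lemma extends_to_semidirect_null_l X Y W (a : X ~> W) (b : Y ~> W) :
  null a -> extends_to_semidirect a b.
Proof.
move/px_null_zero => a0.
by rewrite /extends_to_semidirect a0 zero_comp_r copair_zero_flat_ker zero_comp_l.
Qed.

(** The product is the normalization of the composite graph; the two inclusions
    normalize the morphisms of graphs (1, e d) and (e c, 1) into the pullback. *)
Lemma px_semidirect_ex X Y :
  exists (S : PXMod B) (j : X ~> S) (i : Y ~> S), is_px_semidirect j i.
Proof.
set G := px_graph X; set H := px_graph Y.
have nX : is_normalization (px_graph_ker X) := px_graph_normalization X.
have nY : is_normalization (px_graph_ker Y) := px_graph_normalization Y.
case: (pullback_ex (@sa_regular C) (rg_dom G) (rg_cod H)) => L0 [p1 [p2 pb]].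
case: (pullback_lift pb (a := rg_unit G) (b := rg_unit H)) => [|u [u1 u2]].
  by rewrite rg_dom_unit rg_cod_unit.
have du : (rg_dom H ∘ p2) ∘ u = idm B by rewrite comp_assoc u2 rg_dom_unit.
have cu : (rg_cod G ∘ p1) ∘ u = idm B by rewrite comp_assoc u1 rg_cod_unit.
pose L := {| rg_dom_unit := du; rg_cod_unit := cu |} : RG B.
case: (pullback_lift pb (a := idm _) (b := rg_unit H ∘ rg_dom G)) => [|g [g1 g2]].
  by rewrite -comp_assoc rg_cod_unit comp_id_l comp_id_r.
case: (pullback_lift pb (a := rg_unit G ∘ rg_cod H) (b := idm _)) => [|s [s1 s2]].
  by rewrite -comp_assoc rg_dom_unit comp_id_l comp_id_r.
have hg : is_rg_morphism (G := G) (H := L) g.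
  split; last split=> /=.
  - by rewrite /= comp_assoc g2 -comp_assoc rg_dom_unit comp_id_l.
  - by rewrite comp_assoc g1 comp_id_r.
  - apply: (pullback_ext pb); rewrite -comp_assoc ?g1 ?g2 ?u1 ?u2 ?comp_id_l //.
    by rewrite comp_assoc rg_dom_unit comp_id_r.
have hs : is_rg_morphism (G := H) (H := L) s.
  split; last split=> /=.
  - by rewrite /= comp_assoc s2 comp_id_r.
  - by rewrite comp_assoc s1 -comp_assoc rg_cod_unit comp_id_l.
  - apply: (pullback_ext pb); rewrite -comp_assoc ?s1 ?s2 ?u1 ?u2 ?comp_id_l //.
    by rewrite comp_assoc rg_cod_unit comp_id_r.
case: (precrossed_of_graph_ex L) => S [w nw].
case: (normalization_restrict (rg_mor hg) nX nw) => j ej; rewrite /= in ej.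
case: (normalization_restrict (rg_mor hs) nY nw) => i ei; rewrite /= in ei.
have p1wj : p1 ∘ w ∘ underlying j = px_graph_ker X.
  by rewrite comp_assoc -ej -comp_assoc g1 comp_id_l.
have p2wj : p2 ∘ w ∘ underlying j = zero_mor _ _.
  by rewrite comp_assoc -ej -comp_assoc g2 comp_assoc (normalization_dom nX) zero_comp_r.
have p1wi : p1 ∘ w ∘ underlying i = rg_unit G ∘ px_bd Y.
  by rewrite comp_assoc -ei -comp_assoc s1 comp_assoc (normalization_cod nY).
have p2wi : p2 ∘ w ∘ underlying i = px_graph_ker Y.
  by rewrite comp_assoc -ei -comp_assoc s2 comp_id_l.
case: (kernel_lift (normalization_kernel nY) (x := p2 ∘ w)) => [|p ep].
  rewrite -comp_assoc; exact: (kernel_null (normalization_kernel nw)).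
have mY := normalization_mono nY.
exists S, j, i, p, G, H, L, (px_graph_ker X), (px_graph_ker Y), w, p1, p2.
split; last by do 7!split=> //.
split; first by apply: mY; rewrite -comp_assoc ep p2wi comp_id_r.
split.
  apply: (kernel_intro sq).
  - move=> V a b e; apply: (normalization_mono nX).
    by rewrite -p1wj !comp_assoc e.
  - by apply: (null_mono sq mY); rewrite -comp_assoc ep p2wj; apply: zero_mor_null.
  - move=> V x nx.
    have n2 : null (p2 ∘ (w ∘ x)) by rewrite -comp_assoc -ep comp_assoc; apply: null_comp_l.
    case: (kernel_lift (normalization_kernel nX) (x := p1 ∘ (w ∘ x))) => [|y ey].
      by rewrite -comp_assoc (pullback_comm pb) comp_assoc; apply: null_comp_l.
    exists y; apply: (normalization_mono nw); apply: (pullback_ext pb).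
      by rewrite -!comp_assoc p1wj ey comp_assoc.
    by rewrite -!comp_assoc p2wj zero_comp_l comp_assoc (null_zero n2).
apply: (normalization_mono nw); apply: (pullback_ext pb); rewrite -!comp_assoc.
  rewrite p1wj (normalization_act nX) copair_flat_map comp_id_r.
  by rewrite copair_comp p1wi p1wj.
rewrite p2wj !zero_comp_l copair_comp p2wi p2wj.
by rewrite copair_zero_flat_ker.
Qed.

Lemma px_semidirect_regular_epi X Y T S (inX : X ~> T) (inY : Y ~> T)
    (j : X ~> S) (i : Y ~> S) (l : T ~> S) :
  is_px_semidirect j i -> l ∘ inX = j -> l ∘ inY = i -> regular_epi l.
Proof.
move=> [p [_ [_ [_ [_ [_ [_ [_ [_ [[pi [kj _]] _]]]]]]]]]] ej ei; apply/px_regular_epi.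
apply: (regular_epi_cancel (@sa_regular C)
  (f := copair (underlying inY) (underlying inX))).
rewrite copair_comp -!underlying_comp ej ei.
exact: point_copair_regular_epi pi kj.
Qed.

(** * The Peiffer product and the Peiffer commutator *)

Lemma peiffer_product_regular_epi X Y T Q (inX : X ~> T) (inY : Y ~> T) (σ : T ~> Q) :
  is_peiffer_product inX inY σ -> regular_epi σ.
Proof.
move=> [co [S [S' [jX [iY [jY [iX [l [r [a [b [sd [sd' [l1 [l2 [r1 [r2 [po ->]]]]]]]]]]]]]]]]]].
apply: (regular_epi_comp (@px_regular C B)).
  apply: (pushout_regular_epi po).
  exact: (px_semidirect_regular_epi sd' r2 r1).
exact: (px_semidirect_regular_epi sd l1 l2).
Qed.

Lemma peiffer_product_factor X Y T Q W (inX : X ~> T) (inY : Y ~> T) (σ : T ~> Q)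
    (u : T ~> W) : is_peiffer_product inX inY σ ->
  (exists v : Q ~> W, v ∘ σ = u) <->
  extends_to_semidirect (u ∘ inX) (u ∘ inY) /\ extends_to_semidirect (u ∘ inY) (u ∘ inX).
Proof.
move=> [co [S [S' [jX [iY [jY [iX [l [r [a [b [sd [sd' [l1 [l2 [r1 [r2 [po ->]]]]]]]]]]]]]]]]]].
split.
- move=> [v <-]; split.
    apply/(extends_to_semidirectP _ _ sd); exists (v ∘ a).
    by rewrite -l1 -l2 !comp_assoc.
  apply/(extends_to_semidirectP _ _ sd'); exists (v ∘ b).
  have [e _] := po.
  by rewrite -r1 -r2 e !comp_assoc.
- move=> [/(extends_to_semidirectP _ _ sd) [v [v1 v2]]].
  move=> /(extends_to_semidirectP _ _ sd') [v' [v1' v2']].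
  have [_ up] := po; case: (up W v v').
    apply: (coproduct_ext co); rewrite !comp_assoc ?l1 ?l2 ?r1 ?r2.
      by rewrite v1 v2'.
    by rewrite v2 v1'.
  move=> h [[h1 h2] _]; exists h; rewrite -comp_assoc h1.
  by apply: (coproduct_ext co); rewrite comp_assoc ?l1 ?l2.
Qed.

Lemma peiffer_product_ex X Y : exists (T Q : PXMod B) (inX : X ~> T) (inY : Y ~> T)
  (σ : T ~> Q), is_peiffer_product inX inY σ.
Proof.
case: (px_coproduct_ex X Y) => T [inX [inY co]].
case: (px_semidirect_ex X Y) => S [jX [iY sd]].
case: (px_semidirect_ex Y X) => S' [jY [iX sd']].
case: (coproduct_lift co jX iY) => l [l1 l2]; case: (coproduct_lift co iX jY) => r [r1 r2].
case: (regular_epi_pushout (@px_barr_exact C B) (@px_protomodular C B)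
  (px_semidirect_regular_epi sd l1 l2) (px_semidirect_regular_epi sd' r2 r1)).
move=> Q [a [b [po _]]]; exists T, Q, inX, inY, (a ∘ l); split=> //.
by exists S, S', jX, iY, jY, iX, l, r, a, b.
Qed.

Lemma peiffer_commutator_ex X Y A (m : X ~> A) (n : Y ~> A) : mono m -> mono n ->
  exists (D : PXMod B) (c : D ~> A), is_peiffer_commutator m n c.
Proof.
move=> mm mn; case: (peiffer_product_ex X Y) => T [Q [inX [inY [σ pp]]]].
case: (coproduct_lift (proj1 pp) m n) => h [h1 h2].
case: (kernel_ex (@px_barr_exact C B) (@px_quasi_pointed C B) σ) => N [k kk].
case: (image_ex (@px_regular C B) (h ∘ k)) => D [e [c im]].
exists D, c; split=> //; split=> //.
by exists T, Q, N, inX, inY, σ, h, k, e.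
Qed.

Lemma peiffer_commutator_mono X Y A D (m : X ~> A) (n : Y ~> A) (c : D ~> A) :
  is_peiffer_commutator m n c -> mono c.
Proof.
by move=> [_ [_ [T [Q [N [inX [inY [σ [h [k [e [_ [_ [_ [_ [_ []]]]]]]]]]]]]]]]].
Qed.

Lemma peiffer_commutator_sym X Y A D (m : X ~> A) (n : Y ~> A) (c : D ~> A) :
  is_peiffer_commutator m n c -> is_peiffer_commutator n m c.
Proof.
move=> [mm [mn [T [Q [N [inX [inY [σ [h [k [e [pp [h1 [h2 [kk im]]]]]]]]]]]]]]].
split=> //; split=> //; exists T, Q, N, inY, inX, σ, h, k, e; split=> //.
have [co [S [S' [jX [iY [jY [iX [l [r [a [b [sd [sd' [l1 [l2 [r1 [r2 [po es]]]]]]]]]]]]]]]]]]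
  := pp.
split; first exact: coproduct_sym.
exists S', S, jY, iX, jX, iY, r, l, b, a; do 6!split=> //.
split; first exact: pushout_sym.
by case: po => <- _.
Qed.

(** The conditions for factoring through [σ'] restrict along [x] and [y], which
    gives [d]. If [x] and [y] are regular epic the conditions also descend, so
    that the pushout [P] of [t] and [σ] receives a morphism from the Peiffer
    product [Q']; hence elements of the kernel of [σ'] are null in [P] and lift
    to the kernel of [σ]. *)
Lemma peiffer_commutator_map X Y A D X' Y' A' D' (m : X ~> A) (n : Y ~> A) (c : D ~> A)
    (m' : X' ~> A') (n' : Y' ~> A') (c' : D' ~> A')
    (h : A ~> A') (x : X ~> X') (y : Y ~> Y') :
  is_peiffer_commutator m n c -> is_peiffer_commutator m' n' c' ->
  h ∘ m = m' ∘ x -> h ∘ n = n' ∘ y ->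
  exists d : D ~> D', c' ∘ d = h ∘ c /\
    (regular_epi x -> regular_epi y -> regular_epi d).
Proof.
move=> [_ [_ [T [Q [N [inX [inY [σ [f [k [e [pp [f1 [f2 [kk [re [mc ec]]]]]]]]]]]]]]]]].
move=> [_ [_ [T' [Q' [N' [inX' [inY' [σ' [f' [k' [e' [pp' [f1' [f2' [kk' [re' [mc' ec']]]]]]]]]]]]]]]]].
move=> hm hn; have [co _] := pp; have [co' _] := pp'.
case: (coproduct_lift co (inX' ∘ x) (inY' ∘ y)) => t [t1 t2].
have ft : f' ∘ t = h ∘ f.
  apply: (coproduct_ext co); rewrite !comp_assoc ?t1 ?t2 -comp_assoc.
    by rewrite f1' f1 hm.
  by rewrite f2' f2 hn.
have [q eq] : exists q : Q ~> Q', q ∘ σ = σ' ∘ t.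
  apply/(peiffer_product_factor _ pp); rewrite !comp_assoc t1 t2 -!comp_assoc.
  have [] := proj1 (peiffer_product_factor σ' pp') (ex_intro _ (idm Q') (comp_id_l σ')).
  by split; apply: extends_to_semidirect_restrict.
case: (kernel_lift kk' (x := t ∘ k)) => [|ν eν].
  by rewrite -comp_assoc -eq comp_assoc; apply: null_comp_l; apply: kernel_null.
case: (@regular_epi_mono_diagonal _ _ _ _ _ e c' (e' ∘ ν) (h ∘ c) re mc').
  by crwl ec'; rewrite eν; crw ft; rewrite ec.
move=> d [de cd]; exists d; split=> // rx ry.
apply: (regular_epi_cancel (@px_regular C B) (f := e)); rewrite de.
apply: (regular_epi_comp (@px_regular C B)) => //.
have rt : regular_epi t by apply: (coproduct_regular_epi (@px_regular C B) co' t1 t2).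
case: (regular_epi_pushout (@px_barr_exact C B) (@px_protomodular C B) rt
  (peiffer_product_regular_epi pp)) => P [u [v [[euv _] [_ lift]]]].
have [ω eω] : exists ω : Q' ~> P, ω ∘ σ' = u.
  apply/(peiffer_product_factor _ pp').
  have [c1 c2] := proj1 (peiffer_product_factor (u ∘ t) pp) (ex_intro _ v (eq_sym euv)).
  split; apply: extends_to_semidirect_descend; try eassumption;
    by rewrite !comp_assoc -?t1 -?t2 -!comp_assoc.
have n1 : null (u ∘ k').
  by rewrite -eω comp_assoc; apply: null_comp_l; apply: kernel_null.
case: (null_target Q n1) => z nz.
case: (lift N' k' z) => [|V [ε [τ [rε [τ1 τ2]]]]].
  by apply: (null_unique (@px_quasi_pointed C B) n1); apply: null_comp_l.
case: (kernel_lift kk (x := τ)) => [|τ' eτ].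
  by rewrite τ2; apply: null_comp_r.
apply: (regular_epi_cancel (@px_regular C B) (f := τ')).
suff -> : ν ∘ τ' = ε by [].
apply: (kernel_mono (@px_quasi_pointed C B) kk').
by crw eν; rewrite eτ.
Qed.

(** A morphism that kills [n] kills the commutator: it extends over both
    semidirect products, as one of the two components is null. *)
Lemma peiffer_commutator_null X Y A D W (m : X ~> A) (n : Y ~> A) (c : D ~> A)
    (g : A ~> W) : is_peiffer_commutator m n c -> null (g ∘ n) -> null (g ∘ c).
Proof.
move=> [_ [_ [T [Q [N [inX [inY [σ [f [k [e [pp [f1 [f2 [kk [re [mc ec]]]]]]]]]]]]]]]]] ng.
have [v ev] : exists v : Q ~> W, v ∘ σ = g ∘ f.
  apply/(peiffer_product_factor _ pp); rewrite !comp_assoc f1 f2.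
  by split; [apply: extends_to_semidirect_null_r | apply: extends_to_semidirect_null_l].
apply: (null_regular_epi (@px_quasi_pointed C B) re).
rewrite comp_assoc -ec -comp_assoc -ev comp_assoc; apply: null_comp_l.
exact: kernel_null.
Qed.

(** As one of the subobjects is everything, the coproduct maps onto [A] by a
    split epimorphism, and regular images of kernels are kernels. *)
Lemma peiffer_commutator_kernel X A D (m : X ~> A) (c : D ~> A) :
  is_peiffer_commutator m (idm A) c -> exists (P : PXMod B) (u : A ~> P), is_kernel c u.
Proof.
move=> [_ [_ [T [Q [N [inX [inY [σ [f [k [e [pp [f1 [f2 [kk im]]]]]]]]]]]]]]].
apply: (regular_image_kernel (@px_barr_exact C B) (@px_protomodular C B)
  (@px_quasi_pointed C B) kk _ _ im).
  exact: peiffer_product_regular_epi pp.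
exact: split_epi_regular f2.
Qed.

End PeifferCommutators.

(** * The five-term exact sequence *)

Section FiveTerm.
Context {C : SemiAbelian} {B : C}.
Context (K X Y P : PXMod B) (f : K ~> X) (g : X ~> Y) (p : P ~> X).
Context (kf : is_kernel f g).
Let hE := @px_barr_exact C B.
Let hC := @px_regular C B.
Let hP := @px_protomodular C B.
Let hq := @px_quasi_pointed C B.

(** Normality passes from [A] to a subobject [M] that contains [D]: commutators
    are normal where they are formed, but divided out of smaller objects. *)
Lemma kernel_restrict (D M A Q : PXMod B) (c : D ~> A) (u : A ~> Q) (m : M ~> A)
    (n : D ~> M) : is_kernel c u -> mono m -> m ∘ n = c -> is_kernel n (u ∘ m).
Proof.
move=> kc mm en; apply: (kernel_intro hq).
- by move=> W a b e; apply: (kernel_mono hq kc); rewrite -en !comp_assoc e.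
- by rewrite comp_assoc en; apply: kernel_null.
- move=> W x; rewrite comp_assoc => /(kernel_lift kc) [l el]; exists l.
  by apply: mm; rewrite -comp_assoc en.
Qed.

(** <A, L> lies in <A, A> by monotonicity, and in [L] because [h] kills [L] and
    therefore the commutator. *)
Lemma commutator_in_meet (A L Q D DD M : PXMod B) (l : L ~> A) (h : A ~> Q)
    (c : D ~> A) (cc : DD ~> A) (m : M ~> L) (m' : M ~> DD) :
  is_kernel l h -> is_peiffer_commutator (idm A) l c ->
  is_peiffer_commutator (idm A) (idm A) cc -> is_pullback l cc m m' ->
  exists n : D ~> M, l ∘ m ∘ n = c.
Proof.
move=> kl hc hcc pb.
case: (kernel_lift kl (peiffer_commutator_null hc (kernel_null kl))) => a ea.
case: (peiffer_commutator_map (h := idm A) (x := idm A) (y := l) hc hcc) => // b [eb _].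
case: (pullback_lift pb (a := a) (b := b)) => [|n [n1 _]].
  by rewrite ea eb comp_id_l.
by exists n; rewrite comp_assoc n1.
Qed.

Lemma meet_mono (A L DD M : PXMod B) (l : L ~> A) (cc : DD ~> A)
    (m : M ~> L) (m' : M ~> DD) :
  mono l -> mono cc -> is_pullback l cc m m' -> mono (l ∘ m).
Proof.
move=> ml mcc pb W a b; rewrite !comp_assoc => e.
apply: (pullback_ext pb); first exact: ml.
by apply: mcc; rewrite -!comp_assoc -(pullback_comm pb) !comp_assoc.
Qed.

Lemma commutator_quotient_ex (A L D M : PXMod B) (l : L ~> A) (c : D ~> A)
    (m : M ~> A) (n : D ~> M) :
  is_peiffer_commutator (idm A) l c -> mono m -> m ∘ n = c ->
  exists (Q : PXMod B) (q : M ~> Q), is_cokernel q n.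
Proof.
move=> /peiffer_commutator_sym /peiffer_commutator_kernel [R [u ku]] mm en.
exact: (cokernel_of_kernel_ex hE hP hq (kernel_restrict ku mm en)).
Qed.

Lemma commutator_quotient_kernel (A L D M Q : PXMod B) (l : L ~> A) (c : D ~> A)
    (m : M ~> A) (n : D ~> M) (q : M ~> Q) :
  is_peiffer_commutator (idm A) l c -> mono m -> m ∘ n = c ->
  is_cokernel q n -> is_kernel n q.
Proof.
move=> /peiffer_commutator_sym /peiffer_commutator_kernel [R [u ku]] mm en.
exact: (cokernel_kernel hq (kernel_restrict ku mm en)).
Qed.

Lemma five_term_objects_ex : inhabited (FiveTermObjects f g p).
Proof.
have idmono : forall A : PXMod B, mono (idm A) by move=> A W a b; rewrite !comp_id_l.
have mf := kernel_mono hq kf.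
case: (kernel_ex hE hq p) => Kp [kp kkp]; have mkp := kernel_mono hq kkp.
case: (kernel_ex hE hq (g ∘ p)) => Kgp [kgp kkgp]; have mkgp := kernel_mono hq kkgp.
case: (peiffer_commutator_ex (idmono P) (idmono P)) => PP [cPP hPP].
case: (peiffer_commutator_ex (idmono P) mkp) => PKp [cPKp hPKp].
case: (peiffer_commutator_ex (idmono P) mkgp) => PKgp [cPKgp hPKgp].
case: (peiffer_commutator_ex mf (idmono X)) => KX [cKX hKX].
case: (peiffer_commutator_ex (idmono X) (idmono X)) => XX [cXX hXX].
case: (peiffer_commutator_ex (idmono Y) (idmono Y)) => YY [cYY hYY].
have mPP := peiffer_commutator_mono hPP.
case: (pullback_ex hC kp cPP) => M1 [m1 [m1' pb1]].
case: (pullback_ex hC kgp cPP) => M2 [m2 [m2' pb2]].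
case: (commutator_in_meet kkp hPKp hPP pb1) => n1 en1.
case: (commutator_in_meet kkgp hPKgp hPP pb2) => n2 en2.
have hXK := peiffer_commutator_sym hKX.
case: (kernel_lift kf (peiffer_commutator_null hXK (kernel_null kf))) => n3 en3.
case: (commutator_quotient_ex hPKp (meet_mono mkp mPP pb1) en1) => Q1 [q1 hq1].
case: (commutator_quotient_ex hPKgp (meet_mono mkgp mPP pb2) en2) => Q2 [q2 hq2].
case: (commutator_quotient_ex hXK mf en3) => Q3 [q3 hq3].
case: (commutator_quotient_ex hXX (idmono X) (comp_id_l cXX)) => Q4 [q4 hq4].
case: (commutator_quotient_ex hYY (idmono Y) (comp_id_l cYY)) => Q5 [q5 hq5].
exact: (inhabits (Build_FiveTermObjects kkp kkgp hPP hPKp hPKgp hKX hXX hYY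
  pb1 pb2 en1 en2 en3 hq1 hq2 hq3 hq4 hq5)).
Qed.

Context (rg : regular_epi g) (rp : regular_epi p) (D : FiveTermObjects f g p).

Let hPP := ft_cPPP D.
Let hXX := ft_cXXP D.
Let hYY := ft_cYYP D.
Let hXK := peiffer_commutator_sym (ft_cKXP D).
Let mf : mono f := kernel_mono hq kf.
Let mkgp : mono (ft_kgp D) := kernel_mono hq (ft_kgpP D).
Let rq2 := cokernel_regular_epi (quot2P D).

Lemma kernel_restriction_regular_epi (j0 : ft_Kgp D ~> K) :
  f ∘ j0 = p ∘ ft_kgp D -> regular_epi j0.
Proof.
move=> ej; case: (lift_along hC f rp) => W [e [x [re ex]]].
case: (kernel_lift (ft_kgpP D) (x := x)) => [|l el].
  by rewrite comp_assoc ex -comp_assoc; apply: null_comp_r; apply: kernel_null.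
apply: (regular_epi_cancel hC (f := l)).
suff -> : j0 ∘ l = e by [].
by apply: mf; rewrite -comp_assoc ej comp_assoc el.
Qed.

(** [p] maps P onto X and K[gp] onto K, and commutators are compatible with
    regular images. *)
Lemma PKgp_onto_KX (j : ft_M2 D ~> K) : f ∘ j = p ∘ (ft_kgp D ∘ ft_m2 D) ->
  exists d : ft_PKgp D ~> ft_KX D, regular_epi d /\ ft_n3 D ∘ d = j ∘ ft_n2 D.
Proof.
move=> ej; case: (kernel_lift kf (x := p ∘ ft_kgp D)) => [|j0 ej0].
  by rewrite -comp_assoc; apply: kernel_null (ft_kgpP D).
case: (peiffer_commutator_map (h := p) (x := p) (y := j0) (ft_cPKgpP D) hXK).
- by rewrite comp_id_l comp_id_r.
- by rewrite ej0.
move=> d [ed rd]; exists d; split.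
  exact: rd rp (kernel_restriction_regular_epi ej0).
apply: mf; rewrite -!comp_assoc ej (ft_n3P D) ed -(ft_n2P D).
by rewrite !comp_assoc.
Qed.

Lemma PP_onto_XX : exists d : ft_PP D ~> ft_XX D,
  ft_cXX D ∘ d = p ∘ ft_cPP D /\ regular_epi d.
Proof.
case: (peiffer_commutator_map (h := p) (x := p) (y := p) hPP hXX) => [||d [ed rd]].
- by rewrite comp_id_l comp_id_r.
- by rewrite comp_id_l comp_id_r.
by exists d; split=> //; apply: rd.
Qed.

Lemma XX_onto_YY : exists d : ft_XX D ~> ft_YY D,
  ft_cYY D ∘ d = g ∘ ft_cXX D /\ regular_epi d.
Proof.
case: (peiffer_commutator_map (h := g) (x := g) (y := g) hXX hYY) => [||d [ed rd]].
- by rewrite comp_id_l comp_id_r.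
- by rewrite comp_id_l comp_id_r.
by exists d; split=> //; apply: rd.
Qed.

Let kXX : is_kernel (ft_cXX D) (quot4 D).
Proof.
apply: (commutator_quotient_kernel hXX (m := idm X) _ (comp_id_l _) (quot4P D)).
by move=> W a b; rewrite !comp_id_l.
Qed.

Let kYY : is_kernel (ft_cYY D) (quot5 D).
Proof.
apply: (commutator_quotient_kernel hYY (m := idm Y) _ (comp_id_l _) (quot5P D)).
by move=> W a b; rewrite !comp_id_l.
Qed.

Let kKX : is_kernel (ft_n3 D) (quot3 D).
Proof. exact: (commutator_quotient_kernel hXK mf (ft_n3P D) (quot3P D)). Qed.

(** An element of M2 whose image in K lies in <K, X> has the same image as an
    element of <P, K[gp]>; commuting the kernel pairs of [j] and of the quotient
    replaces it by an element of K[p] ∧ <P, P> without changing its class. *)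
Lemma exact_at_quot2 (i : ft_M1 D ~> ft_M2 D) (j : ft_M2 D ~> K)
    (u1 : ft_Q1 D ~> ft_Q2 D) (u2 : ft_Q2 D ~> ft_Q3 D) :
  ft_kgp D ∘ ft_m2 D ∘ i = ft_kp D ∘ ft_m1 D ->
  f ∘ j = p ∘ (ft_kgp D ∘ ft_m2 D) ->
  u1 ∘ quot1 D = quot2 D ∘ i -> u2 ∘ quot2 D = quot3 D ∘ j ->
  exact_at u1 u2.
Proof.
move=> ei ej eu1 eu2; have rq1 := cokernel_regular_epi (quot1P D).
have ji : null (j ∘ i).
  apply: (null_mono hq mf); rewrite -comp_assoc ej comp_assoc ei -comp_assoc.
  by apply: null_comp_r; apply: kernel_null (ft_kpP D).
case: (PKgp_onto_KX ej) => d [rd ed].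
apply: (exact_of_lift hE hq rq2).
  apply: (null_regular_epi hq rq1).
  by rewrite comp_assoc eu1 -comp_assoc eu2 comp_assoc; apply: null_comp_l.
move=> W m; rewrite -comp_assoc eu2 comp_assoc => /(kernel_lift kKX) [a ea].
case: (lift_along hC a rd) => W1 [e1 [b [re1 eb]]].
have nb : null (quot2 D ∘ (ft_n2 D ∘ b)).
  by rewrite -comp_assoc; apply: null_comp_r; apply: cokernel_null (quot2P D).
case: (null_target (ft_M2 D) nb) => z nz.
case: (kernel_pairs_commute hC hP (g := j) (q := quot2 D)
  (x := m ∘ e1) (x' := ft_n2 D ∘ b) (x'' := z)) => [||W2 [e2 [m' [re2 [em' jm']]]]].
- by rewrite -(comp_assoc j) -ea comp_assoc -eb -!comp_assoc ed.
- by apply: (null_unique hq nb); apply: null_comp_l.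
have nm' : null (j ∘ m') by rewrite jm'; apply: null_comp_r; apply: null_comp_l.
case: (kernel_lift (ft_kpP D) (x := ft_kgp D ∘ (ft_m2 D ∘ m'))) => [|k ek].
  have -> : p ∘ (ft_kgp D ∘ (ft_m2 D ∘ m')) = f ∘ (j ∘ m').
    by crw ej.
  exact: null_comp_l.
case: (pullback_lift (ft_m1P D) (a := k) (b := ft_m2' D ∘ m')) => [|m1 [em1 _]].
  by rewrite ek -!comp_assoc (pullback_comm (ft_m2P D)).
have em : i ∘ m1 = m'.
  apply: (meet_mono mkgp (peiffer_commutator_mono hPP) (ft_m2P D)).
  by rewrite -comp_assoc ei comp_assoc em1 ek !comp_assoc.
exists W2, (e1 ∘ e2), (quot1 D ∘ m1); split; first exact: regular_epi_comp.
by rewrite -comp_assoc eu1 comp_assoc em em' !comp_assoc.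
Qed.

(** An element of K that lies in <X, X> lifts to <P, P>, and the lift lies in
    K[gp]. *)
Lemma exact_at_quot3 (j : ft_M2 D ~> K)
    (u2 : ft_Q2 D ~> ft_Q3 D) (u3 : ft_Q3 D ~> ft_Q4 D) :
  f ∘ j = p ∘ (ft_kgp D ∘ ft_m2 D) ->
  u2 ∘ quot2 D = quot3 D ∘ j -> u3 ∘ quot3 D = quot4 D ∘ f -> exact_at u2 u3.
Proof.
move=> ej eu2 eu3; have rq3 := cokernel_regular_epi (quot3P D).
case: PP_onto_XX => d [ed rd].
apply: (exact_of_lift hE hq rq3).
  apply: (null_regular_epi hq rq2).
  rewrite comp_assoc eu2 -comp_assoc eu3 comp_assoc ej (pullback_comm (ft_m2P D)).
  rewrite -(comp_assoc p) -ed -!comp_assoc.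
  by do 2!apply: null_comp_r; apply: cokernel_null (quot4P D).
move=> W k; rewrite -comp_assoc eu3 comp_assoc => /(kernel_lift kXX) [a ea].
case: (lift_along hC a rd) => W1 [e1 [b [re1 eb]]].
have pb : p ∘ (ft_cPP D ∘ b) = f ∘ (k ∘ e1).
  by rewrite -comp_assoc -ed comp_assoc eb -!comp_assoc ea.
case: (kernel_lift (ft_kgpP D) (x := ft_cPP D ∘ b)) => [|l el].
  by rewrite comp_assoc pb -comp_assoc; apply: null_comp_r; apply: kernel_null.
case: (pullback_lift (ft_m2P D) el) => m [m1 m2].
exists W1, e1, (quot2 D ∘ m); split=> //.
have jm : j ∘ m = k ∘ e1.
  by apply: mf; rewrite -comp_assoc ej !comp_assoc m1 el pb.
by rewrite -comp_assoc eu2 comp_assoc jm comp_assoc.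
Qed.

(** If g x lies in <Y, Y> then g x = g x' with x' in <X, X>; commuting the kernel
    pairs of [g] and of the quotient by <X, X> replaces x by an element of K. *)
Lemma exact_at_quot4 (u3 : ft_Q3 D ~> ft_Q4 D) (gbar : ft_Q4 D ~> ft_Q5 D) :
  u3 ∘ quot3 D = quot4 D ∘ f -> gbar ∘ quot4 D = quot5 D ∘ g -> exact_at u3 gbar.
Proof.
move=> eu3 eg; have rq3 := cokernel_regular_epi (quot3P D).
have rq4 := cokernel_regular_epi (quot4P D).
case: XX_onto_YY => d [ed rd].
apply: (exact_of_lift hE hq rq4).
  apply: (null_regular_epi hq rq3).
  rewrite comp_assoc eu3 -comp_assoc eg comp_assoc.
  by apply: null_comp_l; apply: kernel_null.
move=> W x; rewrite -comp_assoc eg comp_assoc => /(kernel_lift kYY) [a ea].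
case: (lift_along hC a rd) => W1 [e1 [b [re1 eb]]].
have nb : null (quot4 D ∘ (ft_cXX D ∘ b)).
  by rewrite -comp_assoc; apply: null_comp_r; apply: kernel_null.
case: (null_target X nb) => z nz.
case: (kernel_pairs_commute hC hP (g := g) (q := quot4 D)
  (x := x ∘ e1) (x' := ft_cXX D ∘ b) (x'' := z)) => [||W2 [e2 [y [re2 [ey gy]]]]].
- by rewrite -(comp_assoc g) -ea comp_assoc -eb -!comp_assoc ed.
- by apply: (null_unique hq nb); apply: null_comp_l.
case: (kernel_lift kf (x := y)) => [|k ek].
  by rewrite gy; apply: null_comp_r; apply: null_comp_l.
exists W2, (e1 ∘ e2), (quot3 D ∘ k); split; first exact: regular_epi_comp.
by rewrite -comp_assoc eu3 comp_assoc ek ey !comp_assoc.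
Qed.

Lemma five_term_sequence :
  exists (i : ft_M1 D ~> ft_M2 D) (j : ft_M2 D ~> K)
    (u1 : ft_Q1 D ~> ft_Q2 D) (u2 : ft_Q2 D ~> ft_Q3 D)
    (u3 : ft_Q3 D ~> ft_Q4 D) (gbar : ft_Q4 D ~> ft_Q5 D),
    ft_kgp D ∘ ft_m2 D ∘ i = ft_kp D ∘ ft_m1 D /\
    f ∘ j = p ∘ (ft_kgp D ∘ ft_m2 D) /\
    u1 ∘ quot1 D = quot2 D ∘ i /\
    u2 ∘ quot2 D = quot3 D ∘ j /\
    u3 ∘ quot3 D = quot4 D ∘ f /\
    gbar ∘ quot4 D = quot5 D ∘ g /\
    exact_at u1 u2 /\ exact_at u2 u3 /\ exact_at u3 gbar /\
    regular_epi gbar.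
Proof.
have nkp : null (p ∘ ft_kp D) := kernel_null (ft_kpP D).
case: (kernel_lift (ft_kgpP D) (x := ft_kp D)) => [|k0 ek0].
  by rewrite comp_assoc; apply: null_comp_l.
case: (pullback_lift (ft_m2P D) (a := k0 ∘ ft_m1 D) (b := ft_m1' D)) => [|i [i1 i2]].
  by rewrite -comp_assoc ek0 (pullback_comm (ft_m1P D)).
have ei : ft_kgp D ∘ ft_m2 D ∘ i = ft_kp D ∘ ft_m1 D.
  by rewrite comp_assoc i1 -comp_assoc ek0.
case: (kernel_lift kf (x := p ∘ (ft_kgp D ∘ ft_m2 D))) => [|j ej].
  by rewrite -!comp_assoc; apply: null_comp_r; apply: kernel_null (ft_kgpP D).
(* [u1] is well defined because <P, K[p]> is contained in <P, K[gp]>. *)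
case: (peiffer_commutator_map (h := idm P) (x := idm P) (y := k0)
  (ft_cPKpP D) (ft_cPKgpP D)) => [||c [ec _]]; rewrite ?comp_id_l ?ek0 //.
have en : i ∘ ft_n1 D = ft_n2 D ∘ c.
  apply: (meet_mono mkgp (peiffer_commutator_mono hPP) (ft_m2P D)).
  by rewrite -!(comp_assoc (ft_kgp D ∘ ft_m2 D)) ei (ft_n1P D) (ft_n2P D) ec comp_id_l.
case: (cokernel_lift hq (quot1P D) (h := quot2 D ∘ i)) => [|u1 eu1].
  rewrite comp_assoc en -comp_assoc; apply: null_comp_r.
  exact: cokernel_null (quot2P D).
case: (PKgp_onto_KX ej) => d [_ ed].
case: (cokernel_lift hq (quot2P D) (h := quot3 D ∘ j)) => [|u2 eu2].
  rewrite comp_assoc -ed -comp_assoc; apply: null_comp_r.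
  exact: cokernel_null (quot3P D).
(* [u3] is well defined because <K, X> is contained in <X, X>. *)
case: (peiffer_commutator_map (h := idm X) (x := f) (y := idm X)
  (ft_cKXP D) hXX) => [||c' [ec' _]]; rewrite ?comp_id_l //.
case: (cokernel_lift hq (quot3P D) (h := quot4 D ∘ f)) => [|u3 eu3].
  rewrite comp_assoc (ft_n3P D) -(comp_id_l (ft_cKX D)) -ec' -comp_assoc.
  by apply: null_comp_r; apply: cokernel_null (quot4P D).
case: XX_onto_YY => d' [ed' _].
case: (cokernel_lift hq (quot4P D) (h := quot5 D ∘ g)) => [|gbar eg].
  rewrite comp_assoc -ed' -comp_assoc; apply: null_comp_r.
  exact: cokernel_null (quot5P D).
exists i, j, u1, u2, u3, gbar; do 6!split=> //.
split; first exact: exact_at_quot2 ei ej eu1 eu2.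
split; first exact: exact_at_quot3 ej eu2 eu3.
split; first exact: exact_at_quot4 eu3 eg.
apply: (regular_epi_cancel hC (f := quot4 D)); rewrite eg.
by apply: (regular_epi_comp hC) rg; exact: cokernel_regular_epi (quot5P D).
Qed.

End FiveTerm.

Theorem proposition3p1 (C : SemiAbelian) (hUA : condition_UA C) (B : C)
    (hproj : enough_projectives (PXMod B))
    (K X Y P : PXMod B) (f : K ~> X) (g : X ~> Y) (p : P ~> X)
    (hfg : short_exact f g) (hp : projective_presentation p) :
  inhabited (FiveTermObjects f g p) /\
  forall D : FiveTermObjects f g p,
  exists (i : ft_M1 D ~> ft_M2 D) (j : ft_M2 D ~> K)
    (u1 : ft_Q1 D ~> ft_Q2 D) (u2 : ft_Q2 D ~> ft_Q3 D)
    (u3 : ft_Q3 D ~> ft_Q4 D) (gbar : ft_Q4 D ~> ft_Q5 D),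
    (* i is the inclusion and j the restriction of p *)
    ft_kgp D ∘ ft_m2 D ∘ i = ft_kp D ∘ ft_m1 D /\
    f ∘ j = p ∘ (ft_kgp D ∘ ft_m2 D) /\
    (* the morphisms of the sequence are induced by i, j, f and g *)
    u1 ∘ quot1 D = quot2 D ∘ i /\
    u2 ∘ quot2 D = quot3 D ∘ j /\
    u3 ∘ quot3 D = quot4 D ∘ f /\
    gbar ∘ quot4 D = quot5 D ∘ g /\
    exact_at u1 u2 /\ exact_at u2 u3 /\ exact_at u3 gbar /\
    regular_epi gbar.
Proof.
have [kf rg] := hfg; have [_ rp] := hp.
split; first exact: five_term_objects_ex kf.
by move=> D; apply: five_term_sequence.
Qed.
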